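(* Let $X$ be a subordinator with drift $\mathrm{d}\ge0$ and infinite Lévy measure $\Pi$. Then for every $t>0$, $$\frac{L(t,\delta)-t\,\mu(\delta)}{t^{1/2}\,v(\delta)}\ \overset{d}{\longrightarrow}\ \mathcal{N}(0,1)\qquad\text{as }\delta\to0,$$ where $\mu(\delta):=\frac1\delta\big(\mathrm{d}+I(\delta)\big)$ with $I(\delta):=\int_0^\delta\Pi((y,\infty))\,dy$, and $v(\delta):=\frac1\delta\Big[\int_0^\infty(x\wedge\delta)^2\,\Pi(dx)\Big]^{1/2}$.
   Context: A subordinator is a non-decreasing real-valued Lévy process started at $0$ (càdlàg paths, stationary independent increments). Its law is determined by $\mathbb{E}[e^{-\lambda X_1}]=e^{-\Phi(\lambda)}$, $\lambda\ge0$, with $\Phi(\lambda)=\mathrm{d}\lambda+\int_0^\infty(1-e^{-\lambda x})\,\Pi(dx)$, where $\mathrm{d}\ge 0$ is the drift and $\Pi$ is the Lévy measure on $(0,\infty)$, satisfying $\int_0^\infty(1\wedge x)\,\Pi(dx)<\infty$. ''Infinite Lévy measure'' means $\Pi((0,\infty))=\infty$. One has $X_t=\mathrm{d}t+\sum_{0<s\le t}\Delta X_s$ with $\Delta X_s:=X_s-X_{s-}$. For $\delta>0$, the process of $\delta$-shortened jumps $\tilde X^\delta=(\tilde X^\delta_t)_{t\ge0}$ is obtained from $X$ by shortening every jump of size larger than $\delta$ to have size exactly $\delta$, i.e. $\tilde X^\delta_t=\mathrm{d}t+\sum_{0<s\le t}(\Delta X_s\wedge\delta)$. Define $L(t,\delta):=\frac1\delta\tilde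 X^\delta_t$. $\overset{d}{\to}$ denotes convergence in distribution. *)

(* Defs.v *)
From HB Require Import structures.
From mathcomp Require Import all_boot all_order all_algebra.
From mathcomp Require Import all_classical all_reals all_analysis.

Set Implicit Arguments.
Unset Strict Implicit.
Unset Printing Implicit Defensive.

Import Order.TTheory GRing.Theory Num.Theory.
Import numFieldNormedType.Exports.

Local Open Scope classical_set_scope.
Local Open Scope ring_scope.

Section independence.
Context (disp : measure_display) (T : measurableType disp) (R : realType)
  (P : probability T R).

(* Taking some of the [B i] to be [setT] gives the product rule for every
   subfamily. *)
Definition mutually_independent (I : finType) (Y : I -> T -> R) : Prop :=
  forall B : I -> set R, (forall i, measurable (B i)) ->
    (P (\bigcap_i (Y i @^-1` B i)) = \prod_i P (Y i @^-1` B i))%E.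

End independence.

Section convergence_in_distribution.
Context (disp : measure_display) (T : measurableType disp) (R : realType)
  (P : probability T R).

(* The first conjunct says that the [Z i] really are random variables, so that
   the probabilities in the second one are meaningful. *)
Definition cvg_in_distribution (I : Type) (F : set_system I) (Z : I -> T -> R)
    (nu : probability (measurableTypeR R) R) : Prop :=
  (\forall i \near F, measurable_fun [set: T] (Z i)) /\
  (forall x : R, {for x, continuous (fun y : R => nu [set` `]-oo, y]])} ->
    P (Z i @^-1` `]-oo, x]) @[i --> F] --> nu [set` `]-oo, x]]).

End convergence_in_distribution.

(* A process indexed by [0, +oo[ is a family indexed by [R] of which only the
   restriction to nonnegative times is ever used. *)
Section subordinator.
Context (disp : measure_display) (T : measurableType disp) (R : realType)
  (P : probability T R).
Implicit Types (X : R -> {RV P >-> R}) (w : T) (s t delta lambda : R).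

Definition cadlag_paths X : Prop := forall w,
  (forall t, 0 <= t -> X u w @[u --> t^'+] --> X t w) /\
  (forall t, 0 < t -> cvg (X u w @[u --> t^'-])).

Definition stationary_increments X : Prop :=
  forall s t, 0 <= s -> s <= t -> forall B : set R, measurable B ->
    P ((X t \- X s) @^-1` B) = P ((X (t - s) \- X 0) @^-1` B).

Definition independent_increments X : Prop :=
  forall (n : nat) (t : nat -> R), 0 <= t 0%N -> nondecreasing_seq t ->
    mutually_independent P (fun i : 'I_n => X (t i.+1) \- X (t i)).

Definition is_subordinator X : Prop :=
  [/\ forall w, X 0 w = 0,
      forall w s t, 0 <= s -> s <= t -> X s w <= X t w,
      cadlag_paths X,
      stationary_increments X
    & independent_increments X].

(* A measure on ]0, +oo[ is encoded as a Borel measure on [R] that does not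
   charge ]-oo, 0]. *)
Definition is_subordinator_levy_measure
    (Pi : {measure set (measurableTypeR R) -> \bar R}) : Prop :=
  (Pi [set` `]-oo, 0%R]] = 0 /\
   \int[Pi]_(x in `]0%R, +oo[) (Num.min 1 x)%:E < +oo)%E.

Definition laplace_exponent (b : R)
    (Pi : {measure set (measurableTypeR R) -> \bar R}) lambda : R :=
  b * lambda + \int[Pi]_(x in `]0, +oo[) (1 - expR (- (lambda * x))).

Definition has_drift_levy_measure X (b : R)
    (Pi : {measure set (measurableTypeR R) -> \bar R}) : Prop :=
  [/\ 0 <= b,
      is_subordinator_levy_measure Pi
    & forall lambda, 0 <= lambda ->
        ('E_P[fun w => expR (- (lambda * X 1 w))%R] =
         (expR (- laplace_exponent b Pi lambda))%:E)%E].

Definition jump X s w : R := X s w - lim (X u w @[u --> s^'-]).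

Definition shortened (b : R) X delta t w : R :=
  b * t + fine (\esum_(s in `]0, t]) (Num.min (jump X s w) delta)%:E).

Definition L (b : R) X t delta w : R := shortened b X delta t w / delta.

End subordinator.

Section normalization.
Context (R : realType) (b : R)
  (Pi : {measure set (measurableTypeR R) -> \bar R}).

Definition integrated_tail (delta : R) : R :=
  fine (\int[lebesgue_measure]_(y in `]0%R, delta[) Pi [set` `]y, +oo[])%E.

Definition mu (delta : R) : R := (b + integrated_tail delta) / delta.

Definition v (delta : R) : R :=
  Num.sqrt (\int[Pi]_(x in `]0, +oo[) (Num.min x delta) ^+ 2) / delta.

End normalization.

(* Main.v *)
(* Stein's method on the truncated jump functional. Write y = x /\ delta and let
   A be the limit of the sums of (X_{t(k+1)/n} - X_{tk/n}) /\ delta; pathwise it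
   splits as C + J, with J the sum of the shortened jumps and C independent of
   delta. Independence of the increments and the small-time behaviour of E f(X_h)
   give E[A e^{-lambda A}] = t kappa(lambda) E[e^{-lambda A}] with
   kappa(lambda) = b + \int y e^{-lambda y} dPi. Letting delta -> 0 forces
   E[C e^{-lambda C}] = t b E[e^{-lambda C}], hence C = b t almost surely and A is
   the shortened process U. By Weierstrass' theorem the exponential identity
   extends to E[U F(U)] = t E[b F(U) + \int y F(U + y) Pi(dy)] for Lipschitz F
   vanishing at +oo. Taking for F a solution f of Stein's equation, evaluated at
   the standardized variable W with s^2 = t \int y^2 dPi, a Taylor expansion bounds
   |E[f'(W) - W f(W)]| by M delta / s, which tends to 0 because
   s^2 >= t delta^2 Pi(]delta, +oo[) and Pi is infinite. Indicators are finally
   squeezed between ramps. *)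
Require Import Defs.
From HB Require Import structures.
From mathcomp Require Import all_boot all_order all_algebra.
From mathcomp Require Import all_classical all_reals all_analysis.
From mathcomp Require Import measurable_realfun ring lra.

Set Implicit Arguments.
Unset Strict Implicit.
Unset Printing Implicit Defensive.

Import Order.TTheory GRing.Theory Num.Theory.
Import numFieldNormedType.Exports.

Local Open Scope classical_set_scope.
Local Open Scope ring_scope.


(** * Jumps of a nondecreasing càdlàg path *)

(** The law of [X] is given through the Laplace transform of [X 1], whereas the shortened process is
    built from the jumps of each path, and no hypothesis ties these jumps to [Pi]. Truncated
    increments along the grids tk/(n+1) bridge the gap: their joint law is accessible, and their
    pathwise limit contains the shortened jumps. That limit exists because truncated parts and
    excesses over delta add up to [X t], and only cells near finitely many times have an excess. So
    C is [X t] minus all the jumps, whence its independence of delta. The identity for A is the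
    logarithmic derivative of E e^{-lambda A}, obtained without differentiating by weighting one
    factor in a product of independent exponentials. Small times are reached through the weight 1 -
    e^{-x}: its product with e^{-kx} is a difference of consecutive exponentials, so the expectation
    is explicit. Ramps serve as Stein's test functions because they are Lipschitz and constant near
    both infinities: f then decays at least like 1/|x| and may enter an identity stated for
    functions vanishing at +oo, and f' is Lipschitz, as the Taylor expansion requires. *)

Section cadlag_path.
Context (R : realType) (x : R -> R).
Context (xnd : forall s t : R, 0 <= s -> s <= t -> x s <= x t).
Context (xr : forall t : R, 0 <= t -> x u @[u --> t^'+] --> x t).
Context (xl : forall t : R, 0 < t -> cvg (x u @[u --> t^'-])).

Let left s : R := lim (x u @[u --> s^'-]).
Let jmp s : R := x s - left s.

Lemma le_left_limit a s : 0 <= a -> a < s -> x a <= left s.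
Proof.
move=> a0 as_; apply: limr_ge; first exact: xl (le_lt_trans a0 as_).
near=> u; apply: xnd => //; near: u; exact: nbhs_left_ge.
Unshelve. all: by end_near. Qed.

Lemma left_limit_le s : 0 < s -> left s <= x s.
Proof.
move=> s0; apply: limr_le; first exact: xl.
near=> u; apply: xnd; first by near: u; exact: nbhs_left_ge.
by near: u; exact: nbhs_left_le.
Unshelve. all: by end_near. Qed.

Lemma jump_ge0 s : 0 < s -> 0 <= jmp s.
Proof. by move=> s0; rewrite subr_ge0 left_limit_le. Qed.

Lemma jump_le a s : 0 <= a -> a < s -> jmp s <= x s - x a.
Proof. by move=> a0 as_; rewrite lerD2l lerN2 le_left_limit. Qed.

(** * Jump sums bounded by sums of increments *)

Section superadditive.
Context (psi : R -> R).
Context (psi_ge0 : forall a : R, 0 <= a -> 0 <= psi a).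
Context (psi_nd : forall a b : R, 0 <= a -> a <= b -> psi a <= psi b).
Context (psi_add : forall a b : R, 0 <= a -> 0 <= b ->
  psi a + psi b <= psi (a + b)).

(** Cutting []a, b]] at the first jump time [u] gives [jmp u <= x u - x a]; the rest is the same
    problem on []u, b]], and superadditivity glues the two bounds together. *)
Lemma sum_jump_path (s : seq R) a b : 0 <= a -> a <= b ->
  path <%R a s -> all (fun u => u <= b) s ->
  \sum_(u <- s) psi (jmp u) <= psi (x b - x a).
Proof.
elim: s a => [|u s IH] a a0 ab /=.
  by move=> _ _; rewrite big_nil psi_ge0// subr_ge0 xnd.
move=> /andP[au pus] /andP[ub sb].
have u0 : 0 < u by exact: le_lt_trans au.
rewrite big_cons; apply: (@le_trans _ _ (psi (x u - x a) + psi (x b - x u))).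
  apply: lerD; last by apply: IH => //; exact: ltW.
  by apply: psi_nd; [exact: jump_ge0|exact: jump_le].
have := @psi_add (x u - x a) (x b - x u).
rewrite !subr_ge0 !xnd//; [|exact: ltW|exact: ltW].
move=> /(_ isT isT)/le_trans; apply.
by rewrite addrC addrA subrK.
Qed.

Lemma sum_jump_interval (s : seq R) a b : 0 <= a -> a <= b -> uniq s ->
  all (fun u => a < u <= b) s ->
  \sum_(u <- s) psi (jmp u) <= psi (x b - x a).
Proof.
move=> a0 ab us sab.
rewrite (perm_big (sort <=%R s)); last by rewrite perm_sym perm_sort.
apply: sum_jump_path => //.
  have : sorted <%R (sort <=%R s).
    by rewrite lt_sorted_uniq_le sort_uniq us sort_le_sorted.
  have : all (fun u => a < u <= b) (sort <=%R s) by rewrite all_sort.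
  by case: (sort _ _) => //= u s' /andP[/andP[-> _] _] ->.
by rewrite all_sort; apply: sub_all sab => u /andP[].
Qed.

Lemma sum_jump_grid (s : seq R) (g : nat -> R) n : 0 <= g 0%N ->
  {homo g : i j / (i <= j)%N >-> i <= j} -> uniq s ->
  all (fun u => g 0%N < u <= g n) s ->
  \sum_(u <- s) psi (jmp u) <= \sum_(k < n) psi (x (g k.+1) - x (g k)).
Proof.
move=> g0 gnd; elim: n s => [|n IH] s us sg.
  rewrite big_ord0; case: s sg {us} => [|u s]; first by rewrite big_nil.
  by move=> /= /andP[/andP[/lt_le_trans + h] _] => /(_ _ h); rewrite ltxx.
rewrite big_ord_recr/= (bigID (fun u => u <= g n))/=.
rewrite -big_filter -[X in _ + X <= _]big_filter; apply: lerD.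
  apply: IH; first exact: filter_uniq.
  apply/allP => u; rewrite mem_filter => /andP[-> us'].
  by have /allP/(_ _ us')/andP[-> _] := sg.
have gn0 : 0 <= g n by rewrite (le_trans g0)// gnd.
apply: sum_jump_interval => //.
- by rewrite gnd.
- exact: filter_uniq.
- apply/allP => u; rewrite mem_filter -ltNge => /andP[-> us'].
  by have /allP/(_ _ us')/andP[_ ->] := sg.
Qed.

Lemma esum_jump_grid (g : nat -> R) n : g 0%N = 0 ->
  {homo g : i j / (i <= j)%N >-> i <= j} ->
  (\esum_(s in `]0%R, g n]) (psi (jmp s))%:E <=
    (\sum_(k < n) psi (x (g k.+1) - x (g k)))%:E)%E.
Proof.
move=> g0 gnd; apply: ge_ereal_sup => _ [F [finF FI]] <-.
rewrite fsbig_finite//= sumEFin lee_fin; apply: sum_jump_grid => //.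
- by rewrite g0.
- exact: finmap.fset_uniq.
- apply/allP => u; rewrite in_fset_set// inE => /FI /=.
  by rewrite in_itv/= g0.
Qed.

End superadditive.

Lemma left_nbhs (s e : R) : 0 < s -> 0 < e ->
  exists2 h, 0 < h & forall a, s - h < a -> a < s -> left s - e <= x a.
Proof.
move=> s0 e0; have /cvgrPdist_le /(_ _ e0) := xl s0.
rewrite near_withinE => /nbhs_ballP[h /= h0 H]; exists h => // a a1 a2.
have := H a; rewrite /ball/= => /(_ _ a2).
rewrite ltr_norml => H1; have {H1} := H1 _; rewrite ler_norml -/(left s).
by move=> /(_ ltac:(apply/andP; split; lra)) /andP[? ?]; lra.
Qed.

Lemma right_nbhs (s e : R) : 0 <= s -> 0 < e ->
  exists2 h, 0 < h & forall b, s <= b -> b < s + h -> x b <= x s + e.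
Proof.
move=> s0 e0; have /cvgrPdist_le /(_ _ e0) := xr s0.
rewrite near_withinE => /nbhs_ballP[h /= h0 H]; exists h => // b.
rewrite le_eqVlt => /orP[/eqP <- _|b1 b2]; first by rewrite lerDl ltW.
have := H b; rewrite /ball/= => /(_ _ b1).
rewrite ltr_norml => H1; have {H1} := H1 _; rewrite ler_norml.
by move=> /(_ ltac:(apply/andP; split; lra)) /andP[? ?]; lra.
Qed.

Lemma incr_cell_center (s e : R) : 0 < s -> 0 < e ->
  exists2 h, 0 < h & forall a b, s - h < a -> a < s -> s <= b ->
    b < s + h -> x b - x a <= jmp s + e.
Proof.
move=> s0 e0; have e20 : 0 < e / 2 by rewrite divr_gt0.
have [h h0 H] := left_nbhs s0 e20; have [k k0 K] := right_nbhs (ltW s0) e20.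
exists (Num.min h k); first by rewrite lt_min h0 k0.
move=> a b sa as_ sb bs.
have mh : Num.min h k <= h by rewrite ge_min lexx.
have mk : Num.min h k <= k by rewrite ge_min lexx orbT.
have := H a ltac:(lra) as_; have := K b sb ltac:(lra).
by rewrite /jmp; lra.
Qed.

(** A short cell near [s] that avoids [s] lies on one side: if it starts at or after [s], right
    continuity applies; if it ends before [s], the left limit does. Cells are half-open, so [a = s]
    counts as the right side; for [s = 0] the left side is empty. *)
Lemma incr_cell_off_center (s e : R) : 0 <= s -> 0 < e ->
  exists2 h, 0 < h & forall a b, 0 <= a -> a <= b -> s - h < a ->
    b < s + h -> ~~ (a < s <= b) -> x b - x a <= e.
Proof.
move=> s0 e0; have [k k0 K] := right_nbhs s0 e0.
have [h h0 H] : exists2 h, 0 < h & forall a b, 0 <= a -> a <= b -> s - h < a ->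
    b < s -> x b - x a <= e.
  move: s0; rewrite le_eqVlt => /orP[/eqP <-|s0].
    by exists 1 => // a b a0 ab _ b0; lra.
  have [h h0 H] := left_nbhs s0 e0; exists h => // a b a0 ab sa bs.
  have := H a sa (le_lt_trans ab bs).
  by have := le_left_limit (le_trans a0 ab) bs; lra.
exists (Num.min h k); first by rewrite lt_min h0 k0.
move=> a b a0 ab sa bs.
have mh : Num.min h k <= h by rewrite ge_min lexx.
have mk : Num.min h k <= k by rewrite ge_min lexx orbT.
rewrite negb_and -leNgt -ltNge => /orP[sa'|bs'].
  have := K b (le_trans sa' ab) ltac:(lra).
  by have := xnd s0 sa'; lra.
by apply: H => //; lra.
Qed.

(* Lebesgue-number argument: away from finitely many times [D], increments over
   short cells are at most [e]. *)
Lemma small_increments (t e : R) : 0 < t -> 0 < e -> exists (D : seq R) (h : R),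
  [/\ 0 < h, uniq D, all (fun s => 0 < s <= t) D &
   forall a b, 0 <= a -> a <= b -> b <= t -> b - a < h ->
     ~~ has (fun s => a < s <= b) D -> x b - x a <= e].
Proof.
move=> t0 e0.
pose P (s h : R) := 0 < h /\ forall a b : R, 0 <= a -> a <= b -> s - h < a ->
    b < s + h -> ~~ (a < s <= b) -> x b - x a <= e.
have /choice[h hP] : forall s, exists h : R, 0 <= s -> P s h.
  move=> s; have [s0|s0] := leP 0 s; last by exists 0; lra.
  by have [h h0 H] := incr_cell_off_center s0 e0; exists h.
have := @segment_compact R 0 t; rewrite compact_cover.
(* Halved radii: a cell shorter than [h s / 2] whose left end is in the ball of [s] stays within
   [h s] of [s]. *)
move=> /(_ R [set` `[0, t]] (fun s => ball s (h s / 2))) [].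
- by move=> s _; exact: ball_open.
- move=> s /= st; exists s => //; apply: ballxx.
  by move: st; rewrite in_itv/= => /andP[/hP[? _] _]; rewrite divr_gt0.
move=> D Dt cov.
(* The centre 0 may be dropped, since a cell []a, b]] with [0 <= a] never contains it. *)
pose D' := [seq s <- finmap.enum_fset D | 0 < s].
pose m := \big[Num.min/1]_(s <- finmap.enum_fset D) (h s / 2).
have DI s : s \in finmap.enum_fset D -> 0 <= s <= t by move=> /Dt; rewrite inE/= in_itv.
exists D', m; split.
- rewrite /m big_seq_cond; elim/big_ind : _ => //.
    by move=> u v u0 v0; rewrite lt_min u0.
  by move=> s; rewrite andbT => /DI/andP[/hP[? _] _]; rewrite divr_gt0.
- by rewrite filter_uniq// finmap.fset_uniq.
- apply/allP => s; rewrite mem_filter => /andP[-> /DI/andP[_ ->]] //.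
move=> a b a0 ab bt bam hasD.
have /cov [s sD] : [set` `[0, t]] a by rewrite /= in_itv/= a0 (le_trans ab).
rewrite /ball/= => sa.
have sD' : s \in finmap.enum_fset D by [].
have /andP[s0 st] := DI _ sD'.
have [hs0 Hs] := hP _ s0.
have mh : m <= h s / 2 by exact: (ge_bigmin_seq _ s xpredT).
move: sa; rewrite ltr_norml => /andP[sa1 sa2].
apply: (Hs a b) => //; [lra|lra|].
apply/negP => asb; move/hasPn: hasD => /(_ s).
rewrite mem_filter asb sD' andbT => H.
suff : false by [].
by apply: H; case/andP: asb => ? _; exact: le_lt_trans a0 _.
Qed.


Lemma sum_cell_indic (g : nat -> R) n (s : R) :
  {homo g : i j / (i <= j)%N >-> i <= j} ->
  \sum_(k < n) (g k < s <= g k.+1)%R%:R = (g 0%N < s <= g n)%R%:R :> R.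
Proof.
move=> gnd; elim: n => [|n IH].
  by rewrite big_ord0; case: (ltP (g 0%N) s).
rewrite big_ord_recr/= IH; have g0n := gnd _ _ (leq0n n).
have gnn := gnd _ _ (leqnSn n).
have [sn|ns] := leP s (g n).
  by rewrite (le_trans sn gnn) addr0.
by rewrite (le_lt_trans g0n ns) add0r.
Qed.

(** * Limits of truncated increments along the grid *)

Section truncation.
Context (t : R) (t0 : 0 < t) (x0 : x 0 = 0).

Let grid n k : R := t * k%:R / n.+1%:R.

Let grid0 n : grid n 0 = 0. Proof. by rewrite /grid mulr0 mul0r. Qed.

Let gridn n : grid n n.+1 = t. Proof. by rewrite /grid mulfK. Qed.

Let grid_nd n : {homo grid n : i j / (i <= j)%N >-> i <= j}.
Proof.
by move=> i j ij; rewrite ler_pM2r ?invr_gt0 ?ltr0n// ler_pM2l// ler_nat.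
Qed.

Let grid_step n k : grid n k.+1 - grid n k = t / n.+1%:R.
Proof. by rewrite /grid -mulrBl -mulrBr -natrB// subSnn mulr1. Qed.

(** The part of an increment cut off by truncation. Unlike [Num.min _ d] it is superadditive, so its
    sum over jumps bounds its sum over cells from below, and it vanishes on increments at most [d],
    so only finitely many times matter. As the two parts add up to the increment, limits for one
    give limits for the other. *)
Let excess d a : R := Num.max (a - d) 0.

Let excess_ge0 d a : 0 <= excess d a. Proof. by rewrite le_max lexx orbT. Qed.

Let excess_nd d a b : a <= b -> excess d a <= excess d b.
Proof.
move=> ab; rewrite /excess ge_max !le_max lexx orbT andbT.
by rewrite lerD2r ab.
Qed.

Let excess_add d a b : 0 <= d -> 0 <= a -> 0 <= b ->
  excess d a + excess d b <= excess d (a + b).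
Proof. by rewrite /excess/Num.max => ? ? ?; repeat case: ifPn; lra. Qed.

Let min_excess d a : Num.min a d + excess d a = a.
Proof. by rewrite /excess/Num.max/Num.min; repeat case: ifPn; lra. Qed.

Let J d := (\esum_(s in `]0%R, t]) (Num.min (jmp s) d)%:E)%E.
Let K d := (\esum_(s in `]0%R, t]) (excess d (jmp s))%:E)%E.
Let Jall := (\esum_(s in `]0%R, t]) (jmp s)%:E)%E.

Let jmp0 s : [set` `]0%R, t]] s -> 0 <= jmp s.
Proof. by rewrite /= in_itv/= => /andP[? _]; exact: jump_ge0. Qed.

Let Jall_fin : Jall \is a fin_num.
Proof.
rewrite ge0_fin_numE; last by apply: esum_ge0 => s /jmp0; rewrite lee_fin.
have := @esum_jump_grid id (fun a h => h) (fun a b _ h => h)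
  (fun a b _ _ => lexx _) (grid 0) 1 (grid0 0) (grid_nd 0).
by rewrite gridn => /le_lt_trans; apply; rewrite ltry.
Qed.

Let JK d : 0 < d -> Jall = (J d + K d)%E.
Proof.
move=> d0; rewrite /Jall /J /K -esumD.
- by apply: eq_esum => s _; rewrite -EFinD min_excess.
- by move=> s /jmp0 ?; rewrite lee_fin le_min (ltW d0) andbT.
- by move=> s _; rewrite lee_fin.
Qed.

Let J_ge0 d : 0 < d -> (0 <= J d)%E.
Proof.
move=> d0; apply: esum_ge0 => s /jmp0.
by rewrite lee_fin le_min (ltW d0) andbT.
Qed.

Let K_ge0 d : (0 <= K d)%E.
Proof. by apply: esum_ge0 => s _; rewrite lee_fin. Qed.

Let J_fin d : 0 < d -> J d \is a fin_num.
Proof.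
move=> d0; rewrite ge0_fin_numE ?J_ge0//.
rewrite (@le_lt_trans _ _ Jall)//; last by rewrite ltey_eq Jall_fin.
by rewrite (JK d0) leeDl.
Qed.

Let K_fin d : 0 < d -> K d \is a fin_num.
Proof.
move=> d0; rewrite ge0_fin_numE//.
rewrite (@le_lt_trans _ _ Jall)//; last by rewrite ltey_eq Jall_fin.
by rewrite (JK d0) leeDr// J_ge0.
Qed.

Let fineJK d : 0 < d -> fine Jall = fine (J d) + fine (K d).
Proof. by move=> d0; rewrite (JK d0) fineD ?J_fin ?K_fin. Qed.

Let sum_le_K d (s : seq R) : uniq s -> all (fun u => 0 < u <= t) s ->
  ((\sum_(u <- s) excess d (jmp u))%:E <= K d)%E.
Proof.
move=> us st; apply: esum_ge; exists [set` s].
  split; first exact: finite_seq.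
  by move=> u /= us'; rewrite in_itv/=; have /allP/(_ _ us') := st.
by rewrite -sumEFin fsbig_seq.
Qed.

Let excess_sum_cvg d : 0 < d ->
  \sum_(k < n.+1) excess d (x (grid n k.+1) - x (grid n k)) @[n --> \oo]
    --> fine (K d).
Proof.
move=> d0; apply/cvgrPdist_le => e e0.
have [D [h [h0 uD Dt Dh]]] := small_increments t0 d0.
(* Each exceptional time may cost [e / N]; the successor keeps the quotient positive when [D] is
   empty. *)
pose N := (size D).+1.
pose e' := e / N%:R.
have e'0 : 0 < e' by rewrite divr_gt0.
have [h' h'0 Dh'] : exists2 h', 0 < h' & forall s, s \in D -> forall a b,
    s - h' < a -> a < s -> s <= b -> b < s + h' -> x b - x a <= jmp s + e'.
  elim: D Dt {uD Dh N} e' e'0 => [|s D IH]/=; first by move=> _ ? _; exists 1.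
  move=> /andP[/andP[s0 _] /IH{}IH] e' e'0.
  have [h1 h10 H1] := IH _ e'0; have [h2 h20 H2] := incr_cell_center s0 e'0.
  exists (Num.min h1 h2); first by rewrite lt_min h10 h20.
  have m1 : Num.min h1 h2 <= h1 by rewrite ge_min lexx.
  have m2 : Num.min h1 h2 <= h2 by rewrite ge_min lexx orbT.
  move=> u; rewrite inE => /orP[/eqP ->|uD] a b ? ? ? ?.
    by apply: H2 => //; lra.
  by apply: H1 => //; lra.
have mt : 0 < Num.min h h' / t by rewrite divr_gt0// lt_min h0.
near=> n.
have step k : grid n k.+1 - grid n k < Num.min h h'.
  rewrite grid_step mulrC -ltr_pdivlMr//.
  by near: n; exact: (near_infty_natSinv_lt (PosNum mt)).
have mh : Num.min h h' <= h by rewrite ge_min lexx.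
have mh' : Num.min h h' <= h' by rewrite ge_min lexx orbT.
have lower : fine (K d) <= \sum_(k < n.+1) excess d (x (grid n k.+1) - x (grid n k)).
  have := @esum_jump_grid (excess d) (fun a _ => excess_ge0 d a)
    (fun a b _ => @excess_nd d a b) (fun a b => @excess_add d a b (ltW d0))
    (grid n) n.+1 (grid0 n) (@grid_nd n).
  by rewrite -lee_fin fineK ?K_fin// gridn.
have upper : \sum_(k < n.+1) excess d (x (grid n k.+1) - x (grid n k)) <=
    fine (K d) + e.
  pose c s := excess d (jmp s) + e'.
  have c0 s : 0 <= c s by rewrite addr_ge0// ltW.
  (* A cell without exceptional time has increment at most [d] and excess 0; any other cell is paid
     for by a time of [D] inside it. After exchanging the sums each time of [D] is counted exactly
     once. *)
  apply: (@le_trans _ _ (\sum_(k < n.+1) \sum_(s <- D)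
      (grid n k < s <= grid n k.+1)%R%:R * c s)).
    apply: ler_sum => k _; have [/hasP[s sD sk]|] := boolP
        (has (fun s => grid n k < s <= grid n k.+1) D).
      rewrite (big_rem s)//= sk mul1r.
      apply: (@le_trans _ _ (c s)); last first.
        by rewrite lerDl sumr_ge0// => i _; rewrite mulr_ge0.
      have /andP[s1 s2] := sk.
      have := step k; have := Dh' _ sD (grid n k) (grid n k.+1).
      move=> H st; have {}H := H ltac:(lra) s1 s2 ltac:(lra).
      apply: (le_trans (excess_nd _ H)).
      by rewrite /c /excess/Num.max; repeat case: ifPn; lra.
    move=> hD; rewrite (@le_trans _ _ 0)//; last first.
      by apply: sumr_ge0 => i _; rewrite mulr_ge0.
    have gk : 0 <= grid n k by rewrite -(grid0 n) grid_nd.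
    have gt : grid n k.+1 <= t by rewrite -(gridn n) grid_nd.
    have gg : grid n k <= grid n k.+1 by exact: grid_nd.
    have := Dh _ _ gk gg gt (lt_le_trans (step k) mh) hD.
    by move=> H; rewrite /excess ge_max lexx andbT subr_le0.
  rewrite exchange_big/=.
  rewrite (_ : \sum_(s <- D) _ = \sum_(s <- D) c s); last first.
    apply: eq_big_seq => s sD; rewrite -mulr_suml sum_cell_indic; last exact: grid_nd.
    by have /allP/(_ _ sD) := Dt; rewrite grid0 gridn => ->; rewrite mul1r.
  rewrite big_split/= lerD//.
    by rewrite -lee_fin fineK ?K_fin// sum_le_K.
  rewrite big_const_seq count_predT iter_addr_0 -[e' *+ _]mulr_natr.
  by rewrite /e' mulrAC ler_pdivrMr// ler_pM2l// ler_nat.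
rewrite ler_norml; apply/andP; split; lra.
Unshelve. all: by end_near. Qed.

(** The constant [c] is [x t] minus the sum of all jumps: increments telescope to [x t], and
    subtracting the convergent excess sums leaves the truncated ones. *)
Lemma truncated_grid_sum_cvg : exists2 c, 0 <= c &
  (forall d, 0 < d -> 0 <= fine (J d) /\
     \sum_(k < n.+1) Num.min (x (grid n k.+1) - x (grid n k)) d @[n --> \oo]
       --> c + fine (J d)) /\
  (forall e, 0 < e -> exists2 h, 0 < h &
     forall d, 0 < d -> d < h -> fine (J d) <= e).
Proof.
have tele n : \sum_(k < n.+1) (x (grid n k.+1) - x (grid n k)) = x t.
  by rewrite -(big_mkord xpredT (fun k => x (grid n k.+1) - x (grid n k)))
    telescope_sumr// gridn grid0 x0 subr0.
exists (x t - fine Jall).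
  rewrite subr_ge0 -lee_fin fineK//.
  have := @esum_jump_grid id (fun a h => h) (fun a b _ h => h)
    (fun a b _ _ => lexx _) (grid 0) 1 (grid0 0) (grid_nd 0).
  by rewrite gridn tele.
split=> [d d0|e e0].
  split; first by rewrite fine_ge0// J_ge0.
  rewrite (fineJK d0) (_ : x t - _ + _ = x t - fine (K d)); last by ring.
  under eq_fun => n.
    rewrite (eq_bigr (fun k : 'I__ => (x (grid n k.+1) - x (grid n k)) -
       excess d (x (grid n k.+1) - x (grid n k)))); last first.
      by move=> k _; rewrite -[X in _ = X - _](min_excess d) addrK.
    rewrite sumrB tele.
  over.
  by apply: cvgB; [exact: cvg_cst|exact: excess_sum_cvg].
have e20 : 0 < e / 2 by rewrite divr_gt0.
(* A finite set [F] of jump times carries all but [e / 2] of the total; on [F] truncation keeps at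
   most [d] per jump, hence the threshold [e / 2 / N]. *)
have [_ [F [finF FI] <-] HF] := ub_ereal_sup_adherent e20 Jall_fin.
pose s := finmap.enum_fset (fset_set F).
pose N := (size s).+1.
exists (e / 2 / N%:R); first by rewrite divr_gt0.
move=> d d0 dh.
have sK : \sum_(u <- s) excess d (jmp u) <= fine (K d).
  rewrite -lee_fin fineK ?K_fin//; apply: sum_le_K.
    exact: finmap.fset_uniq.
  apply/allP => u us; have : F u.
    by move: us; rewrite /s in_fset_set// inE.
  by move=> /FI /=; rewrite in_itv.
have {}HF : (Jall - (e / 2)%:E < \sum_(i \in F) (jmp i)%:E)%E := HF.
move: HF; rewrite fsbig_finite//= sumEFin -(fineK Jall_fin) -EFinB lte_fin.
rewrite -/s => HF.
have : \sum_(u <- s) jmp u <= \sum_(u <- s) excess d (jmp u) + e / 2.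
  apply: (@le_trans _ _ (\sum_(u <- s) (excess d (jmp u) + d))).
    by apply: ler_sum => u _; rewrite /excess/Num.max; case: ifPn; lra.
  rewrite big_split/= lerD2l big_const_seq count_predT iter_addr_0 -[d *+ _]mulr_natr.
  move: dh; rewrite ltr_pdivlMr// => /ltW/(le_trans _); apply.
  by rewrite ler_pM2l// ler_nat.
by have := fineJK d0; lra.
Qed.

End truncation.
End cadlag_path.

(** * Approximation by polynomials in an exponential *)

Section bernstein.
Context {R : realType}.
Implicit Types (F G : nat -> R) (u e k c : R).

(* The n-th Bernstein polynomial of F, as the law of a sum of n Bernoulli
   variables: condition on one of them. *)
Fixpoint bernstein n F : {poly R} :=
  if n is n'.+1 then
    (1 - 'X) * bernstein n' F + 'X * bernstein n' (F \o succn)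
  else (F 0%N)%:P.

Lemma bernsteinS n F u : (bernstein n.+1 F).[u] =
  (1 - u) * (bernstein n F).[u] + u * (bernstein n (F \o succn)).[u].
Proof. by rewrite /= !(hornerE, hornerM). Qed.

Lemma le_bernstein n F G u : 0 <= u <= 1 ->
  (forall i, (i <= n)%N -> F i <= G i) ->
  (bernstein n F).[u] <= (bernstein n G).[u].
Proof.
move=> /andP[u0 u1]; elim: n F G => [|n IH] F G FG.
  by rewrite /= !hornerC FG.
rewrite !bernsteinS lerD// ler_wpM2l ?subr_ge0//.
  by apply: IH => i ni; rewrite FG// leqW.
by apply: IH => i ni; rewrite /= FG.
Qed.

(** The family e + k (i - nu + c)^2 is stable under the recursion: conditioning on one Bernoulli
    variable only moves the centre [c]. At [c = 0] this is the binomial variance n u (1 - u). *)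
Lemma bernstein_variance n u e k c :
  (bernstein n (fun i => e + k * (i%:R - n%:R * u + c) ^+ 2)).[u] =
  e + k * (n%:R * u * (1 - u) + c ^+ 2).
Proof.
elim: n c => [|n IH] c.
  by rewrite /= hornerC !mul0r subr0 !add0r.
rewrite bernsteinS.
have -> : (fun i : nat => e + k * (i%:R - n.+1%:R * u + c) ^+ 2) =
    (fun i => e + k * (i%:R - n%:R * u + (c - u)) ^+ 2).
  by apply/funext => i; rewrite -natr1; ring.
have -> : (fun i : nat => e + k * (i%:R - n%:R * u + (c - u)) ^+ 2) \o succn =
    (fun i => e + k * (i%:R - n%:R * u + (c - u + 1)) ^+ 2).
  by apply/funext => i; rewrite /= -natr1; ring.
by rewrite !IH -natr1; ring.
Qed.

(** Chebyshev's argument: [g (i / N)] differs from [g u] by at most [e] close to [u] and by at most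
    2M elsewhere, and one quadratic covers both cases. Monotonicity of the Bernstein operator then
    averages the bound. *)
Lemma bernstein_dist (g : R -> R) n u e M d : 0 <= u <= 1 -> 0 < d ->
  (forall v, 0 <= v <= 1 -> `|g v| <= M) ->
  (forall v, 0 <= v <= 1 -> `|v - u| < d -> `|g v - g u| <= e) -> 0 <= e ->
  `|(bernstein n.+1 (fun i => g (i%:R / n.+1%:R))).[u] - g u| <=
    e + 2 * M / d ^+ 2 / n.+1%:R.
Proof.
move=> u01 d0 gM gd e0; set N : R := n.+1%:R.
have N0 : 0 < N by rewrite ltr0n.
(* Chosen so that k (i - Nu)^2 equals 2M ((i/N - u)/d)^2, which is at least 2M once i/N is at
   distance [d] from [u]. *)
pose k := 2 * M / d ^+ 2 / N ^+ 2.
have M0 : 0 <= M by rewrite (le_trans _ (gM u u01)).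
have k0 : 0 <= k by rewrite !divr_ge0 ?sqr_ge0// mulr_ge0.
have key i : (i <= n.+1)%N ->
    `|g (i%:R / N) - g u| <= e + k * (i%:R - N * u + 0) ^+ 2.
  move=> ni; set v := i%:R / N.
  have v01 : 0 <= v <= 1.
    by rewrite divr_ge0// ler_pdivrMr// mul1r ler_nat.
  have -> : i%:R - N * u + 0 = N * (v - u).
    by rewrite addr0 /v; field; rewrite gt_eqF.
  have -> : k * (N * (v - u)) ^+ 2 = 2 * M * ((v - u) / d) ^+ 2.
    by rewrite /k; field; rewrite !gt_eqF.
  have [vu|vu] := ltP (`|v - u|) d.
    apply: (le_trans (gd v v01 vu)); rewrite lerDl.
    by rewrite mulr_ge0 ?sqr_ge0// mulr_ge0.
  apply: (@le_trans _ _ (2 * M)).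
    rewrite (le_trans (ler_normB _ _))// mulr2n mulrDl mul1r.
    by rewrite lerD// gM.
  rewrite (@le_trans _ _ (2 * M * ((v - u) / d) ^+ 2))//; last by rewrite lerDr.
  rewrite ler_peMr ?mulr_ge0// -real_normK ?num_real// exprn_ege1//.
  by rewrite normrM normfV (gtr0_norm d0) ler_pdivlMr// mul1r.
have vb : k * (N * u * (1 - u) + 0 ^+ 2) <= 2 * M / d ^+ 2 / N.
  have -> : 2 * M / d ^+ 2 / N = k * N.
    by rewrite /k; field; rewrite !gt_eqF.
  rewrite ler_wpM2l// expr0n addr0 -mulrA ler_piMr// ?ltW//.
  by case/andP: u01 => ? ?; nra.
rewrite ler_distl; apply/andP; split.
  apply: (@le_trans _ _ (bernstein n.+1 (fun i => (g u - e) +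
      (- k) * (i%:R - N * u + 0) ^+ 2)).[u]).
    by rewrite bernstein_variance mulNr opprD addrA lerD2l lerN2.
  apply: le_bernstein => // i /key; rewrite ler_distl => /andP[+ _].
  by rewrite mulNr; lra.
apply: (@le_trans _ _ (bernstein n.+1 (fun i => (g u + e) +
      k * (i%:R - N * u + 0) ^+ 2)).[u]).
  apply: le_bernstein => // i /key; rewrite ler_distl => /andP[_].
  by rewrite addrA.
by rewrite bernstein_variance addrA lerD2l.
Qed.

Theorem weierstrass_approximation (g : R -> R) (M e : R) : continuous g ->
  (forall v, 0 <= v <= 1 -> `|g v| <= M) -> 0 < e ->
  exists p : {poly R}, forall u, 0 <= u <= 1 -> `|g u - p.[u]| <= e.
Proof.
move=> cg gM e0.
have M0 : 0 <= M by rewrite (le_trans _ (gM 0 _))// lexx ler01.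
(* Compactness turns a bound valid near each [u0] for all large [n] into one that is uniform in
   [u]. *)
have := @segment_compact R 0 1 => /compact_near_coveringP.
move=> /(_ nat \oo (fun n u => 0 <= u <= 1 ->
  `|(bernstein n.+1 (fun i => g (i%:R / n.+1%:R))).[u] - g u| <= e) _).
case => [u0 _|N _ HN]; last first.
  exists (bernstein N.+1 (fun i => g (i%:R / N.+1%:R))) => u u01.
  by rewrite distrC; apply: HN => //=; rewrite in_itv.
have e40 : 0 < e / 4 by rewrite divr_gt0.
have /cvgrPdist_le /(_ _ e40) /nbhs_ballP[d /= d0 Hd] := cg u0.
have d20 : 0 < d / 2 by rewrite divr_gt0.
pose k := 2 * M / (d / 2) ^+ 2.
have k1 : 0 < k + 1 by rewrite ltr_wpDl// divr_ge0 ?sqr_ge0// mulr_ge0.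
have ek0 : 0 < e / 2 / (k + 1) by rewrite !divr_gt0.
exists (ball u0 (d / 2), [set n | n.+1%:R^-1 < e / 2 / (k + 1)]).
  split => /=; first exact: nbhsx_ballx.
  exact: (near_infty_natSinv_lt (PosNum ek0)).
move=> [u n] /= [u0u nk u01].
have := @bernstein_dist g n u (e / 2) M _ u01 d20 gM _.
rewrite -/k => /(_ _ _)/le_trans; apply.
- move=> v v01 vu; rewrite (le_trans (ler_distD (g u0) _ _))//.
  rewrite [leRHS](_ : _ = e / 4 + e / 4); last by field.
  rewrite lerD//; first rewrite distrC.
    apply: Hd; rewrite /ball/= (le_lt_trans (ler_distD u _ _))//.
    by rewrite [ltRHS]splitr ltrD// distrC.
  by apply: Hd; rewrite /ball/= (lt_trans u0u)// ltr_pdivrMr// ltr_pMr// ltr1n.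
- exact/ltW/divr_gt0.
move: nk; rewrite ltr_pdivlMr// => nk.
have nn : 0 < n.+1%:R^-1 :> R by rewrite invr_gt0.
rewrite [leRHS]splitr lerD2l (le_trans _ (ltW nk))//.
by rewrite mulrDr mulr1 mulrC lerDl ltW.
Qed.

(** The substitution u = e^{-x} maps [[0, +oo]] onto [[0, 1]]; the limit [l] supplies the value at u
    = 0. *)
Corollary exp_weierstrass_approximation (F : R -> R) (M l e : R) : continuous F ->
  (forall x, 0 <= x -> `|F x| <= M) -> F x @[x --> +oo%R] --> l -> 0 < e ->
  exists p : {poly R}, forall x, 0 <= x -> `|F x - p.[expR (- x)]| <= e.
Proof.
move=> cF FM Fl e0.
(* The value [l] on all nonpositive arguments makes [g] continuous on the whole line. *)
pose g u := if 0 < u then F (- ln u) else l.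
have lM : `|l| <= M.
  have : `|F x| @[x --> +oo%R] --> `|l| by exact: cvg_norm.
  move=> /(cvg_lim (@norm_hausdorff _ _)) <-; apply: limr_le.
    by apply/cvg_ex; exists `|l|; exact: cvg_norm.
  by near=> x; apply: FM; near: x; exact: nbhs_pinfty_ge.
have [|v /andP[v0 v1]|p Hp] := @weierstrass_approximation g M e _ _ e0.
- move=> u; have [u0|u0|u0] := ltgtP 0 u.
  + have cu : F (- ln v) @[v --> u] --> F (- ln u).
      apply: (@cvg_comp _ _ _ (fun v => - ln v) F _ (nbhs (- ln u))); last exact: cF.
      by apply: cvgN; exact: continuous_ln.
    rewrite /continuous_at /g u0; apply: cvg_trans cu.
    apply: near_eq_cvg; near=> v; rewrite ifT//.
    by near: v; exact: lt_nbhsr.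
  + rewrite /continuous_at /g ltNge (ltW u0)/=.
    apply: cvg_near_cst; near=> v.
    rewrite ltNge ifF//; apply/negbF/ltW.
    by near: v; exact: lt_nbhsl.
  + rewrite -u0 /continuous_at {2}/g ltxx.
    apply/cvgrPdist_le => d d0; move/cvgrPdist_le : Fl => /(_ _ d0)[A [_ HA]].
    near=> v; rewrite /g; case: ifPn => v0; last by rewrite subrr normr0 ltW.
    apply: HA; rewrite ltrNr -[ltRHS]expRK ltr_ln ?posrE ?expR_gt0//.
    by near: v; apply: lt_nbhsl; exact: expR_gt0.
- by rewrite /g; case: ifPn => // v0'; apply: FM; rewrite oppr_ge0 ln_le0.
exists p => x x0; have := Hp (expR (- x)).
by rewrite /g expR_gt0 expRK opprK expR_ge0 expR_le1 oppr_le0 x0 => ->.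
Unshelve. all: by end_near. Qed.

End bernstein.

(** * Expectations of products of independent variables *)

Section bounded_expectation.
Context d (T : measurableType d) (R : realType) (P : probability T R).
Implicit Types (f g : T -> R) (M : R).

(* [probability_setT] with the coercion to measures in the form in which
   integrals produce it. *)
Lemma measure_probability_setT : (P : {measure set T -> \bar R}) [set: T] = 1%E.
Proof. exact: probability_setT. Qed.

Lemma bounded_integrable f M : measurable_fun [set: T] f ->
  (forall w, `|f w| <= M) -> P.-integrable setT (fun w => (f w)%:E).
Proof.
move=> mf fM; apply: measurable_bounded_integrable => //.
  by rewrite measure_probability_setT ltry.
exists M; split; first by rewrite num_real.
by move=> N MN w _ /=; exact: le_trans (fM w) (ltW MN).
Qed.

Lemma Rintegral_probability_cst (r : R) : \int[P]_w (cst r w) = r.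
Proof. by rewrite Rintegral_cst// measure_probability_setT mulr1. Qed.

End bounded_expectation.

Section integrable_real.
Context d (T : measurableType d) (R : realType).
Context (m : {measure set T -> \bar R}) (D : set T) (mD : measurable D).
Implicit Types f g : T -> R.

Lemma integrable_scaler a f : m.-integrable D (fun x => (f x)%:E) ->
  m.-integrable D (fun x => (a * f x)%:E).
Proof. exact: integrableZl. Qed.

Lemma integrable_addr f g : m.-integrable D (fun x => (f x)%:E) ->
  m.-integrable D (fun x => (g x)%:E) ->
  m.-integrable D (fun x => (f x + g x)%:E).
Proof. exact: integrableD. Qed.

Lemma integrable_subr f g : m.-integrable D (fun x => (f x)%:E) ->
  m.-integrable D (fun x => (g x)%:E) ->
  m.-integrable D (fun x => (f x - g x)%:E).
Proof. exact: integrableB. Qed.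

End integrable_real.

Lemma dominated_cvg_Rintegral d (T : measurableType d) (R : realType)
    (m : {measure set T -> \bar R}) (D : set T) (f_ : nat -> T -> R)
    (f g : T -> R) : measurable D ->
  (forall n, measurable_fun D (f_ n)) -> measurable_fun D f ->
  (forall x, D x -> f_ ^~ x @ \oo --> f x) ->
  m.-integrable D (EFin \o g) ->
  (forall n x, D x -> `|f_ n x| <= g x) ->
  \int[m]_(x in D) f_ n x @[n --> \oo] --> \int[m]_(x in D) f x.
Proof.
move=> mD mf_ mf f_f ig f_g.
have [|||||intf _ H] := @dominated_convergence _ _ _ m D mD
  (fun n x => (f_ n x)%:E) (EFin \o f) (EFin \o g) => //.
- by move=> n; exact/measurable_EFinP.
- exact/measurable_EFinP.
- by apply: aeW => x Dx; apply: cvg_EFin; [exact: nearW|exact: f_f].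
- by apply: aeW => x n Dx; rewrite lee_fin f_g.
apply: fine_cvg.
by rewrite /Rintegral fineK//; exact: integrable_fin_num.
Qed.

Section independence_product.
Context d (T : measurableType d) (R : realType) (P : probability T R).

Section one_coordinate.
Local Open Scope ereal_scope.
Context (Y f : T -> R).
Context (mY : measurable_fun [set: T] Y).
Context (mf : measurable_fun [set: T] f).
Context (f0 : forall w, (0 <= f w)%R).
Context (intf : \int[P]_w (f w)%:E \is a fin_num).
Context (Yf : forall B : set R, measurable B ->
  \int[P]_w (\1_B (Y w) * f w)%:E =
  \int[P]_w (\1_B (Y w))%:E * \int[P]_w (f w)%:E).

Import HBNNSimple.

Lemma indep_integral_nnsfun (h : {nnsfun measurableTypeR R >-> R}) :
  \int[P]_w (h (Y w) * f w)%:E =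
  \int[P]_w (h (Y w))%:E * \int[P]_w (f w)%:E.
Proof.
pose r := finmap.enum_fset (fset_set (range h)).
pose B y := h @^-1` [set y].
have mB y : measurable (B y) by exact: measurable_sfunP.
have mBY y : measurable_fun [set: T] (fun w => \1_(B y) (Y w) : R).
  rewrite (_ : (fun w => _) = \1_(Y @^-1` B y)); last by [].
  apply: measurable_indic; rewrite -[X in measurable X]setTI.
  by apply: mY; [exact: measurableT|exact: mB].
have hE x : h x = (\sum_(y <- r) y * \1_(B y) x)%R.
  by rewrite fimfunE fsbig_finite.
have B0 y x : (0 <= y * \1_(B y) x :> R)%R.
  by have := nnfun_muleindic_ge0 h y x; rewrite -EFinM lee_fin.
have term y (k : T -> R) : measurable_fun [set: T] k -> (forall w, 0 <= k w)%R ->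
    \int[P]_w (y * \1_(B y) (Y w) * k w)%:E =
    y%:E * \int[P]_w (\1_(B y) (Y w) * k w)%:E.
  move=> mk k0; have [y0|y0] := leP 0%R y.
    under eq_integral do rewrite -mulrA EFinM.
    rewrite ge0_integralZl_EFin//.
      by move=> w _; rewrite lee_fin mulr_ge0.
    by apply/measurable_EFinP/measurable_funM.
  (* A negative [y] is not a value of [h], so both sides are 0. *)
  have BE : B y = set0 by rewrite /B preimage_nnfun0.
  by rewrite BE !integral0_eq ?mule0// => w _; rewrite indic0 ?mulr0 ?mul0r.
under eq_integral do rewrite hE mulr_suml -sumEFin.
rewrite ge0_integral_sum//; first last.
- by move=> y w _; rewrite lee_fin mulr_ge0.
- move=> y; apply/measurable_EFinP/measurable_funM => //.
  exact: measurable_funM.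
under [in RHS]eq_integral do rewrite hE -sumEFin.
rewrite ge0_integral_sum//; first last.
- by move=> y w _; rewrite lee_fin.
- by move=> y; apply/measurable_EFinP/measurable_funM.
rewrite ge0_sume_distrl; last first.
  by move=> y _; apply: integral_ge0 => w _; rewrite lee_fin.
apply: eq_bigr => y _; rewrite term// Yf; last exact: mB.
rewrite muleA; congr (_ * _).
transitivity (\int[P]_w (y * \1_(B y) (Y w) * cst 1%R w)%:E); last first.
  by apply: eq_integral => w _; rewrite /= mulr1.
rewrite term//; congr (_ * _).
by apply: eq_integral => w _; rewrite /= mulr1.
Qed.

Lemma indep_integral (g : R -> R) :
  measurable_fun [set: R] g -> (forall x, (0 <= g x)%R) ->
  \int[P]_w (g (Y w) * f w)%:E =
  \int[P]_w (g (Y w))%:E * \int[P]_w (f w)%:E.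
Proof.
move=> mg g0.
have mg' : measurable_fun [set: measurableTypeR R] (EFin \o g).
  exact/measurable_EFinP.
pose h n := nnsfun_approx measurableT mg' n.
have hg x : (h n x)%:E @[n --> \oo] --> (g x)%:E.
  by apply: (cvg_nnsfun_approx measurableT mg') => // y _; rewrite lee_fin.
have hnd x : {homo (fun n => h n x) : m n / (m <= n)%N >-> (m <= n)%R}.
  by move=> m n mn; have /lefP := nd_nnsfun_approx measurableT mg' mn; exact.
have mhY n : measurable_fun [set: T] (fun w => h n (Y w)).
  by apply: (measurableT_comp (f := h n)).
have c1 : \int[P]_w (h n (Y w) * f w)%:E @[n --> \oo] -->
    \int[P]_w (g (Y w) * f w)%:E.
  rewrite [X in _ --> X](_ : _ =
      \int[P]_w limn (fun n => (h n (Y w) * f w)%:E)); last first.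
    apply: eq_integral => w _; apply/esym/cvg_lim => //.
    by rewrite EFinM; under eq_fun do rewrite EFinM; apply: cvgeZr.
  apply: cvg_monotone_convergence => //.
  - by move=> n; apply/measurable_EFinP/measurable_funM.
  - by move=> n w _; rewrite lee_fin mulr_ge0.
  - by move=> w _ m n mn; rewrite lee_fin ler_wpM2r// hnd.
have c2 : \int[P]_w (h n (Y w))%:E @[n --> \oo] --> \int[P]_w (g (Y w))%:E.
  rewrite [X in _ --> X](_ : _ = \int[P]_w limn (fun n => (h n (Y w))%:E)).
    apply: cvg_monotone_convergence => //.
    - by move=> n; apply/measurable_EFinP.
    - by move=> n w _; rewrite lee_fin.
    - by move=> w _ m n mn; rewrite lee_fin hnd.
  by apply: eq_integral => w _; apply/esym/cvg_lim => //; exact: hg.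
apply: (cvg_unique _ c1) => //.
rewrite (_ : (fun n => _) = (fun n => \int[P]_w (h n (Y w))%:E *
    \int[P]_w (f w)%:E)); first exact: cvgeZr.
by apply/funext => n; rewrite -indep_integral_nnsfun.
Qed.

End one_coordinate.

Section product.
Local Open Scope ereal_scope.
Context (I : finType) (Y : I -> T -> R) (g : I -> R -> R) (M : R).
Context (mY : forall i, measurable_fun [set: T] (Y i)).
Context (indY : mutually_independent P Y).
Context (mg : forall i, measurable_fun [set: R] (g i)).
Context (g01 : forall i x, (0 <= g i x <= M)%R).

(** Interpolates between indicators ([s] empty: the definition of independence) and the functions
    [g i] ([s] everything), so that coordinates are exchanged one at a time. *)
Let G (s : seq I) (B : I -> set R) i : R -> R :=
  if i \in s then g i else \1_(B i).

Let G_ge0 s B i x : (0 <= G s B i x)%R.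
Proof. by rewrite /G; case: ifP => // _; case/andP: (g01 i x). Qed.

Let mG s B i : measurable (B i) -> measurable_fun [set: T] (fun w => G s B i (Y i w)).
Proof.
move=> mB; apply: (measurableT_comp (f := G s B i)) => //.
by rewrite /G; case: ifP.
Qed.

Let G_le s B i x : (G s B i x <= Num.max 1 M)%R.
Proof.
rewrite /G le_max; case: ifP => _; first by case/andP: (g01 i x) => _ ->; rewrite orbT.
by rewrite indicE; case: (_ \in _); rewrite ?lexx ?ler01.
Qed.

Let G_int s B i : measurable (B i) -> \int[P]_w (G s B i (Y i w))%:E \is a fin_num.
Proof.
move=> mB; apply: integrable_fin_num => //.
apply: (@bounded_integrable _ _ _ P _ (Num.max 1 M)%R); first exact: mG.
by move=> w; rewrite ger0_norm.
Qed.

Lemma expectation_prod_indic s (B : I -> set R) : (forall i, measurable (B i)) ->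
  \int[P]_w (\prod_i G s B i (Y i w))%:E = \prod_i \int[P]_w (G s B i (Y i w))%:E.
Proof.
elim: s B => [|i s IH] B mB.
  rewrite /G /=.
  transitivity (\int[P]_w (\1_(\bigcap_i (Y i @^-1` B i)) w)%:E).
    apply: eq_integral => w _; congr EFin; rewrite indicE.
    have [wB|] := boolP (w \in _).
      rewrite big1// => j _; rewrite indicE mem_set//.
      by move: wB; rewrite inE => /(_ j); exact.
    move/negP; rewrite inE => /existsNP[j /not_implyP[_ Bj]].
    by rewrite (bigD1 j)//= indicE memNset// mul0r.
  rewrite integral_indic//; last first.
    apply: fin_bigcap_measurable => // j _.
    by rewrite -[X in measurable X]setTI; apply: mY.
  rewrite setIT; transitivity (\prod_i P (Y i @^-1` B i)); first exact: indY.
  apply: eq_bigr => j _.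
  have mj : measurable (Y j @^-1` B j).
    by rewrite -[X in measurable X]setTI; apply: mY.
  rewrite (_ : (fun w => _) = (fun w => (\1_(Y j @^-1` B j) w)%:E)).
    by rewrite integral_indic// setIT.
  by apply/funext => w; rewrite !indicE.
have [is_|is_] := boolP (i \in s).
  have -> : G (i :: s) B = G s B.
    apply/funext => j; rewrite /G inE; case: eqVneq => //= ->.
    by rewrite is_.
  exact: IH.
have Gj j : j != i -> G (i :: s) B j = G s B j.
  by rewrite /G inE => /negbTE ->.
pose f w := (\prod_(j | j != i) G s B j (Y j w))%R.
pose c := \prod_(j | j != i) \int[P]_w (G s B j (Y j w))%:E.
have mf : measurable_fun [set: T] f.
  rewrite /f; under eq_fun do rewrite -big_filter.
  by apply: measurable_prod => j _; exact: mG.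
(* Varying only the set at [i] in the induction hypothesis shows that [Y i] is independent of the
   product [f] of the other factors, which is what replacing an indicator by [g i] requires. The
   induction keeps [B] free for this purpose. *)
have key B0 : measurable B0 -> \int[P]_w (\1_B0 (Y i w) * f w)%:E =
    \int[P]_w (\1_B0 (Y i w))%:E * c.
  move=> mB0; pose B' j := if j == i then B0 else B j.
  have mB' j : measurable (B' j) by rewrite /B'; case: ifP.
  have := IH B' mB'; rewrite (bigD1 i)//=.
  under eq_integral => w _ do rewrite (bigD1 i)//=.
  have -> : G s B' i = \1_B0 by rewrite /G (negbTE is_) /B' eqxx.
  have GB j : j != i -> G s B' j = G s B j by rewrite /G /B' => /negbTE ->.
  have -> : \prod_(j | j != i) \int[P]_w (G s B' j (Y j w))%:E = c.
    by apply: eq_bigr => j /GB ->.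
  move=> <-; apply: eq_integral => w _; congr (_ * _)%:E.
  by apply: eq_bigr => j /GB ->.
have fc : \int[P]_w (f w)%:E = c.
  have := key setT measurableT.
  rewrite (_ : \int[P]_w (\1_setT (Y i w))%:E = \int[P]_w (cst 1 w)); last first.
    by apply: eq_integral => w _; rewrite indicE in_setT.
  rewrite integral_cst// measure_probability_setT !mul1e => <-.
  by apply: eq_integral => w _; rewrite indicE in_setT mul1r.
rewrite (bigD1 i)//=; under eq_integral => w _ do rewrite (bigD1 i)//=.
have -> : G (i :: s) B i = g i by rewrite /G mem_head.
have -> : \prod_(j | j != i) \int[P]_w (G (i :: s) B j (Y j w))%:E = c.
  by apply: eq_bigr => j /Gj ->.
rewrite -fc -indep_integral//.
- apply: eq_integral => w _; congr (_ * _)%:E.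
  by apply: eq_bigr => j /Gj ->.
- by move=> w; apply: prodr_ge0.
- rewrite fc /c; elim/big_ind : _ => // [x y|j _]; first exact: fin_numM.
  exact: G_int.
- by move=> B0 mB0; rewrite fc key.
- by move=> x; case/andP: (g01 i x).
Qed.

Lemma expectation_prod :
  \int[P]_w (\prod_i g i (Y i w))%:E = \prod_i \int[P]_w (g i (Y i w))%:E.
Proof.
have := @expectation_prod_indic (enum I) (fun=> setT) (fun=> measurableT).
have -> : G (enum I) (fun=> setT) = g; last by [].
by apply/funext => i; rewrite /G mem_enum.
Qed.

Lemma Rexpectation_prod :
  (\int[P]_w (\prod_i g i (Y i w)) = \prod_i \int[P]_w (g i (Y i w)))%R.
Proof.
rewrite /Rintegral expectation_prod.
have H i : \int[P]_w (g i (Y i w))%:E \is a fin_num.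
  apply: integrable_fin_num => //; apply: (@bounded_integrable _ _ _ P _ M).
    exact: (measurableT_comp (f := g i)).
  by move=> w; case/andP: (g01 i (Y i w)) => ? ?; rewrite ger0_norm.
rewrite -[RHS]/(fine _%:E) -prodEFin; congr fine.
by apply: eq_bigr => i _; rewrite fineK.
Qed.

End product.
End independence_product.

Lemma same_law_integral d (T : measurableType d) (R : realType)
    (P : probability T R) (g : R -> R) (u v : T -> R) :
  measurable_fun [set: T] u -> measurable_fun [set: T] v ->
  (forall B : set R, measurable B -> P (u @^-1` B) = P (v @^-1` B)) ->
  measurable_fun [set: R] g -> (forall x, 0 <= g x) ->
  (\int[P]_w (g (u w))%:E = \int[P]_w (g (v w))%:E)%E.
Proof.
move=> mu mv uv mg g0.
have push (k : T -> R) : measurable_fun [set: T] k ->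
    (\int[P]_w (g (k w))%:E = \int[pushforward P k]_x (g x)%:E)%E.
  move=> mk; rewrite ge0_integral_pushforward//.
  - exact/measurable_EFinP.
  - by move=> x _; rewrite lee_fin.
rewrite !push//; apply: eq_measure_integral => A mA _; exact: uv.
Qed.

(** * Increments and Laplace transforms of a subordinator *)

Section increments.
Context d (T : measurableType d) (R : realType) (P : probability T R).
Context (X : R -> {RV P >-> R}) (hX : is_subordinator X).

Lemma subordinator0 w : X 0 w = 0. Proof. by case: hX. Qed.

Lemma subordinator_nd w s t : 0 <= s -> s <= t -> X s w <= X t w.
Proof. by case: hX => _ + _ _ _; exact. Qed.

Lemma subordinator_ge0 w s : 0 <= s -> 0 <= X s w.
Proof. by move=> s0; rewrite -(subordinator0 w) subordinator_nd. Qed.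

Lemma measurable_subordinator s : measurable_fun [set: T] (X s).
Proof. exact: measurable_funPT. Qed.

(** Bounds on the test functions are assumed on [[0, +oo[] only, whereas the product formula asks
    for them on the whole line; increments are nonnegative, so clamping changes no value that
    occurs. *)
Let clamp (g : R -> R) x := g (Num.max x 0).

Let mclamp g : measurable_fun [set: R] g -> measurable_fun [set: R] (clamp g).
Proof.
move=> mg; apply: (measurableT_comp mg).
by apply: measurable_maxr => //; exact: measurable_cst.
Qed.

Lemma increments_expectation (tau : nat -> R) (h M : R) n (g : 'I_n -> R -> R) :
  0 <= h -> 0 <= tau 0%N -> (forall k, tau k.+1 = tau k + h) ->
  (forall i, measurable_fun [set: R] (g i)) ->
  (forall i x, 0 <= x -> 0 <= g i x <= M) ->
  \int[P]_w (\prod_(i < n) g i (X (tau i.+1) w - X (tau i) w)) =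
  \prod_(i < n) \int[P]_w g i (X h w).
Proof.
move=> h0 t0 th mg gM.
have tnd : nondecreasing_seq tau.
  by apply/nondecreasing_seqP => k; rewrite th lerDl.
have tau0 k : 0 <= tau k by rewrite (le_trans t0)// tnd.
have incr0 k w : 0 <= X (tau k.+1) w - X (tau k) w.
  by rewrite subr_ge0 subordinator_nd// tnd.
have [_ _ _ stat indep] := hX.
have mY (i : 'I_n) : measurable_fun [set: T] (X (tau i.+1) \- X (tau i)).
  by apply: measurable_funB; exact: measurable_subordinator.
have cM i x : 0 <= clamp (g i) x <= M by apply: gM; rewrite le_max lexx orbT.
transitivity (\int[P]_w (\prod_(i < n)
    clamp (g i) ((X (tau i.+1) \- X (tau i)) w))).
  apply: eq_Rintegral => w _; apply: eq_bigr => i _.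
  by rewrite /clamp /= max_l.
rewrite (Rexpectation_prod mY (indep n tau t0 tnd) _ cM)//; last first.
  by move=> i; exact: mclamp.
apply: eq_bigr => i _; rewrite /Rintegral; congr fine.
rewrite (@same_law_integral _ _ _ P _ _ (X h)) //.
- apply: eq_integral => w _; congr EFin.
  by rewrite /clamp max_l// subordinator_ge0.
- move=> B mB; rewrite stat// ?tnd//.
  congr (P _); rewrite th addrAC subrr add0r; apply/funext => w /=.
  by rewrite subordinator0 subr0.
- exact: mclamp.
- by move=> x; case/andP: (cM i x).
Qed.

Definition laplace lambda s : R := \int[P]_w expR (- (lambda * X s w)).

Lemma measurable_laplace lambda s :
  measurable_fun [set: T] (fun w => expR (- (lambda * X s w))).
Proof.
apply: measurableT_comp => //; apply: measurableT_comp => //.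
by apply: measurable_funM => //; exact: measurable_subordinator.
Qed.

Lemma integrable_laplace lambda s : 0 <= lambda -> 0 <= s ->
  P.-integrable setT (fun w => (expR (- (lambda * X s w)))%:E).
Proof.
move=> l0 s0; apply: (@bounded_integrable _ _ _ P _ 1).
  exact: measurable_laplace.
move=> w; rewrite ger0_norm ?expR_ge0// expR_le1 oppr_le0 mulr_ge0//.
exact: subordinator_ge0.
Qed.

Lemma laplace_ge0 lambda s : 0 <= laplace lambda s.
Proof. by apply: Rintegral_ge0 => w _; exact: expR_ge0. Qed.

Lemma laplace_ni lambda s t : 0 <= lambda -> 0 <= s -> s <= t ->
  laplace lambda t <= laplace lambda s.
Proof.
move=> l0 s0 st; apply: le_Rintegral => //.
- by apply: integrable_laplace => //; exact: le_trans st.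
- exact: integrable_laplace.
by move=> w _; rewrite ler_expR lerN2 ler_wpM2l// subordinator_nd.
Qed.

Lemma laplaceX lambda h n : 0 <= lambda -> 0 <= h ->
  laplace lambda (h * n%:R) = laplace lambda h ^+ n.
Proof.
move=> l0 h0; have := @increments_expectation (fun k => h * k%:R) h 1 n
  (fun _ x => expR (- (lambda * x))) h0.
rewrite mulr0 lexx => /(_ isT) H.
rewrite -[RHS](_ : \prod_(i < n) laplace lambda h = _); last first.
  by rewrite prodr_const card_ord.
rewrite -H.
- apply: eq_Rintegral => w _; rewrite -expR_sum; congr expR.
  rewrite sumrN -mulr_sumr; congr (- (_ * _)).
  rewrite -(big_mkord xpredT (fun k => X (h * k.+1%:R) w - X (h * k%:R) w)).
  by rewrite telescope_sumr// mulr0 subordinator0 subr0.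
- by move=> k; rewrite -natr1 mulrDr mulr1.
- move=> _; apply: measurableT_comp => //; apply: measurableT_comp => //.
- by move=> _ x x0; rewrite expR_ge0 expR_le1 oppr_le0 mulr_ge0.
Qed.

(** Multiplicativity over equal steps settles rational times, through uniqueness of nonnegative
    roots; monotonicity in [s] then squeezes a real time between k/(n+1) and (k+1)/(n+1). *)
Lemma laplace_exponentE lambda Phi s : 0 <= lambda -> 0 <= s ->
  laplace lambda 1 = expR (- Phi) -> laplace lambda s = expR (- (s * Phi)).
Proof.
move=> l0 s0 L1.
have L0 : laplace lambda 0 = 1.
  rewrite /laplace; under eq_Rintegral do rewrite subordinator0 mulr0 oppr0 expR0.
  exact: Rintegral_probability_cst.
have Phi0 : 0 <= Phi.
  by have := laplace_ni l0 (lexx 0) ler01; rewrite L0 L1 expR_le1 oppr_le0.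
have Lrat (k n : nat) : laplace lambda (k%:R / n.+1%:R) =
    expR (- (k%:R / n.+1%:R * Phi)).
  have L1n : laplace lambda n.+1%:R^-1 = expR (- (n.+1%:R^-1 * Phi)).
    apply: (@pexpIrn _ n.+1) => //; rewrite ?nnegrE ?laplace_ge0 ?expR_ge0//.
    rewrite -laplaceX// mulVf// L1 -expRM_natl; congr expR.
    by rewrite mulrN mulrA mulfV// mul1r.
  rewrite mulrC laplaceX// L1n -expRM_natl; congr expR.
  by rewrite mulrN; congr (- _); ring.
apply/eqP; rewrite -subr_eq0 -normr_le0; apply/ler_addgt0Pl => e e0.
rewrite addr0.
near \oo => n.
have N0 : 0 < n.+1%:R :> R by rewrite ltr0n.
pose k := Num.truncn (s * n.+1%:R).
have /andP[k1 k2] : k%:R <= s * n.+1%:R < k.+1%:R.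
  by apply: truncn_itv; rewrite mulr_ge0.
have {}k1 : k%:R / n.+1%:R <= s by rewrite ler_pdivrMr.
have {}k2 : s <= k.+1%:R / n.+1%:R by rewrite ler_pdivlMr// ltW.
have kn0 : 0 <= k%:R / n.+1%:R :> R by rewrite divr_ge0.
have a1 := laplace_ni l0 kn0 k1; have a2 := laplace_ni l0 s0 k2.
rewrite !Lrat in a1 a2.
have b1 : expR (- (s * Phi)) <= expR (- (k%:R / n.+1%:R * Phi)).
  by rewrite ler_expR lerN2 ler_wpM2r.
have b2 : expR (- (k.+1%:R / n.+1%:R * Phi)) <= expR (- (s * Phi)).
  by rewrite ler_expR lerN2 ler_wpM2r.
have c : expR (- (k%:R / n.+1%:R * Phi)) - expR (- (k.+1%:R / n.+1%:R * Phi)) <= e.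
  have -> : - (k.+1%:R / n.+1%:R * Phi) =
      - (k%:R / n.+1%:R * Phi) - Phi / n.+1%:R :> R.
    by rewrite -[in LHS](@natr1 R k) mulrDl; ring.
  rewrite expRD -[X in X - _]mulr1 -mulrBr.
  have x1 : expR (- (k%:R / n.+1%:R * Phi)) <= 1 :> R.
    by rewrite expR_le1 oppr_le0 mulr_ge0.
  have x2 : 1 - expR (- (Phi / n.+1%:R)) <= Phi / n.+1%:R.
    by rewrite lerBlDl -lerBlDr; exact: expR_ge1Dx.
  have x3 : Phi / n.+1%:R <= e.
    have : n.+1%:R^-1 < e / (Phi + 1).
      near: n; have ep : 0 < e / (Phi + 1) by rewrite divr_gt0// ltr_wpDl.
      exact: (near_infty_natSinv_lt (PosNum ep)).
    rewrite ltr_pdivlMr ?ltr_wpDl// => H; apply: le_trans (ltW H).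
    by rewrite mulrC ler_pM2l ?invr_gt0// lerDl.
  rewrite (le_trans _ x3)// (le_trans _ x2)// ler_piMl//.
  by rewrite subr_ge0 expR_le1 oppr_le0 divr_ge0.
by rewrite ler_norml; apply/andP; split; lra.
Unshelve. all: by end_near. Qed.

End increments.

(** * Small-time behaviour of a subordinator *)

Section levy_measure.
Context (R : realType) (Pi : {measure set (measurableTypeR R) -> \bar R}).
Context (hPi : is_subordinator_levy_measure Pi).
Let D : set R := [set` `]0%R, +oo[].

Lemma levy_integrable (f : R -> R) C : measurable_fun [set: R] f ->
  (forall x, 0 < x -> `|f x| <= C * Num.min 1 x) ->
  Pi.-integrable D (fun x => (f x)%:E).
Proof.
move=> mf fC; have [_ fin1] := hPi.
have mD : measurable D by exact: measurable_itv.
have mmin : measurable_fun [set: R] (fun x : R => Num.min 1 x).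
  by apply: measurable_minr => //; exact: measurable_cst.
have int1 : Pi.-integrable D (fun x => (Num.min 1 x)%:E).
  apply/integrableP; split.
    by apply/measurable_EFinP; exact: measurable_funTS.
  rewrite (_ : (\int[Pi]_(x in D) _ = \int[Pi]_(x in D) (Num.min 1 x)%:E)%E)//.
  apply: eq_integral => x; rewrite inE /D /= in_itv/= andbT => x0.
  by rewrite ger0_norm // le_min ler01 ltW.
apply: (@le_integrable _ _ _ Pi D mD _
  (fun x => C%:E * (Num.min 1 x)%:E)%E); last exact: integrableZl.
  by apply/measurable_EFinP; exact: measurable_funTS.
move=> x; rewrite /D /= in_itv/= andbT => x0.
have fx := fC _ x0.
by rewrite lee_fin (le_trans fx)// ler_norm.
Qed.

End levy_measure.

Section generator.
Context d (T : measurableType d) (R : realType) (P : probability T R).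
Context (X : R -> {RV P >-> R}) (b : R).
Context (Pi : {measure set (measurableTypeR R) -> \bar R}).
Context (hX : is_subordinator X) (hbPi : has_drift_levy_measure X b Pi).
Let D : set R := [set` `]0%R, +oo[].

Let mD : measurable (D : set (measurableTypeR R)).
Proof. exact: measurable_itv. Qed.

Let hPi : is_subordinator_levy_measure Pi.
Proof. by case: hbPi. Qed.

Lemma laplace_subordinator lambda s : 0 <= lambda -> 0 <= s ->
  laplace X lambda s = expR (- (s * laplace_exponent b Pi lambda)).
Proof.
move=> l0 s0; apply: laplace_exponentE => //.
have [_ _ /(_ _ l0)] := hbPi.
rewrite unlock /laplace /Rintegral => H.
by rewrite -[RHS]/(fine (expR (- laplace_exponent b Pi lambda))%:E) -H.
Qed.

(** The weight 1 - e^{-x} is comparable to min(1, x), so the rescaled laws of [X h] become measures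
    of bounded mass as h tends to 0. Their limit is [Gen]: mass [b] at 0, where the drift
    accumulates, plus (1 - e^{-x}) Pi(dx). *)
Let gen h (F : R -> R) : R :=
  h^-1 * \int[P]_w ((1 - expR (- X h w)) * F (X h w)).
Let Gen (F : R -> R) : R :=
  b * F 0 + \int[Pi]_(x in D) ((1 - expR (- x)) * F x).

Let bounded (F : R -> R) := exists M, forall x, 0 <= x -> `|F x| <= M.

Let one_sub_exp_ge0 (x : R) : 0 <= x -> 0 <= 1 - expR (- x).
Proof. by move=> x0; rewrite subr_ge0 expR_le1 oppr_le0. Qed.

Let one_sub_exp_le1 (x : R) : 1 - expR (- x) <= 1.
Proof. by rewrite gerBl expR_ge0. Qed.

Let one_sub_exp_le (x : R) : 1 - expR (- x) <= x.
Proof. by rewrite lerBlDl -lerBlDr; exact: expR_ge1Dx. Qed.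

Let m1e : measurable_fun [set: R] (fun x : R => 1 - expR (- x)).
Proof. by apply: measurable_funB => //; exact: measurableT_comp. Qed.

Let gen_integrable h F : 0 <= h -> measurable_fun [set: R] F -> bounded F ->
  P.-integrable setT (fun w => ((1 - expR (- X h w)) * F (X h w))%:E).
Proof.
move=> h0 mF [M FM].
apply: (@bounded_integrable _ _ _ P _ M).
  apply: (measurableT_comp (measurable_funM m1e mF)).
  exact: measurable_subordinator.
move=> w; have Xh := subordinator_ge0 hX w h0.
rewrite normrM ger0_norm ?one_sub_exp_ge0//.
by rewrite (le_trans _ (FM _ Xh))// ler_piMl// one_sub_exp_le1.
Qed.

Let Gen_integrable F : measurable_fun [set: R] F -> bounded F ->
  Pi.-integrable D (fun x => ((1 - expR (- x)) * F x)%:E).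
Proof.
move=> mF [M FM]; apply: (levy_integrable hPi (C := M)).
  exact: measurable_funM.
move=> x x0; have x0' := ltW x0; have y0 := one_sub_exp_ge0 x0'.
rewrite normrM (ger0_norm y0) mulrC ler_pM ?FM//.
by rewrite le_min one_sub_exp_le1 one_sub_exp_le.
Qed.

Let gen_linear h a F G : 0 <= h ->
  measurable_fun [set: R] F -> bounded F ->
  measurable_fun [set: R] G -> bounded G ->
  gen h (fun x => a * F x + G x) = a * gen h F + gen h G.
Proof.
move=> h0 mF bF mG bG; rewrite /gen [in RHS]mulrCA -mulrDr; congr (_ * _).
have iF := gen_integrable h0 mF bF; have iG := gen_integrable h0 mG bG.
rewrite -RintegralZl// -RintegralD//; last exact: integrable_scaler.
by apply: eq_Rintegral => w _; rewrite mulrDr mulrCA.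
Qed.

Let Gen_linear a F G :
  measurable_fun [set: R] F -> bounded F ->
  measurable_fun [set: R] G -> bounded G ->
  Gen (fun x => a * F x + G x) = a * Gen F + Gen G.
Proof.
move=> mF bF mG bG; rewrite /Gen.
have iF := Gen_integrable mF bF; have iG := Gen_integrable mG bG.
rewrite [X in _ + X = _](_ : _ = a * \int[Pi]_(x in D) ((1 - expR (- x)) * F x)
    + \int[Pi]_(x in D) ((1 - expR (- x)) * G x)); first by ring.
rewrite -RintegralZl// -RintegralD//; last exact: integrable_scaler.
by apply: eq_Rintegral => w _; rewrite mulrDr mulrCA.
Qed.

Let gen_dist h F G (e : R) : 0 < h ->
  measurable_fun [set: R] F -> bounded F ->
  measurable_fun [set: R] G -> bounded G ->
  (forall x, 0 <= x -> `|F x - G x| <= e) ->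
  `|gen h F - gen h G| <= e * gen h (cst 1).
Proof.
move=> h0 mF bF mG bG FG; have h0' := ltW h0.
have iF := gen_integrable h0' mF bF; have iG := gen_integrable h0' mG bG.
have b1 : bounded (cst 1) by exists 1 => x _; rewrite normr1.
have i1 := gen_integrable h0' (measurable_cst _) b1.
rewrite /gen -mulrBr normrM gtr0_norm ?invr_gt0// mulrCA ler_pM2l ?invr_gt0//.
rewrite -RintegralB// (le_trans (le_normr_Rintegral _ _))//; first exact: integrable_subr.
rewrite -RintegralZl//; apply: le_Rintegral => //.
- by apply: integrable_norm; exact: integrable_subr.
- exact: integrable_scaler.
move=> w _ /=; rewrite -mulrBr normrM mulr1 mulrC.
have Xh := subordinator_ge0 hX w h0'.
have y0 := one_sub_exp_ge0 Xh.
by rewrite (ger0_norm y0) ler_wpM2r ?FG.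
Qed.

Let Gen_dist F G (e : R) :
  measurable_fun [set: R] F -> bounded F ->
  measurable_fun [set: R] G -> bounded G ->
  (forall x, 0 <= x -> `|F x - G x| <= e) ->
  `|Gen F - Gen G| <= e * Gen (cst 1).
Proof.
move=> mF bF mG bG FG.
have iF := Gen_integrable mF bF; have iG := Gen_integrable mG bG.
have b1 : bounded (cst 1) by exists 1 => x _; rewrite normr1.
have i1 := Gen_integrable (measurable_cst _) b1.
have b0 : 0 <= b by case: hbPi.
rewrite /Gen opprD addrACA -mulrBr [leRHS]mulrDr (le_trans (ler_normD _ _))// lerD//.
  by rewrite normrM ger0_norm// mulr1 mulrC ler_wpM2r// FG.
rewrite -RintegralB// (le_trans (le_normr_Rintegral _ _))//; first exact: integrable_subr.
rewrite -RintegralZl//; apply: le_Rintegral => //.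
- by apply: integrable_norm; exact: integrable_subr.
- exact: integrable_scaler.
move=> x; rewrite /D /= in_itv/= andbT => x0; rewrite -mulrBr normrM mulr1 mulrC.
have x0' := ltW x0; have y0 := one_sub_exp_ge0 x0'.
by rewrite (ger0_norm y0) ler_wpM2r ?FG.
Qed.

Section limit.
Context (h_ : nat -> R) (h_gt0 : forall n, 0 < h_ n).
Context (h_0 : h_ n @[n --> \oo] --> (0 : R)).

Let exp_slope (A : R) : (h_ n)^-1 * (1 - expR (- (h_ n * A))) @[n --> \oo] --> A.
Proof.
have ge u : u * expR (- u) <= 1 - expR (- u) :> R.
  rewrite lerBrDr -[X in _ + X]mul1r -mulrDl -[leRHS](expRxMexpNx_1 u).
  by rewrite ler_wpM2r ?expR_ge0// addrC expR_ge1Dx.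
apply: (squeeze_cvgr (f := fun n => A * expR (- (h_ n * A))) (h := cst A)).
- apply: nearW => n; rewrite [_^-1 * _]mulrC ler_pdivlMr// ler_pdivrMr//.
  rewrite mulrAC [A * h_ n]mulrC ge/=.
  by rewrite one_sub_exp_le.
- rewrite -[X in _ --> X]mulr1; apply: cvgMr.
  have : expR (- (h_ n * A)) @[n --> \oo] --> expR (- (0 * A)).
    apply: (@cvg_comp _ _ _ (fun n => - (h_ n * A)) expR _ (nbhs (- (0 * A)))).
      by apply: cvgN; apply: cvgMl.
    exact: continuous_expR.
  by rewrite mul0r oppr0 expR0.
- exact: cvg_cst.
Qed.

Let mexp k : measurable_fun [set: R] (fun x : R => expR (- (k%:R * x))).
Proof.
by apply: measurableT_comp => //; apply: measurableT_comp.
Qed.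

Let bexp k : bounded (fun x : R => expR (- (k%:R * x))).
Proof.
exists 1 => x x0; rewrite ger0_norm ?expR_ge0// expR_le1 oppr_le0.
exact: mulr_ge0.
Qed.

Let expS k (x : R) : expR (- (k.+1%:R * x)) = expR (- x) * expR (- (k%:R * x)).
Proof. by rewrite -expRD -natr1; congr expR; ring. Qed.

(** Since (1 - e^{-x}) e^{-kx} = (1 - e^{-(k+1)x}) - (1 - e^{-kx}), both sides are differences of
    quantities given by the Laplace exponent at k + 1 and k. *)
Let gen_exp k : gen (h_ n) (fun x => expR (- (k%:R * x))) @[n --> \oo] -->
  Gen (fun x => expR (- (k%:R * x))).
Proof.
pose A k := laplace_exponent b Pi k%:R.
have -> : Gen (fun x => expR (- (k%:R * x))) = A k.+1 - A k.
  have int j : Pi.-integrable D (fun x => (1 - expR (- (j%:R * x)))%:E).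
    apply: (levy_integrable hPi (C := 1 + j%:R)).
      by apply: measurable_funB.
    move=> x x0; have x0' := ltW x0.
    rewrite ger0_norm; last by rewrite one_sub_exp_ge0// mulr_ge0.
    have [x1|x1] := ltP 1 x.
      by rewrite mulr1 (le_trans (one_sub_exp_le1 _))// lerDl.
    by rewrite (le_trans (one_sub_exp_le _))// ler_wpM2r// lerDr.
  rewrite /Gen mulr0 oppr0 expR0 /A /laplace_exponent -/D.
  rewrite (_ : \int[Pi]_(x in D) ((1 - expR (- x)) * _) =
    \int[Pi]_(x in D) (1 - expR (- (k.+1%:R * x))) -
    \int[Pi]_(x in D) (1 - expR (- (k%:R * x)))).
    by rewrite -natr1; ring.
  rewrite -RintegralB; [|exact: mD|exact: int|exact: int].
  apply: eq_Rintegral => x _.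
  by rewrite expS; ring.
have -> : (fun n => gen (h_ n) (fun x => expR (- (k%:R * x)))) =
    (fun n => (h_ n)^-1 * (1 - expR (- (h_ n * A k.+1))) -
              (h_ n)^-1 * (1 - expR (- (h_ n * A k)))).
  apply/funext => n; rewrite /gen -mulrBr; congr (_ * _).
  have h0 := ltW (h_gt0 n).
  rewrite -!laplace_subordinator// /laplace.
  have diff u v : (1 - u) - (1 - v) = v - u :> R by ring.
  rewrite diff -RintegralB//; [|exact: integrable_laplace..].
  by apply: eq_Rintegral => w _; rewrite expS; ring.
by apply: cvgB; exact: exp_slope.
Qed.

Let gen0 h : gen h (cst 0) = 0.
Proof.
rewrite /gen; under eq_Rintegral do rewrite mulr0.
by rewrite (Rintegral_probability_cst P 0) mulr0.
Qed.

Let Gen0 : Gen (cst 0) = 0.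
Proof.
rewrite /Gen mulr0 add0r; under eq_Rintegral do rewrite mulr0.
by rewrite /Rintegral integral0.
Qed.

(** The extra factor e^{-kx} closes the induction: splitting off the constant term of [p] leaves a
    polynomial times one more power of e^{-x}. *)
Let gen_poly (p : {poly R}) k (F := fun x => p.[expR (- x)] * expR (- (k%:R * x))) :
  [/\ measurable_fun [set: R] F, bounded F &
      gen (h_ n) F @[n --> \oo] --> Gen F].
Proof.
rewrite /F {F}; elim/poly_ind: p k => [|p c IH] k.
  have -> : (fun x : R => 0.[expR (- x)] * expR (- (k%:R * x))) = cst 0.
    by apply/funext => x; rewrite horner0 mul0r.
  split; first exact: measurable_cst.
    by exists 0 => x _; rewrite normr0.
  by rewrite Gen0; under eq_fun do rewrite gen0; exact: cvg_cst.
have -> : (fun x : R => (p * 'X + c%:P).[expR (- x)] * expR (- (k%:R * x))) =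
    (fun x => c * expR (- (k%:R * x)) + p.[expR (- x)] * expR (- (k.+1%:R * x))).
  by apply/funext => x; rewrite hornerMXaddC expS; ring.
have [mp bp cp] := IH k.+1; have [M pM] := bp; have [N eN] := bexp k.
split.
- by apply: measurable_funD => //; apply: measurable_funM.
- exists (`|c| * N + M) => x x0; rewrite (le_trans (ler_normD _ _))//.
  by rewrite lerD ?pM// normrM ler_wpM2l// eN.
rewrite (Gen_linear c (mexp k) (bexp k) mp bp).
rewrite (_ : (fun n => _) = (fun n => c * gen (h_ n) (fun x => expR (- (k%:R * x))) +
    gen (h_ n) (fun x => p.[expR (- x)] * expR (- (k.+1%:R * x))))); last first.
  by apply/funext => n; exact: (gen_linear c (ltW (h_gt0 n)) (mexp k) (bexp k) mp bp).
by apply: cvgD => //; apply: cvgMr.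
Qed.

(** Both functionals are positive, so a uniform approximation error costs at most that error times
    the total mass, and the masses converge to [Gen (cst 1)]. *)
Lemma generator_limit (F : R -> R) (M l : R) : continuous F ->
  (forall x, 0 <= x -> `|F x| <= M) -> F x @[x --> +oo%R] --> l ->
  gen (h_ n) F @[n --> \oo] --> Gen F.
Proof.
move=> cF FM Fl.
have mF : measurable_fun [set: R] F by exact: continuous_measurable_fun.
have bF : bounded F by exists M.
have g1 : gen (h_ n) (cst 1) @[n --> \oo] --> Gen (cst 1).
  have e1 : (fun x : R => expR (- (0%:R * x))) = cst 1.
    by apply/funext => x; rewrite mul0r oppr0 expR0.
  by have := @gen_exp 0%N; rewrite e1.
have G1 : 0 <= Gen (cst 1).
  rewrite addr_ge0//; first by case: hbPi; rewrite mulr1.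
  apply: Rintegral_ge0 => x; rewrite /D /= in_itv/= andbT => x0.
  by rewrite mulr1 one_sub_exp_ge0// ltW.
apply/cvgrPdist_le => e e0.
pose C := Gen (cst 1) + 1.
have C0 : 0 < C by rewrite ltr_wpDl.
have e1 : 0 < e / 3 / C by rewrite !divr_gt0.
have e3 : 0 < e / 3 by rewrite divr_gt0.
have [p Hp] := exp_weierstrass_approximation cF FM Fl e1.
have [] := @gen_poly p 0%N; set G := (fun x => _) => mG bG cG.
have FG x : 0 <= x -> `|F x - G x| <= e / 3 / C.
  by move=> x0; rewrite /G mul0r oppr0 expR0 mulr1 Hp.
near=> n.
have d1 : e / 3 / C * gen (h_ n) (cst 1) <= e / 3.
  rewrite mulrAC ler_pdivrMr// ler_pM2l//; near: n.
  have : \forall n \near \oo, gen (h_ n) (cst 1) < C.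
    by apply: (cvgr_lt (Gen (cst 1))) => //; rewrite ltrDl.
  by apply: filterS => n /ltW.
have d2 : e / 3 / C * Gen (cst 1) <= e / 3.
  by rewrite mulrAC ler_pdivrMr// ler_pM2l// lerDl.
have d3 : `|Gen G - gen (h_ n) G| <= e / 3.
  by near: n; move/cvgrPdist_le : cG; exact.
have k1 := le_trans (gen_dist (h_gt0 n) mF bF mG bG FG) d1.
have k2 := le_trans (Gen_dist mF bF mG bG FG) d2.
move: d3 k1 k2; rewrite !ler_norml => /andP[? ?] /andP[? ?] /andP[? ?].
apply/andP; split; lra.
Unshelve. all: by end_near. Qed.

End limit.
End generator.

Section truncated_generator.
Context d (T : measurableType d) (R : realType) (P : probability T R).
Context (X : R -> {RV P >-> R}) (b : R).
Context (Pi : {measure set (measurableTypeR R) -> \bar R}).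
Context (hX : is_subordinator X) (hbPi : has_drift_levy_measure X b Pi).
Context (delta : R) (delta_gt0 : 0 < delta).

(** Truncation divided by the weight 1 - e^{-x}; 1 is the limit at 0 from the right, and keeping it
    for negative arguments gives a continuous function on the line. *)
Let rho (x : R) : R := if 0 < x then Num.min x delta / (1 - expR (- x)) else 1.

Let one_sub_exp_gt0 (x : R) : 0 < x -> 0 < 1 - expR (- x).
Proof. by move=> x0; rewrite subr_gt0 expR_lt1 oppr_lt0. Qed.

(** Amounts to 1 - e^{-x} >= x / (1 + x), that is, to e^x >= 1 + x. *)
Let rho_le (x : R) : 0 < x -> rho x <= Num.min x delta * (1 + x^-1).
Proof.
move=> x0; have y0 := one_sub_exp_gt0 x0.
rewrite /rho x0 ler_wpM2l//; first by rewrite le_min !ltW.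
have -> : 1 + x^-1 = (1 + x) / x by field; rewrite gt_eqF.
rewrite ler_pdivlMr// mulrC ler_pdivrMr// mulrBr mulr1 [1 + x]addrC -addrA lerDl.
rewrite subr_ge0 -[leRHS](expRxMexpNx_1 x) ler_wpM2r ?expR_ge0//.
by have := expR_ge1Dx x; lra.
Qed.

Let rho_ge1 (x : R) : 0 < x -> x <= delta -> 1 <= rho x.
Proof.
move=> x0 xd; rewrite /rho x0 min_l// ler_pdivlMr ?one_sub_exp_gt0// mul1r.
by have := expR_ge1Dx (- x); lra.
Qed.

Let cvg_expN (x : R) : expR (- y) @[y --> x] --> expR (- x).
Proof.
apply: (@cvg_comp _ _ _ (fun y : R => - y) expR _ (nbhs (- x))).
  exact: cvgN.
exact: continuous_expR.
Qed.

Let cvg_min_delta (x : R) : Num.min y delta @[y --> x] --> Num.min x delta.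
Proof.
by apply: (@continuous_min _ _ (fun y : R => y) (cst delta)) => //; exact: cvg_cst.
Qed.

Let continuous_rho : continuous rho.
Proof.
move=> x; have [x0|x0|<-] := ltgtP 0 x.
- have : Num.min y delta / (1 - expR (- y)) @[y --> x] -->
      Num.min x delta / (1 - expR (- x)).
    apply: cvgM; first exact: cvg_min_delta.
    apply: cvgV; first by rewrite gt_eqF// one_sub_exp_gt0.
    by apply: cvgB; [exact: cvg_cst|exact: cvg_expN].
  rewrite /continuous_at {2}/rho x0; apply: cvg_trans; apply: near_eq_cvg.
  by near=> y; rewrite /rho ifT//; near: y; exact: lt_nbhsr.
- rewrite /continuous_at {2}/rho ltNge (ltW x0)/=.
  apply: cvg_near_cst; near=> y; rewrite /rho ifF//.
  by apply/negbTE; rewrite -leNgt ltW//; near: y; exact: lt_nbhsl.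
rewrite /continuous_at {2}/rho ltxx; apply/cvgrPdist_le => e e0.
near=> y; have [y0|y0] := ltP 0 y; last first.
  by rewrite /rho ltNge y0/= subrr normr0 ltW.
have yd : y <= delta by near: y; exact: lt_le_nbhsl.
have ye : y <= e by near: y; exact: lt_le_nbhsl.
have := rho_ge1 y0 yd; have := rho_le y0.
rewrite min_l// mulrDr mulr1 mulfV ?gt_eqF// => h1 h2.
by rewrite ler_norml; apply/andP; split; lra.
Unshelve. all: by end_near. Qed.

Context (h_ : nat -> R) (h_gt0 : forall n, 0 < h_ n).
Context (h_0 : h_ n @[n --> \oo] --> (0 : R)).

Lemma generator_truncated lambda : 0 <= lambda ->
  (h_ n)^-1 * \int[P]_w (Num.min (X (h_ n) w) delta *
    expR (- (lambda * Num.min (X (h_ n) w) delta))) @[n --> \oo] -->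
  b + \int[Pi]_(x in [set` `]0%R, +oo[])
    (Num.min x delta * expR (- (lambda * Num.min x delta))).
Proof.
move=> l0.
(* Multiplication by the weight turns [F] into the wanted integrand, and [F 0 = 1] leaves the drift
   term equal to [b]. *)
pose F x := rho x * expR (- (lambda * Num.min x delta)).
have min_ge0 x : 0 <= x -> 0 <= Num.min x delta.
  by move=> x0; rewrite le_min x0 ltW.
have FE x : 0 <= x -> (1 - expR (- x)) * F x =
    Num.min x delta * expR (- (lambda * Num.min x delta)).
  rewrite le_eqVlt => /orP[/eqP <-|x0].
    by rewrite min_l ?ltW// mulr0 !oppr0 expR0 subrr !mul0r.
  rewrite /F /rho x0 mulrA; congr (_ * _); rewrite mulrC divfK// gt_eqF//.
  exact: one_sub_exp_gt0.
have F0 : F 0 = 1.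
  by rewrite /F /rho ltxx min_l ?ltW// mulr0 oppr0 expR0 mulr1.
have Fcont : continuous F.
  move=> x; apply: cvgM; first exact: continuous_rho.
  apply: (@cvg_comp _ _ _ (fun y : R => lambda * Num.min y delta)
    (fun z => expR (- z)) _ (nbhs (lambda * Num.min x delta))).
    by apply: cvgMr; exact: cvg_min_delta.
  exact: cvg_expN.
have Fbnd x : 0 <= x -> `|F x| <= 1 + delta.
  move=> x0; have e1 : expR (- (lambda * Num.min x delta)) <= 1.
    by rewrite expR_le1 oppr_le0 mulr_ge0// min_ge0.
  have r0 : 0 <= rho x.
    rewrite /rho; case: ifPn => // x0'.
    by rewrite divr_ge0 ?min_ge0// ltW// one_sub_exp_gt0.
  rewrite ger0_norm ?mulr_ge0 ?expR_ge0//.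
  rewrite (@le_trans _ _ (rho x))//; first by rewrite ler_piMr.
  move: x0; rewrite le_eqVlt => /orP[/eqP <-|x0].
    by rewrite /rho ltxx lerDl ltW.
  rewrite (le_trans (rho_le x0))// mulrDr mulr1 addrC lerD//.
    by rewrite ler_pdivrMr// mul1r ge_min lexx.
  by rewrite ge_min lexx orbT.
have Flim : F x @[x --> +oo%R] --> delta / (1 - 0) * expR (- (lambda * delta)).
  have : delta / (1 - expR (- x)) * expR (- (lambda * delta)) @[x --> +oo%R] -->
      delta / (1 - 0) * expR (- (lambda * delta)).
    apply: cvgMl; apply: cvgMr; apply: cvgV; first by rewrite subr0 oner_neq0.
    by apply: cvgB; [exact: cvg_cst|exact: cvgr_expR].
  apply: cvg_trans; apply: near_eq_cvg; near=> x.
  have x0 : 0 < x by near: x; exact: nbhs_pinfty_gt.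
  have dx : delta <= x by near: x; apply: nbhs_pinfty_ge; exact: num_real.
  by rewrite /F /rho x0 min_r.
have := generator_limit hX hbPi h_gt0 h_0 Fcont Fbnd Flim.
rewrite F0 mulr1.
rewrite (_ : \int[Pi]_(x in _) ((1 - expR (- x)) * F x) =
  \int[Pi]_(x in [set` `]0%R, +oo[])
    (Num.min x delta * expR (- (lambda * Num.min x delta)))); last first.
  apply: eq_Rintegral => x; rewrite inE /= in_itv/= andbT => x0.
  by rewrite FE// ltW.
apply: cvg_trans; apply: near_eq_cvg; near=> n; congr (_ * _).
apply: eq_Rintegral => w _; rewrite FE//.
exact/(subordinator_ge0 hX)/ltW.
Unshelve. all: by end_near. Qed.

End truncated_generator.

(** * Truncated increments along a grid *)

Lemma Rintegral_sum d (T : measurableType d) (R : realType)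
    (m : {measure set T -> \bar R}) (D : set T) (I : Type) (s : seq I)
    (f : I -> T -> R) : measurable D ->
  (forall i, m.-integrable D (fun x => (f i x)%:E)) ->
  \int[m]_(x in D) (\sum_(i <- s) f i x) = \sum_(i <- s) \int[m]_(x in D) f i x.
Proof.
move=> mD intf.
have ints r : m.-integrable D (fun x => (\sum_(i <- r) f i x)%:E).
  rewrite (_ : (fun x => _) = (fun x => \sum_(i <- r) (f i x)%:E)%E).
    exact: integrable_sum.
  by apply/funext => x; rewrite sumEFin.
elim: s => [|i s IH].
  under eq_Rintegral do rewrite big_nil.
  by rewrite big_nil /Rintegral integral0.
under eq_Rintegral do rewrite big_cons.
by rewrite RintegralD; [rewrite big_cons IH| |exact: intf|exact: ints].
Qed.

Section truncated_sums.
Context d (T : measurableType d) (R : realType) (P : probability T R).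
Context (X : R -> {RV P >-> R}) (b : R).
Context (Pi : {measure set (measurableTypeR R) -> \bar R}).
Context (hX : is_subordinator X) (hbPi : has_drift_levy_measure X b Pi).
Context (t : R) (t_gt0 : 0 < t).

Section fixed_truncation.
Context (delta : R) (delta_gt0 : 0 < delta).

Let tau n k : R := t * k%:R / n.+1%:R.

Let tau_ge0 n k : 0 <= tau n k.
Proof. by rewrite divr_ge0// mulr_ge0// ltW. Qed.

Let tauS n k : tau n k.+1 = tau n k + t / n.+1%:R.
Proof. by rewrite /tau -natr1 mulrDr mulr1 mulrDl. Qed.

Let step_gt0 n : 0 < t / n.+1%:R. Proof. by rewrite divr_gt0. Qed.

Let incr_ge0 n k w : 0 <= X (tau n k.+1) w - X (tau n k) w.
Proof. by rewrite subr_ge0 (subordinator_nd hX)// tauS lerDl ltW. Qed.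

Definition truncated_sum n w : R :=
  \sum_(k < n.+1) Num.min (X (t * k.+1%:R / n.+1%:R) w - X (t * k%:R / n.+1%:R) w) delta.
Local Notation S := truncated_sum.

Lemma truncated_sum_ge0 n w : 0 <= S n w.
Proof.
apply: sumr_ge0 => k _; rewrite le_min (ltW delta_gt0) andbT.
exact: (incr_ge0 n k w).
Qed.

Lemma measurable_truncated_sum n : measurable_fun [set: T] (S n).
Proof.
apply: measurable_sum => k; apply: measurable_minr; last exact: measurable_cst.
by apply: measurable_funB; exact: measurable_subordinator.
Qed.

Section exponential_moments.
Context (lambda : R) (lambda_ge0 : 0 <= lambda).

Let psi (x : R) : R := expR (- (lambda * Num.min x delta)).
Let phi (x : R) : R := Num.min x delta * psi x.

Let mmin : measurable_fun [set: R] (fun x : R => Num.min x delta).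
Proof. by apply: measurable_minr => //; exact: measurable_cst. Qed.

Let mpsi : measurable_fun [set: R] psi.
Proof.
apply: measurableT_comp => //; apply: measurableT_comp => //.
by apply: measurable_funM.
Qed.

Let mphi : measurable_fun [set: R] phi. Proof. exact: measurable_funM. Qed.

Let min_ge0 x : 0 <= x -> 0 <= Num.min x delta.
Proof. by move=> x0; rewrite le_min x0 ltW. Qed.

Let psi_bnd x : 0 <= x -> 0 <= psi x <= 1.
Proof.
by move=> x0; rewrite expR_ge0 expR_le1 oppr_le0 mulr_ge0// min_ge0.
Qed.

Let phi_bnd x : 0 <= x -> 0 <= phi x <= delta.
Proof.
move=> x0; have /andP[p0 p1] := psi_bnd x0; rewrite mulr_ge0 ?min_ge0//=.
by rewrite (le_trans (ler_piMr (min_ge0 x0) p1))// ge_min lexx orbT.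
Qed.

Let expS n w : expR (- (lambda * S n w)) =
  \prod_(k < n.+1) psi (X (tau n k.+1) w - X (tau n k) w).
Proof. by rewrite -expR_sum sumrN mulr_sumr. Qed.

(** A product rule without derivatives: S e^{-lambda S} is a sum over [k] of products whose [k]-th
    factor alone carries the extra weight, so independence applies to each of them. *)
Let factor n (k : 'I_n.+1) (j : 'I_n.+1) : R -> R := if j == k then phi else psi.

Let sum_expS n w : S n w * expR (- (lambda * S n w)) =
  \sum_(k < n.+1) \prod_(j < n.+1) factor k j (X (tau n j.+1) w - X (tau n j) w).
Proof.
rewrite expS mulr_suml; apply: eq_bigr => k _.
rewrite [in LHS](bigD1 k)//= [in RHS](bigD1 k)//= mulrA /factor eqxx.
by congr (_ * _); apply: eq_bigr => j /negbTE ->.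
Qed.

Let Epsi n := \int[P]_w psi (X (t / n.+1%:R) w).
Let Ephi n := \int[P]_w phi (X (t / n.+1%:R) w).

Let E_expS n : \int[P]_w expR (- (lambda * S n w)) = Epsi n ^+ n.+1.
Proof.
under eq_Rintegral do rewrite expS.
rewrite [LHS](@increments_expectation _ _ _ _ _ hX (tau n) (t / n.+1%:R) 1
  n.+1 (fun=> psi))//.
- by rewrite prodr_const card_ord.
- exact: ltW.
Qed.

Let E_sum_expS n : \int[P]_w (S n w * expR (- (lambda * S n w))) =
  n.+1%:R * (Ephi n * Epsi n ^+ n).
Proof.
have factor_bnd k (j : 'I_n.+1) x : 0 <= x -> 0 <= factor k j x <= 1 + delta.
  rewrite /factor => x0; case: ifP => _.
    have /andP[-> h] := phi_bnd x0; rewrite (le_trans h)//.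
    by rewrite lerDr.
  have /andP[-> h] := psi_bnd x0; rewrite (le_trans h)//.
  by rewrite lerDl ltW.
have mfactor k (j : 'I_n.+1) : measurable_fun [set: R] (factor k j).
  by rewrite /factor; case: ifP.
under eq_Rintegral do rewrite sum_expS.
rewrite Rintegral_sum//; last first.
  move=> k; apply: (@bounded_integrable _ _ _ P _ ((1 + delta) ^+ n.+1)).
    apply: measurable_prod => j _; apply: (measurableT_comp (mfactor k j)).
    by apply: measurable_funB; exact: measurable_subordinator.
  move=> w; rewrite normr_prod.
  rewrite [leRHS](_ : _ = \prod_(j < n.+1) (1 + delta)).
    apply: ler_prod => j _; rewrite normr_ge0/=.
    have /andP[? ?] := factor_bnd k j _ (incr_ge0 n j w).
    by rewrite ger0_norm.
  by rewrite prodr_const card_ord.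
rewrite (eq_bigr (fun=> Ephi n * Epsi n ^+ n)).
  by rewrite sumr_const card_ord mulr_natl.
move=> k _.
rewrite [LHS](@increments_expectation _ _ _ _ _ hX (tau n) (t / n.+1%:R)
  (1 + delta) n.+1 (factor k))//.
- rewrite (bigD1 k)//= {1}/factor eqxx; congr (_ * _).
  rewrite (eq_bigr (fun=> Epsi n)); last by move=> j /negbTE jk; rewrite /factor jk.
  rewrite prodr_const (eq_card (B := predC1 k)) ?cardC1 ?card_ord//.
- exact: ltW.
- by move=> j x; exact: factor_bnd.
Qed.

Let step_cvg : t / n.+1%:R @[n --> \oo] --> (0 : R).
Proof. by rewrite -(mulr0 t); apply: cvgMr; exact: cvg_harmonic. Qed.

(** Truncating the increment only increases the exponential, so [Epsi] lies between the known
    Laplace transform at time t/(n+1) and 1. *)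
Let Epsi_cvg : Epsi n @[n --> \oo] --> (1 : R).
Proof.
pose Phi := laplace_exponent b Pi lambda.
apply: (squeeze_cvgr (f := fun n => expR (- (t / n.+1%:R * Phi))) (h := cst 1)).
- apply: nearW => n; have h0 := ltW (step_gt0 n).
  have mX := measurable_subordinator X (t / n.+1%:R).
  have ipsi : P.-integrable setT (fun w => (psi (X (t / n.+1%:R) w))%:E).
    apply: (@bounded_integrable _ _ _ P _ 1); first exact: (measurableT_comp mpsi).
    move=> w; have /andP[p0 p1] := psi_bnd (subordinator_ge0 hX w h0).
    by rewrite ger0_norm.
  apply/andP; split.
    rewrite -(laplace_subordinator hX hbPi)//; apply: le_Rintegral => //.
      exact: integrable_laplace.
    by move=> w _; rewrite ler_expR lerN2 ler_wpM2l// ge_min lexx.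
  rewrite /= -(Rintegral_probability_cst P 1); apply: le_Rintegral => //.
    apply: (@bounded_integrable _ _ _ P (cst 1) 1); first exact: measurable_cst.
    by move=> w; rewrite normr1.
  by move=> w _; have /andP[] := psi_bnd (subordinator_ge0 hX w h0).
- have : expR (- (t / n.+1%:R * Phi)) @[n --> \oo] --> expR (- (0 * Phi)).
    apply: (@cvg_comp _ _ _ (fun n => - (t / n.+1%:R * Phi)) expR _ (nbhs (- (0 * Phi)))).
      by apply: cvgN; apply: cvgMl; exact: step_cvg.
    exact: continuous_expR.
  by rewrite mul0r oppr0 expR0.
- exact: cvg_cst.
Qed.

Context (A : T -> R) (SA : forall w, S n w @[n --> \oo] --> A w).
Let kappa := b + \int[Pi]_(x in [set` `]0%R, +oo[])
  (Num.min x delta * expR (- (lambda * Num.min x delta))).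

(** With step h = t/(n+1) the grid sums satisfy E[S e^{-lambda S}] Epsi = t (Ephi / h)
    E[e^{-lambda S}]; in the limit [Epsi] becomes 1 and Ephi / h becomes [kappa]. *)
Lemma truncated_limit_identity : 0 < lambda ->
  \int[P]_w (A w * expR (- (lambda * A w))) =
  t * kappa * \int[P]_w expR (- (lambda * A w)).
Proof.
move=> l0.
have mA : measurable_fun [set: T] A.
  apply: (measurable_fun_cvg (h := S)) => [n|w _]; last exact: SA.
  exact: measurable_truncated_sum.
have mexp (f : T -> R) : measurable_fun [set: T] f ->
    measurable_fun [set: T] (fun w => expR (- (lambda * f w))).
  move=> mf; apply: measurableT_comp => //; apply: measurableT_comp => //.
  exact: measurable_funM.
have icst (r : R) : P.-integrable setT (EFin \o cst r).
  apply: (@bounded_integrable _ _ _ P (cst r) `|r|); first exact: measurable_cst.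
  by [].
have expA w : expR (- (lambda * S n w)) @[n --> \oo] --> expR (- (lambda * A w)).
  apply: (@cvg_comp _ _ _ (fun n => - (lambda * S n w)) expR _
    (nbhs (- (lambda * A w)))); last exact: continuous_expR.
  by apply: cvgN; apply: cvgMr; exact: SA.
have c1 : \int[P]_w expR (- (lambda * S n w)) @[n --> \oo] -->
    \int[P]_w expR (- (lambda * A w)).
  apply: (dominated_cvg_Rintegral (g := cst 1)) => //.
  - by move=> n; apply: mexp; exact: measurable_truncated_sum.
  - exact: mexp.
  - move=> n w _; rewrite ger0_norm ?expR_ge0// expR_le1 oppr_le0.
    by rewrite mulr_ge0// truncated_sum_ge0.
have c2 : \int[P]_w (S n w * expR (- (lambda * S n w))) @[n --> \oo] -->
    \int[P]_w (A w * expR (- (lambda * A w))).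
  (* For [lambda > 0] the function z e^{-lambda z} is at most 1 / lambda on [[0, +oo[], which gives
     domination by a constant. *)
  apply: (dominated_cvg_Rintegral (g := cst lambda^-1)) => //.
  - move=> n; apply: measurable_funM; first exact: measurable_truncated_sum.
    by apply: mexp; exact: measurable_truncated_sum.
  - by apply: measurable_funM => //; exact: mexp.
  - by move=> w _; apply: cvgM; [exact: SA|exact: expA].
  - move=> n w _; rewrite ger0_norm ?mulr_ge0 ?expR_ge0 ?truncated_sum_ge0//.
    rewrite /= -[leRHS]mulr1 -(expRxMexpNx_1 (lambda * S n w)) mulrA.
    rewrite ler_wpM2r ?expR_ge0// mulrC ler_pdivlMr// mulrC.
    by have := expR_ge1Dx (lambda * S n w); lra.
have c3 := generator_truncated hX hbPi delta_gt0 step_gt0 step_cvg lambda_ge0.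
have eqn n : \int[P]_w (S n w * expR (- (lambda * S n w))) * Epsi n =
    t * ((t / n.+1%:R)^-1 * Ephi n) * \int[P]_w expR (- (lambda * S n w)).
  rewrite E_sum_expS E_expS exprS.
  have N0 : (n.+1%:R : R) != 0 by rewrite pnatr_eq0.
  move: (n.+1%:R) N0 => N N0; have t0 := lt0r_neq0 t_gt0.
  by field; rewrite N0 t0.
have l1 : \int[P]_w (S n w * expR (- (lambda * S n w))) * Epsi n @[n --> \oo] -->
    \int[P]_w (A w * expR (- (lambda * A w))) * 1.
  by apply: cvgM.
have l2 : t * ((t / n.+1%:R)^-1 * Ephi n) *
    \int[P]_w expR (- (lambda * S n w)) @[n --> \oo] -->
    t * kappa * \int[P]_w expR (- (lambda * A w)).
  by apply: cvgM => //; apply: cvgMr.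
rewrite -[LHS]mulr1; apply: (cvg_unique _ l1) => //.
by rewrite (funext eqn).
Qed.

End exponential_moments.
End fixed_truncation.
End truncated_sums.

(** * The continuous part is the drift *)

Section continuous_part.
Context d (T : measurableType d) (R : realType) (P : probability T R).
Context (X : R -> {RV P >-> R}) (b : R).
Context (Pi : {measure set (measurableTypeR R) -> \bar R}).
Context (hX : is_subordinator X) (hbPi : has_drift_levy_measure X b Pi).
Context (t : R) (t_gt0 : 0 < t).

Let J delta w : R :=
  fine (\esum_(s in `]0%R, t]) (Num.min (jump X s w) delta)%:E)%E.

(** [C] is obtained path by path by choice, hence without measurability, which is recovered
    afterwards from the limits stated here. *)
Lemma truncated_sum_pathwise_limit : exists C : T -> R, [/\ forall w, 0 <= C w,
  forall delta w, 0 < delta -> 0 <= J delta w,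
  forall delta w, 0 < delta ->
    truncated_sum X t delta n w @[n --> \oo] --> C w + J delta w &
  forall w e, 0 < e -> exists2 h, 0 < h &
    forall delta, 0 < delta -> delta < h -> J delta w <= e].
Proof.
have [_ _ cad _ _] := hX.
have H w := @truncated_grid_sum_cvg R (fun u => X u w)
  (fun s t => @subordinator_nd _ _ _ _ X hX w s t) (fun s => (cad w).1 s)
  (fun s => (cad w).2 s) t t_gt0 (subordinator0 hX w).
have /choice[C HC] : forall w, exists c, 0 <= c /\
    (forall delta, 0 < delta -> 0 <= J delta w /\
      truncated_sum X t delta n w @[n --> \oo] --> c + J delta w) /\
    (forall e, 0 < e -> exists2 h, 0 < h &
      forall delta, 0 < delta -> delta < h -> J delta w <= e).
  by move=> w; have [c c0 [h1 h2]] := H w; exists c.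
exists C; split=> [w|delta w d0|delta w d0|w e e0].
- by have [] := HC w.
- by have [_ [/(_ _ d0)[] ]] := HC w.
- by have [_ [/(_ _ d0)[] ]] := HC w.
- by have [_ [_ /(_ _ e0)]] := HC w.
Qed.

Let D : set R := [set` `]0%R, +oo[].

Let mD : measurable (D : set (measurableTypeR R)).
Proof. exact: measurable_itv. Qed.

Let hPi : is_subordinator_levy_measure Pi. Proof. by case: hbPi. Qed.

Definition truncated_mean delta lambda : R := b + \int[Pi]_(x in [set` `]0%R, +oo[])
  (Num.min x delta * expR (- (lambda * Num.min x delta))).

Lemma truncated_integrable delta lambda : 0 < delta -> 0 <= lambda ->
  Pi.-integrable D (fun x =>
    (Num.min x delta * expR (- (lambda * Num.min x delta)))%:E).
Proof.
move=> d0 l0.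
have mmin : measurable_fun [set: R] (fun x : R => Num.min x delta).
  by apply: measurable_minr => //; exact: measurable_cst.
apply: (levy_integrable hPi (C := 1 + delta)).
  apply: measurable_funM => //; apply: measurableT_comp => //.
  by apply: measurableT_comp => //; exact: measurable_funM.
move=> x x0; have m0 : 0 <= Num.min x delta by rewrite le_min !ltW.
rewrite ger0_norm ?mulr_ge0 ?expR_ge0//.
rewrite (@le_trans _ _ (Num.min x delta))//.
  by rewrite ler_piMr// expR_le1 oppr_le0 mulr_ge0.
have [x1|x1] := ltP 1 x.
  by rewrite mulr1 ge_min lerDr ler01 orbT.
rewrite ge_min; apply/orP; left.
by rewrite ler_peMl// ?lerDl// ltW.
Qed.

Lemma truncated_mean_cvg (delta_ : nat -> R) lambda : 0 <= lambda ->
  (forall n, 0 < delta_ n <= 1) -> delta_ n @[n --> \oo] --> (0 : R) ->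
  truncated_mean (delta_ n) lambda @[n --> \oo] --> b.
Proof.
move=> l0 d01 d0; rewrite -[X in _ --> X]addr0.
rewrite (_ : 0 = \int[Pi]_(x in D) cst (0 : R) x); last first.
  by rewrite /Rintegral integral0.
apply: cvgD; first exact: cvg_cst.
(* At [lambda = 0] the exponential is 1, so this is the integrability of [Num.min x 1], the
   dominating function. *)
have i1 := truncated_integrable ltr01 (lexx (0 : R)).
apply: (@dominated_cvg_Rintegral _ _ _ Pi D
  (fun n x => Num.min x (delta_ n) * expR (- (lambda * Num.min x (delta_ n))))
  (cst 0) (fun x => Num.min x 1 * expR (- (0 * Num.min x 1)))) => //.
- move=> n; have /andP[dn _] := d01 n.
  by have /measurable_int/measurable_EFinP := truncated_integrable dn l0.
- move=> x; rewrite /D /= in_itv/= andbT => x0.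
  apply: (squeeze_cvgr (f := cst 0) (h := delta_)) => //; last exact: cvg_cst.
  apply: nearW => n; have /andP[dn _] := d01 n.
  have m0 : 0 <= Num.min x (delta_ n) by rewrite le_min !ltW.
  rewrite mulr_ge0 ?expR_ge0//=.
  rewrite (@le_trans _ _ (Num.min x (delta_ n)))//.
    by rewrite ler_piMr// expR_le1 oppr_le0 mulr_ge0.
  by rewrite ge_min lexx orbT.
- move=> n x; rewrite /D /= in_itv/= andbT => x0; have /andP[dn dn1] := d01 n.
  have m0 : 0 <= Num.min x (delta_ n) by rewrite le_min !ltW.
  rewrite ger0_norm ?mulr_ge0 ?expR_ge0// mul0r oppr0 expR0 mulr1.
  rewrite (@le_trans _ _ (Num.min x (delta_ n)))//.
    by rewrite ler_piMr// expR_le1 oppr_le0 mulr_ge0.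
  by rewrite le_min !ge_min lexx dn1 orbT.
Qed.

Context (C : T -> R) (C0 : forall w, 0 <= C w).
Context (J0 : forall delta w, 0 < delta -> 0 <= J delta w).
Context (limS : forall delta w, 0 < delta ->
    truncated_sum X t delta n w @[n --> \oo] --> C w + J delta w).
Context (Jlim : forall w e, 0 < e -> exists2 h, 0 < h &
    forall delta, 0 < delta -> delta < h -> J delta w <= e).

Let mA delta : 0 < delta -> measurable_fun [set: T] (fun w => C w + J delta w).
Proof.
move=> d0; apply: (measurable_fun_cvg (h := truncated_sum X t delta)) => [n|w _].
  exact: measurable_truncated_sum.
exact: limS.
Qed.

Let delta_ (n : nat) : R := n.+1%:R^-1.

Let delta_gt0 n : 0 < delta_ n. Proof. by rewrite invr_gt0. Qed.

Let delta_cvg : delta_ n @[n --> \oo] --> (0 : R). Proof. exact: cvg_harmonic. Qed.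

Let A_cvg w : C w + J (delta_ n) w @[n --> \oo] --> C w.
Proof.
rewrite -[X in _ --> X]addr0; apply: cvgD; first exact: cvg_cst.
apply/cvgrPdist_le => e e0; have [h h0 H] := Jlim w e0.
near=> n; rewrite sub0r normrN ger0_norm ?J0//; apply: H => //.
by near: n; exact: (near_infty_natSinv_lt (PosNum h0)).
Unshelve. all: by end_near. Qed.

(** [C] is the limit of [C + J delta] as delta decreases to 0, and each of these is a limit of
    measurable grid sums. *)
Lemma measurable_continuous_part : measurable_fun [set: T] C.
Proof.
apply: (measurable_fun_cvg (h := fun n w => C w + J (delta_ n) w)) => [n|w _].
  exact: mA.
exact: A_cvg.
Qed.

Lemma measurable_jump_part delta : 0 < delta -> measurable_fun [set: T] (J delta).
Proof.
move=> d0; have -> : J delta = (fun w => (C w + J delta w) - C w).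
  by apply/funext => w; rewrite addrC addKr.
apply: measurable_funB; [exact: mA|exact: measurable_continuous_part].
Qed.

Let mexp lambda (f : T -> R) : measurable_fun [set: T] f ->
  measurable_fun [set: T] (fun w => expR (- (lambda * f w))).
Proof.
move=> mf; apply: measurableT_comp => //; apply: measurableT_comp => //.
exact: measurable_funM.
Qed.

Let icst (r : R) : P.-integrable setT (EFin \o cst r).
Proof.
by apply: (@bounded_integrable _ _ _ P (cst r) `|r|); first exact: measurable_cst.
Qed.

Let iexp lambda (f : T -> R) : 0 <= lambda -> measurable_fun [set: T] f ->
  (forall w, 0 <= f w) ->
  P.-integrable setT (fun w => (expR (- (lambda * f w)))%:E).
Proof.
move=> l0 mf f0; apply: (@bounded_integrable _ _ _ P _ 1); first exact: mexp.
by move=> w; rewrite ger0_norm ?expR_ge0// expR_le1 oppr_le0 mulr_ge0.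
Qed.

Let mul_exp_le lambda (z : R) : 0 < lambda -> 0 <= z ->
  `|z * expR (- (lambda * z))| <= lambda^-1.
Proof.
move=> l0 z0; rewrite ger0_norm ?mulr_ge0 ?expR_ge0//.
rewrite -[leRHS]mulr1 -(expRxMexpNx_1 (lambda * z)) mulrA.
rewrite ler_wpM2r ?expR_ge0// mulrC ler_pdivlMr// mulrC.
by have := expR_ge1Dx (lambda * z); lra.
Qed.

Let imul_exp lambda (f : T -> R) : 0 < lambda -> measurable_fun [set: T] f ->
  (forall w, 0 <= f w) ->
  P.-integrable setT (fun w => (f w * expR (- (lambda * f w)))%:E).
Proof.
move=> l0 mf f0; apply: (@bounded_integrable _ _ _ P _ lambda^-1).
  by apply: measurable_funM => //; exact: mexp.
by move=> w; exact: mul_exp_le.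
Qed.

Let continuous_part_identity lambda : 0 < lambda ->
  \int[P]_w (C w * expR (- (lambda * C w))) =
  t * b * \int[P]_w expR (- (lambda * C w)).
Proof.
move=> l0; pose A n w := C w + J (delta_ n) w.
have A0 n w : 0 <= A n w by rewrite addr_ge0// J0.
have mAn n : measurable_fun [set: T] (A n) by exact: mA.
have mC := measurable_continuous_part.
have expA w : expR (- (lambda * A n w)) @[n --> \oo] --> expR (- (lambda * C w)).
  apply: (@cvg_comp _ _ _ (fun n => - (lambda * A n w)) expR _
    (nbhs (- (lambda * C w)))); last exact: continuous_expR.
  by apply: cvgN; apply: cvgMr; exact: A_cvg.
have c1 : \int[P]_w expR (- (lambda * A n w)) @[n --> \oo] -->
    \int[P]_w expR (- (lambda * C w)).
  apply: (dominated_cvg_Rintegral (g := cst 1)) => //.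
  - by move=> n; exact: mexp.
  - exact: mexp.
  - move=> n w _; rewrite ger0_norm ?expR_ge0// expR_le1 oppr_le0.
    by rewrite mulr_ge0// ltW.
have c2 : \int[P]_w (A n w * expR (- (lambda * A n w))) @[n --> \oo] -->
    \int[P]_w (C w * expR (- (lambda * C w))).
  apply: (dominated_cvg_Rintegral (g := cst lambda^-1)) => //.
  - by move=> n; apply: measurable_funM => //; exact: mexp.
  - by apply: measurable_funM => //; exact: mexp.
  - by move=> w _; apply: cvgM; [exact: A_cvg|exact: expA].
  - by move=> n w _; exact: mul_exp_le.
have c3 : t * truncated_mean (delta_ n) lambda *
    \int[P]_w expR (- (lambda * A n w)) @[n --> \oo] -->
    t * b * \int[P]_w expR (- (lambda * C w)).
  apply: cvgM => //; apply: cvgMr; apply: truncated_mean_cvg => //.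
    exact: ltW.
  by move=> n; rewrite delta_gt0 invf_le1// ler1n.
apply: (cvg_unique _ c2) => //.
rewrite (_ : (fun n => _) = (fun n => t * truncated_mean (delta_ n) lambda *
    \int[P]_w expR (- (lambda * A n w))))//.
apply/funext => n; apply: (truncated_limit_identity hX hbPi) => //.
- exact: ltW.
- by move=> w; exact: limS.
Qed.

(* The two identities [E[(C - tb) e^{-C}] = E[(C - tb) e^{-2C}] = 0] combine into
   the vanishing of the expectation of a nonnegative variable. *)
Lemma continuous_part_ae : {ae P, forall w, C w = t * b}.
Proof.
have mC := measurable_continuous_part.
(* Nonnegative because e^{-x} decreases, so that the two differences have the same sign. *)
pose f w := (C w - t * b) * (expR (- (t * b)) - expR (- C w)) * expR (- C w).
have f0 w : 0 <= f w.
  rewrite mulr_ge0 ?expR_ge0//; have [h|h] := leP (C w) (t * b).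
    by rewrite mulr_le0// subr_le0// ler_expR lerN2.
  by rewrite mulr_ge0// subr_ge0 ?ler_expR ?lerN2 ltW.
pose m w := expR (- (t * b)) *
   (C w * expR (- (1 * C w)) - t * b * expR (- (1 * C w))) -
   (C w * expR (- (2 * C w)) - t * b * expR (- (2 * C w))).
have fm w : f w = m w.
  rewrite /f /m mul1r (_ : - (2 * C w) = - C w + - C w); last by ring.
  by rewrite expRD; ring.
have id1 := continuous_part_identity ltr01.
have id2 := continuous_part_identity (ltr0n R 2 : 0 < 2).
have i1 := imul_exp ltr01 mC C0; have i2 := imul_exp (ltr0n R 2 : 0 < 2) mC C0.
have e1 := integrable_scaler measurableT (t * b) (iexp (@ler01 R) mC C0).
have e2 := integrable_scaler measurableT (t * b) (iexp (ler0n R 2) mC C0).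
have if1 : P.-integrable setT (fun w => (m w)%:E).
  apply: integrable_subr => //; last exact: integrable_subr.
  by apply: integrable_scaler => //; exact: integrable_subr.
have intf : \int[P]_w f w = 0.
  under eq_Rintegral do rewrite fm.
  rewrite /m RintegralB//; last 2 first.
    by apply: integrable_scaler => //; exact: integrable_subr.
    exact: integrable_subr.
  rewrite RintegralZl//; last exact: integrable_subr.
  rewrite !RintegralB// !RintegralZl//; try exact: iexp.
  by rewrite id1 id2; ring.
have if0 : P.-integrable setT (fun w => (f w)%:E).
  by rewrite (_ : (fun w => (f w)%:E) = (fun w => (m w)%:E))//;
    apply/funext => w; rewrite fm.
have : (\int[P]_w `|(f w)%:E| = 0)%E.
  under eq_integral do rewrite gee0_abs ?lee_fin//.
  have := integrable_fin_num measurableT if0 => /fineK <-.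
  by rewrite -/(Rintegral _ _ _) intf.
move/ae_eq_integral_abs => /(_ measurableT) H.
have {}H := H ltac:(exact: measurable_int if0).
apply: filterS H => w /(_ I) /= [].
rewrite /f => /eqP; rewrite !mulf_eq0 (gt_eqF (expR_gt0 _)) orbF.
move=> /orP[|]; rewrite subr_eq0 => /eqP//.
by move=> /expR_inj /oppr_inj.
Qed.

End continuous_part.

(** * The size-bias identity of the shortened process *)

Section shortened_law.
Context d (T : measurableType d) (R : realType) (P : probability T R).
Context (X : R -> {RV P >-> R}) (b : R).
Context (Pi : {measure set (measurableTypeR R) -> \bar R}).
Context (hX : is_subordinator X) (hbPi : has_drift_levy_measure X b Pi).
Context (t : R) (t_gt0 : 0 < t).

Let b0 : 0 <= b. Proof. by case: hbPi. Qed.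

Section fixed_delta.
Context (delta : R) (delta_gt0 : 0 < delta).
Local Notation U := (shortened b X delta t).

Lemma shortened_ge0 w : 0 <= U w.
Proof.
have [C [_ J0 _ _]] := truncated_sum_pathwise_limit hX t_gt0.
by rewrite addr_ge0 ?mulr_ge0 ?J0// ltW.
Qed.

Lemma measurable_shortened : measurable_fun [set: T] U.
Proof.
have [C [C0 J0 limS Jlim]] := truncated_sum_pathwise_limit hX t_gt0.
apply: measurable_funD; first exact: measurable_cst.
exact: (measurable_jump_part J0 limS Jlim).
Qed.

(** The identity is known for [C + J], where [C] may differ from [t * b] on a null set; expectations
    do not see the difference. *)
Lemma shortened_exp_identity lambda : 0 < lambda ->
  \int[P]_w (U w * expR (- (lambda * U w))) =
  t * truncated_mean b Pi delta lambda * \int[P]_w expR (- (lambda * U w)).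
Proof.
move=> l0.
have [C [C0 J0 limS Jlim]] := truncated_sum_pathwise_limit hX t_gt0.
pose A w := C w +
  fine (\esum_(s in `]0%R, t]) (Num.min (jump X s w) delta)%:E)%E.
have id : \int[P]_w (A w * expR (- (lambda * A w))) =
    t * truncated_mean b Pi delta lambda * \int[P]_w expR (- (lambda * A w)).
  apply: (truncated_limit_identity hX hbPi t_gt0 delta_gt0 (ltW l0)) => // w.
  exact: limS.
have ae := continuous_part_ae hX hbPi t_gt0 C0 J0 limS Jlim.
have mC := measurable_continuous_part J0 limS Jlim.
have mU := measurable_shortened.
have AU : {ae P, forall w, A w = U w}.
  by apply: filterS ae => w Cw; rewrite /A Cw mulrC.
have mA : measurable_fun [set: T] A.
  apply: measurable_funD => //.
  exact: (measurable_jump_part J0 limS Jlim).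
have swap (g : R -> R) : measurable_fun [set: R] g ->
    \int[P]_w g (U w) = \int[P]_w g (A w).
  move=> mg; rewrite /Rintegral; congr fine; apply: ae_eq_integral => //.
  - by apply/measurable_EFinP; exact: (measurableT_comp mg).
  - by apply/measurable_EFinP; exact: (measurableT_comp mg).
  - by apply: filterS AU => w /= -> _.
have me : measurable_fun [set: R] (fun x : R => expR (- (lambda * x))).
  by apply: measurableT_comp => //; apply: measurableT_comp.
rewrite (swap _ me) (swap (fun x => x * expR (- (lambda * x))))//.
exact: measurable_funM.
Qed.

Let D : set R := [set` `]0%R, +oo[].

Let mD : measurable (D : set (measurableTypeR R)).
Proof. exact: measurable_itv. Qed.

Let y (x : R) : R := Num.min x delta.

Let y_gt0 x : D x -> 0 < y x.
Proof. by rewrite /D /= in_itv/= andbT /y lt_min delta_gt0 => ->. Qed.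

Let y_ge0 x : D x -> 0 <= y x. Proof. by move/y_gt0/ltW. Qed.

Let my : measurable_fun [set: R] y.
Proof. by apply: measurable_minr => //; exact: measurable_cst. Qed.

Let bounded (F : R -> R) := exists M, forall x, 0 <= x -> `|F x| <= M.

Let iy : Pi.-integrable D (fun x => (y x)%:E).
Proof.
have := truncated_integrable hbPi delta_gt0 (lexx (0 : R)).
have e : (fun x => (Num.min x delta * expR (- (0 * Num.min x delta)))%:E) =
    (fun x => (y x)%:E).
  by apply/funext => x; rewrite mul0r oppr0 expR0 mulr1.
by rewrite -e.
Qed.

Let iyF (F : R -> R) (M z : R) : measurable_fun [set: R] F ->
  (forall x, 0 <= x -> `|F x| <= M) -> 0 <= z ->
  Pi.-integrable D (fun x => (y x * F (z + y x))%:E).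
Proof.
move=> mF FM z0; apply: (@le_integrable _ _ _ Pi D mD _ (fun x => (M * y x)%:E)).
- apply/measurable_EFinP; apply: measurable_funTS; apply: measurable_funM => //.
  by apply: (measurableT_comp mF); exact: measurable_funD.
- move=> x Dx; have y0 := y_ge0 Dx.
  rewrite /= lee_fin normrM (ger0_norm y0) mulrC.
  by rewrite (le_trans _ (ler_norm _))// ler_wpM2r// FM// addr_ge0.
- exact: integrable_scaler.
Qed.

Definition jump_transform (F : R -> R) (z : R) : R :=
  \int[Pi]_(x in [set` `]0%R, +oo[]) (Num.min x delta * F (z + Num.min x delta)).
Local Notation Psi := jump_transform.

Local Notation mean := (b + \int[Pi]_(x in [set` `]0%R, +oo[]) Num.min x delta).

Let mean_int_ge0 : 0 <= \int[Pi]_(x in D) y x.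
Proof. by apply: Rintegral_ge0 => x Dx; exact: y_ge0. Qed.

Let mean_ge0 : 0 <= mean. Proof. by rewrite addr_ge0. Qed.

Let Psi_bound (F : R -> R) (M z : R) : measurable_fun [set: R] F ->
  (forall x, 0 <= x -> `|F x| <= M) -> 0 <= z ->
  `|Psi F z| <= M * \int[Pi]_(x in D) y x.
Proof.
move=> mF FM z0; have i1 := iyF mF FM z0.
rewrite (le_trans (le_normr_Rintegral _ _))// -RintegralZl//.
apply: le_Rintegral => //.
- exact: integrable_norm.
- exact: integrable_scaler.
move=> x Dx; have y0 := y_ge0 Dx.
by rewrite normrM (ger0_norm y0) mulrC ler_wpM2r// FM// addr_ge0.
Qed.

Let Psi_linear (a : R) (F G : R -> R) (z : R) : measurable_fun [set: R] F -> bounded F ->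
  measurable_fun [set: R] G -> bounded G -> 0 <= z ->
  Psi (fun x => a * F x + G x) z = a * Psi F z + Psi G z.
Proof.
move=> mF [M FM] mG [N GN] z0.
have iF := iyF mF FM z0; have iG := iyF mG GN z0.
rewrite -RintegralZl// -RintegralD//; last exact: integrable_scaler.
by apply: eq_Rintegral => x _; rewrite mulrDr mulrCA.
Qed.

Let mU := measurable_shortened.
Let U0 := shortened_ge0.

(** The exponential identity bounds E[U e^{-lambda U}] by [t * mean] uniformly in lambda; monotone
    convergence as lambda decreases to 0 concludes. *)
Lemma shortened_integrable : P.-integrable setT (fun w => (U w)%:E).
Proof.
pose f n w := U w * expR (- (n.+1%:R^-1 * U w)).
have n0 n : 0 < n.+1%:R^-1 :> R by rewrite invr_gt0.
have mf n : measurable_fun [set: T] (f n).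
  apply: measurable_funM => //; apply: measurableT_comp => //.
  by apply: measurableT_comp => //; exact: measurable_funM.
have f0 n w : 0 <= f n w by rewrite mulr_ge0 ?expR_ge0.
have me n : P.-integrable setT (fun w => (expR (- (n.+1%:R^-1 * U w)))%:E).
  apply: (@bounded_integrable _ _ _ P _ 1).
    apply: measurableT_comp => //; apply: measurableT_comp => //.
    exact: measurable_funM.
  move=> w; rewrite ger0_norm ?expR_ge0// expR_le1 oppr_le0 mulr_ge0//.
have intf n : P.-integrable setT (fun w => (f n w)%:E).
  apply: (@bounded_integrable _ _ _ P _ n.+1%:R) => // w.
  rewrite ger0_norm// /f -[leRHS]mulr1.
  rewrite -[X in _ <= _ * X](expRxMexpNx_1 (n.+1%:R^-1 * U w)) mulrA.
  rewrite ler_wpM2r ?expR_ge0// -ler_pdivrMl// (le_trans _ (expR_ge1Dx _))//.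
  by rewrite lerDr.
have fle n : (\int[P]_w (f n w)%:E <= (t * mean)%:E)%E.
  have := integrable_fin_num measurableT (intf n) => /fineK <-.
  rewrite lee_fin -/(Rintegral _ _ _) shortened_exp_identity//.
  rewrite -[leRHS]mulr1; apply: ler_pM.
  - rewrite mulr_ge0 ?(ltW t_gt0)// addr_ge0//; apply: Rintegral_ge0 => x Dx.
    by rewrite mulr_ge0 ?expR_ge0// y_ge0.
  - by apply: Rintegral_ge0 => w _; exact: expR_ge0.
  - rewrite ler_pM2l// lerD2l; apply: le_Rintegral => //.
      exact: (truncated_integrable hbPi delta_gt0 (ltW (n0 n))).
    move=> x Dx; rewrite ler_piMr ?y_ge0// expR_le1 oppr_le0.
    by rewrite mulr_ge0 ?y_ge0// ltW.
  - rewrite -[leRHS](Rintegral_probability_cst P 1).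
    apply: le_Rintegral; [exact: measurableT|exact: me| |].
      apply: (@bounded_integrable _ _ _ P (cst 1) 1); first exact: measurable_cst.
      by move=> w; rewrite normr1.
    by move=> w _; rewrite expR_le1 oppr_le0 mulr_ge0.
apply/integrableP; split; first exact/measurable_EFinP.
under eq_integral do rewrite gee0_abs ?lee_fin//.
apply: (@le_lt_trans _ _ (t * mean)%:E); last exact: ltry.
have lim w : (f n w)%:E @[n --> \oo] --> (U w)%:E.
  apply: cvg_EFin; first exact: nearW.
  rewrite -[X in _ --> X]mulr1; apply: cvgMr.
  have : expR (- (n.+1%:R^-1 * U w)) @[n --> \oo] --> expR (- (0 * U w)).
    apply: (@cvg_comp _ _ _ (fun n => - (n.+1%:R^-1 * U w)) expR _ (nbhs (- (0 * U w)))).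
      by apply: cvgN; apply: cvgMl; exact: cvg_harmonic.
    exact: continuous_expR.
  by rewrite mul0r oppr0 expR0.
rewrite (_ : (\int[P]_w (U w)%:E = \int[P]_w limn (fun n => (f n w)%:E))%E); last first.
  by apply: eq_integral => w _; apply/esym/cvg_lim => //; exact: lim.
rewrite monotone_convergence//.
- apply: lime_le; last exact: nearW.
  apply: ereal_nondecreasing_is_cvgn => i j ij; apply: ge0_le_integral => //.
  + by move=> w _; rewrite lee_fin.
  + by apply/measurable_EFinP.
  + by apply/measurable_EFinP.
  + move=> w _; rewrite lee_fin ler_wpM2l// ler_expR lerN2 ler_wpM2r//.
    by rewrite lef_pV2 ?posrE// ler_nat.
- by move=> n; apply/measurable_EFinP.
- by move=> n w _; rewrite lee_fin.
- move=> w _ i j ij; rewrite lee_fin ler_wpM2l// ler_expR lerN2 ler_wpM2r//.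
  by rewrite lef_pV2 ?posrE// ler_nat.
Qed.

Let iU := shortened_integrable.

Let iFU (F : R -> R) (M : R) : measurable_fun [set: R] F ->
  (forall x, 0 <= x -> `|F x| <= M) ->
  P.-integrable setT (fun w => (F (U w))%:E).
Proof.
move=> mF FM; apply: (@bounded_integrable _ _ _ P _ M).
  exact: (measurableT_comp mF).
by move=> w; exact: FM.
Qed.

Let iUFU (F : R -> R) (M : R) : measurable_fun [set: R] F ->
  (forall x, 0 <= x -> `|F x| <= M) ->
  P.-integrable setT (fun w => (U w * F (U w))%:E).
Proof.
move=> mF FM; apply: (@le_integrable _ _ _ P setT measurableT _
  (fun w => (M * U w)%:E)).
- apply/measurable_EFinP; apply: measurable_funM => //.
  exact: (measurableT_comp mF).
- move=> w _; have Uw := U0 w.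
  rewrite /= lee_fin normrM (ger0_norm Uw) mulrC.
  by rewrite (le_trans _ (ler_norm _))// ler_wpM2r// FM.
- exact: integrable_scaler.
Qed.

Let iPsi (F : R -> R) (M : R) : measurable_fun [set: R] F ->
  (forall x, 0 <= x -> `|F x| <= M) ->
  measurable_fun [set: T] (fun w => Psi F (U w)) ->
  P.-integrable setT (fun w => (Psi F (U w))%:E).
Proof.
move=> mF FM mP.
apply: (@bounded_integrable _ _ _ P _ (M * \int[Pi]_(x in D) y x)) => // w.
exact: Psi_bound.
Qed.

(** The side conditions travel with the identity so that the class is closed under linear
    combinations, which is what the induction on polynomials uses. *)
Let good (F : R -> R) := [/\ measurable_fun [set: R] F, bounded F,
  measurable_fun [set: T] (fun w => Psi F (U w)) &
  \int[P]_w (U w * F (U w)) = t * \int[P]_w (b * F (U w) + Psi F (U w))].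

Let good_linear a F G : good F -> good G -> good (fun x => a * F x + G x).
Proof.
move=> [mF bF mPF eF] [mG bG mPG eG].
have PsiE w : Psi (fun x => a * F x + G x) (U w) = a * Psi F (U w) + Psi G (U w).
  exact: Psi_linear.
have [M FM] := bF; have [N GN] := bG.
have i1 := iFU mF FM; have i2 := iFU mG GN.
have i3 := iUFU mF FM; have i4 := iUFU mG GN.
have i5 := iPsi mF FM mPF; have i6 := iPsi mG GN mPG.
have i7 := integrable_addr measurableT (integrable_scaler measurableT b i1) i5.
have i8 := integrable_addr measurableT (integrable_scaler measurableT b i2) i6.
split.
- by apply: measurable_funD => //; exact: measurable_funM.
- exists (`|a| * M + N) => x x0; rewrite (le_trans (ler_normD _ _))//.
  by rewrite lerD ?GN// normrM ler_wpM2l// FM.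
- rewrite (_ : (fun w => _) = (fun w => a * Psi F (U w) + Psi G (U w))).
    by apply: measurable_funD => //; exact: measurable_funM.
  by apply/funext => w; exact: PsiE.
- transitivity (a * \int[P]_w (U w * F (U w)) + \int[P]_w (U w * G (U w))).
    rewrite -RintegralZl// -RintegralD//; last exact: integrable_scaler.
    by apply: eq_Rintegral => w _; ring.
  rewrite eF eG mulrCA -mulrDr; congr (_ * _).
  rewrite -RintegralZl// -RintegralD//; last exact: integrable_scaler.
  by apply: eq_Rintegral => w _; rewrite PsiE; ring.
Qed.

Let good0 : good (cst 0).
Proof.
have PsiE z : Psi (cst 0) z = 0.
  rewrite /Psi; under eq_Rintegral do rewrite mulr0.
  by rewrite /Rintegral integral0.
split.
- exact: measurable_cst.
- by exists 0 => x _; rewrite normr0.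
- by under eq_fun do rewrite PsiE; exact: measurable_cst.
- under eq_Rintegral do rewrite mulr0.
  under [in RHS]eq_Rintegral do rewrite PsiE mulr0 addr0.
  by rewrite (Rintegral_probability_cst P 0) mulr0.
Qed.

(** Exponentials are eigenfunctions of [Psi], with the jump part of [truncated_mean] as eigenvalue,
    so the identity reduces to [shortened_exp_identity]. The rates k + 1 are positive, as that
    identity requires. *)
Let good_exp k : good (fun z => expR (- (k.+1%:R * z))).
Proof.
have k0 : 0 < k.+1%:R :> R by rewrite ltr0n.
have mexp : measurable_fun [set: R] (fun z : R => expR (- (k.+1%:R * z))).
  by apply: measurableT_comp => //; apply: measurableT_comp.
have iy' := truncated_integrable hbPi delta_gt0 (ltW k0).
have PsiE z : Psi (fun z => expR (- (k.+1%:R * z))) z =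
    (truncated_mean b Pi delta k.+1%:R - b) * expR (- (k.+1%:R * z)).
  rewrite /truncated_mean addrAC subrr add0r mulrC -RintegralZl//.
  by apply: eq_Rintegral => x _; rewrite mulrDr opprD expRD; ring.
have ie := @iFU (fun z => expR (- (k.+1%:R * z))) 1 mexp.
have b1 x : 0 <= x -> `|expR (- (k.+1%:R * x))| <= 1 :> R.
  by move=> x0; rewrite ger0_norm ?expR_ge0// expR_le1 oppr_le0 mulr_ge0// ltW.
split => //.
- by exists 1.
- under eq_fun do rewrite PsiE.
  by apply: measurable_funM => //; exact: (measurableT_comp mexp).
- rewrite shortened_exp_identity// -mulrA; congr (_ * _).
  rewrite -RintegralZl//; last exact: ie.
  by apply: eq_Rintegral => w _; rewrite PsiE; ring.
Qed.

Let good_poly (p : {poly R}) k :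
  good (fun z => p.[expR (- z)] * expR (- (k.+1%:R * z))).
Proof.
elim/poly_ind: p k => [|p c IH] k.
  rewrite (_ : (fun z => _) = cst 0)//.
  by apply/funext => x; rewrite horner0 mul0r.
rewrite (_ : (fun z => _) = (fun z => c * expR (- (k.+1%:R * z)) +
    p.[expR (- z)] * expR (- (k.+2%:R * z)))); first exact: good_linear.
apply/funext => z; rewrite hornerMXaddC.
have -> : - (k.+2%:R * z) = - z + - (k.+1%:R * z) :> R.
  by rewrite -[in LHS]natr1; ring.
by rewrite expRD; ring.
Qed.

(* Exponential polynomials without constant term are dense in the space of
   functions vanishing at infinity. *)
Lemma shortened_identity (F : R -> R) (M K : R) :
  (forall x, `|F x| <= M) -> (forall x z, `|F x - F z| <= K * `|x - z|) ->
  F x @[x --> +oo%R] --> (0 : R) ->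
  measurable_fun [set: T] (fun w => Psi F (U w)) /\
  \int[P]_w (U w * F (U w)) = t * \int[P]_w (b * F (U w) + Psi F (U w)).
Proof.
move=> FM FK F0.
have lip_cont (G : R -> R) (N : R) :
    (forall x z, `|G x - G z| <= N * `|x - z|) -> continuous G.
  move=> GN x; apply/cvgrPdist_le => e e0.
  have N1 : 0 < `|N| + 1 by rewrite ltr_wpDl.
  near=> z; rewrite (le_trans (GN _ _))//.
  have : `|x - z| <= e / (`|N| + 1).
    by near: z; apply: cvgr_dist_le; [exact: cvg_id|rewrite divr_gt0].
  rewrite ler_pdivlMr// mulrC; apply: le_trans.
  by rewrite ler_wpM2r// (le_trans (ler_norm _))// lerDl.
have cF := lip_cont _ _ FK.
have FM' x : 0 <= x -> `|F x| <= M by [].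
have mF : measurable_fun [set: R] F by exact: continuous_measurable_fun.
have mPsi : measurable_fun [set: T] (fun w => Psi F (U w)).
  (* [Psi F] inherits the Lipschitz property of [F] on [[0, +oo[]; clamping the argument extends it
     to the line, where continuity gives measurability. *)
  pose G z := Psi F (Num.max z 0).
  rewrite (_ : (fun w => _) = G \o U); last first.
    by apply/funext => w; rewrite /G /= max_l.
  apply: (measurableT_comp (f := G)) => //.
  apply: continuous_measurable_fun; apply: (lip_cont _ (K * \int[Pi]_(x in D) y x)).
  move=> x z; set x' := Num.max x 0; set z' := Num.max z 0.
  have x0 : 0 <= x' by rewrite le_max lexx orbT.
  have z0 : 0 <= z' by rewrite le_max lexx orbT.
  have xz : `|x' - z'| <= `|x - z|.
    rewrite /x' /z' /Num.max; case: ltP => ?; case: ltP => ?.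
    + by rewrite subrr normr0.
    + by rewrite sub0r normrN ger0_norm// ler_normr; apply/orP; right; lra.
    + by rewrite subr0 ger0_norm// ler_normr; apply/orP; left; lra.
    + by [].
  have K0 : 0 <= K.
    by have := FK 1 0; rewrite subr0 normr1 mulr1; apply: le_trans.
  have ix := iyF mF FM' x0; have iz := iyF mF FM' z0.
  rewrite /G -/x' -/z' /Psi -RintegralB//.
  rewrite (le_trans (le_normr_Rintegral _ _))//; first exact: integrable_subr.
  rewrite mulrAC -RintegralZl//.
  apply: le_Rintegral => //.
  - by apply: integrable_norm; exact: integrable_subr.
  - exact: integrable_scaler.
  move=> u Du; have u0 := y_ge0 Du.
  rewrite -mulrBr normrM (ger0_norm u0) mulrC ler_wpM2r//.
  rewrite (le_trans (FK _ _))// ler_wpM2l// (le_trans _ xz)//.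
  by rewrite (_ : x' + _ - _ = x' - z')//; ring.
split=> //; apply/eqP; rewrite -subr_eq0 -normr_le0; apply/ler_addgt0Pl => e e0.
rewrite addr0.
(* Dominates the total weight of the two sides, against which a uniform error is multiplied; adding
   1 makes it positive. *)
pose B := \int[P]_w U w + t * mean + 1.
have EU0 : 0 <= \int[P]_w U w by apply: Rintegral_ge0.
have tm0 : 0 <= t * mean by rewrite mulr_ge0// ltW.
have B0 : 0 < B by rewrite /B ltr_wpDl// addr_ge0.
pose e' := e / B / 4.
have e'0 : 0 < e' by rewrite !divr_gt0.
have [p Hp] := exp_weierstrass_approximation cF FM' F0 e'0.
have [q [c pE]] : exists q c, p = q * 'X + c%:P.
  by elim/poly_ind: p {Hp} => [|p c _]; [exists 0, 0; rewrite mul0r add0r|exists p, c].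
pose G z := q.[expR (- z)] * expR (- (1%:R * z)).
have gG : good G by exact: (good_poly q 0).
have [mG [N GN] mPG eG] := gG.
have pG z : p.[expR (- z)] = G z + c.
  by rewrite pE hornerMXaddC /G mul1r.
(* At +oo the function [F] tends to 0 and the polynomial to its constant term, so that term is at
   most [e']; removing it at most doubles the error and leaves a member of the class [good]. *)
have c_le : `|c| <= e'.
  have : `|F x - p.[expR (- x)]| @[x --> +oo%R] --> `|0 - p.[0]|.
    apply: cvg_norm; apply: cvgB => //.
    apply: (@cvg_comp _ _ _ (fun x => expR (- x)) (horner p) _ (nbhs 0)).
      exact: cvgr_expR.
    exact: continuous_horner.
  rewrite sub0r normrN pE hornerMXaddC mulr0 add0r => H.
  rewrite -(cvg_lim _ H)//; apply: limr_le; first by apply/cvg_ex; exists `|c|.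
  by near=> x; rewrite -pE; apply: Hp; near: x; apply: nbhs_pinfty_ge; exact: num_real.
have FG x : 0 <= x -> `|F x - G x| <= 2 * e'.
  move=> x0; have := Hp x x0; rewrite pG => h.
  have -> : F x - G x = (F x - (G x + c)) + c by ring.
  by rewrite (le_trans (ler_normD _ _))//; lra.
have i1 := iFU mF FM'; have i2 := iFU mG GN.
have i3 := iUFU mF FM'; have i4 := iUFU mG GN.
have i5 := iPsi mF FM' mPsi; have i6 := iPsi mG GN mPG.
have i7 := integrable_addr measurableT (integrable_scaler measurableT b i1) i5.
have i8 := integrable_addr measurableT (integrable_scaler measurableT b i2) i6.
have d1 : `|\int[P]_w (U w * F (U w)) - \int[P]_w (U w * G (U w))| <=
    2 * e' * \int[P]_w U w.
  rewrite -RintegralB// (le_trans (le_normr_Rintegral _ _))//.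
    exact: integrable_subr.
  rewrite -RintegralZl//; apply: le_Rintegral => //.
  - by apply: integrable_norm; exact: integrable_subr.
  - exact: integrable_scaler.
  move=> w _; rewrite -mulrBr normrM (ger0_norm (U0 w)) mulrC.
  by rewrite ler_wpM2r// FG.
have d2 : `|\int[P]_w (b * F (U w) + Psi F (U w)) -
    \int[P]_w (b * G (U w) + Psi G (U w))| <= 2 * e' * mean.
  rewrite -RintegralB// (le_trans (le_normr_Rintegral _ _))//.
    exact: integrable_subr.
  rewrite -[leRHS](Rintegral_probability_cst P); apply: le_Rintegral => //.
  - by apply: integrable_norm; exact: integrable_subr.
  - apply: (@bounded_integrable _ _ _ P (cst _) `|2 * e' * mean|) => //.
  move=> w _; rewrite opprD addrACA -mulrBr (le_trans (ler_normD _ _))//.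
  rewrite [leRHS]mulrDr lerD//.
    by rewrite normrM (ger0_norm b0) mulrC ler_wpM2r// FG.
  have <- : Psi (fun x => -1 * G x + F x) (U w) = Psi F (U w) - Psi G (U w).
    rewrite Psi_linear ?mulN1r 1?addrC//; first by exists N.
    by exists M.
  apply: Psi_bound => //.
  - by apply: measurable_funD => //; exact: measurable_funM.
  - by move=> x x0; rewrite mulN1r addrC FG.
have -> : \int[P]_w (U w * F (U w)) - t * \int[P]_w (b * F (U w) + Psi F (U w)) =
    (\int[P]_w (U w * F (U w)) - \int[P]_w (U w * G (U w))) -
    t * (\int[P]_w (b * F (U w) + Psi F (U w)) -
         \int[P]_w (b * G (U w) + Psi G (U w))).
  by rewrite eG; ring.
rewrite (le_trans (ler_normB _ _))// normrM (gtr0_norm t_gt0).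
have d3 : t * `|\int[P]_w (b * F (U w) + Psi F (U w)) -
    \int[P]_w (b * G (U w) + Psi G (U w))| <= 2 * e' * (t * mean).
  by rewrite mulrCA ler_pM2l.
rewrite (le_trans (lerD d1 d3))// -mulrDr.
have -> : e = 4 * e' * B by rewrite /e'; field; rewrite gt_eqF.
apply: ler_pM => //; [|exact: addr_ge0| |].
- by rewrite mulr_ge0// ltW.
- by rewrite ler_pM2r// ler_nat.
- by rewrite lerDl.
Unshelve. all: by end_near. Qed.

End fixed_delta.
End shortened_law.

(** * Gaussian tails *)

Section mean_value.
Context (R : realType).
Implicit Types (f df : R -> R) (x y a b K : R).

Lemma derive_continuous f df x : is_derive x 1 f (df x) -> {for x, continuous f}.
Proof. by move=> [/derivable1_diffP/differentiable_continuous]. Qed.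

Lemma mean_value f df a b : a < b ->
  (forall x, a <= x <= b -> is_derive x 1 f (df x)) ->
  exists2 c, a < c < b & f b - f a = df c * (b - a).
Proof.
move=> ab fd; have [||c] := @MVT R f df a b ab.
- by move=> x; rewrite in_itv/= => /andP[? ?]; apply: fd; rewrite !ltW.
- apply: continuous_in_subspaceT => x; rewrite inE /= in_itv/= => xab.
  exact: derive_continuous (fd _ xab).
- by rewrite in_itv/= => cab H; exists c.
Qed.

Lemma is_derive_fun f g x (df dg : R) : f =1 g -> df = dg ->
  is_derive x 1 f df -> is_derive x 1 g dg.
Proof. by move=> /funext -> ->. Qed.

Lemma is_derive_mul f g x (df dg : R) : is_derive x 1 f df -> is_derive x 1 g dg ->
  is_derive x 1 (fun y => f y * g y) (f x * dg + g x * df).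
Proof. by move=> fd gd; exact: is_deriveM. Qed.

Lemma is_derive_sub f g x (df dg : R) : is_derive x 1 f df -> is_derive x 1 g dg ->
  is_derive x 1 (fun y => f y - g y) (df - dg).
Proof. by move=> fd gd; exact: is_deriveB. Qed.

Lemma is_derive_exp_comp f x (df : R) : is_derive x 1 f df ->
  is_derive x 1 (fun y => expR (f y)) (expR (f x) * df).
Proof. by move=> fd; exact: is_derive1_comp. Qed.

Lemma is_derive_inv f x (df : R) : f x != 0 -> is_derive x 1 f df ->
  is_derive x 1 (fun y => (f y)^-1) (- (f x) ^- 2 * df).
Proof. by move=> fx fd; exact: is_deriveV. Qed.

Lemma derive_bounded_lipschitz f df K : (forall x, is_derive x 1 f (df x)) ->
  (forall x, `|df x| <= K) -> forall x y, `|f x - f y| <= K * `|x - y|.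
Proof.
move=> fd dK.
have H x y : x < y -> `|f x - f y| <= K * `|x - y|.
  move=> xy; have [c _ E] := mean_value xy (fun z _ => fd z).
  by rewrite distrC E normrM [`|x - y|]distrC ler_wpM2r.
move=> x y; have [xy|xy|->] := ltgtP x y; first exact: H.
  by rewrite distrC [`|x - y|]distrC; exact: H.
by rewrite !subrr normr0 mulr0.
Qed.

Lemma nonincreasing_tail_ge0 f df a :
  (forall x, a < x -> is_derive x 1 f (df x)) -> (forall x, a < x -> df x <= 0) ->
  f x @[x --> +oo%R] --> (0 : R) -> forall x, a < x -> 0 <= f x.
Proof.
move=> fd d0 f0 x ax; rewrite -(cvg_lim _ f0)//.
apply: limr_le; first by apply/cvg_ex; exists 0.
near=> y; have xy : x < y by near: y; apply: nbhs_pinfty_gt; exact: num_real.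
have [z /andP[z1 z2]|c /andP[c1 _] E] := @mean_value f df x y xy.
  by apply: fd; exact: lt_le_trans z1.
rewrite -subr_le0 E mulr_le0_ge0// ?d0 ?subr_ge0 ?(ltW xy)//.
exact: lt_trans c1.
Unshelve. all: by end_near. Qed.

End mean_value.

(** * Tail bounds for the standard normal law *)

Section gaussian_tail.
Context (R : realType).

Implicit Types x y : R.
Local Notation phi := (normal_pdf 0 1 : R -> R).

Lemma gauss_pdfE : phi = fun x => normal_peak 1 * expR (- (x ^+ 2 / 2)).
Proof.
apply/funext => x; rewrite normal_pdfE ?oner_neq0// /normal_fun subr0.
by rewrite expr1n mulNr.
Qed.

Lemma gauss_pdf_gt0 x : 0 < phi x.
Proof. by rewrite gauss_pdfE mulr_gt0 ?expR_gt0// normal_peak_gt0// oner_neq0. Qed.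

Lemma is_derive_gauss_pdf x : is_derive x 1 phi (- (x * phi x)).
Proof.
rewrite gauss_pdfE.
have d1 : is_derive x 1 (fun y : R => - (y ^+ 2 / 2)) (- x).
  have := is_derive_mul (is_derive_id x (1 : R)) (is_derive_id x (1 : R)).
  move=> /(is_derive_mul (is_derive_cst (- 2^-1 : R) x (1 : R))).
  apply: is_derive_fun => [y|]; first by rewrite /= expr2; ring.
  by rewrite /=; field.
have := is_derive_mul (is_derive_cst (normal_peak 1 : R) x (1 : R)) (is_derive_exp_comp d1).
by apply: is_derive_fun => //; rewrite /=; ring.
Qed.

Lemma gauss_pdf_anti x y : `|x| <= `|y| -> phi y <= phi x.
Proof.
move=> xy; rewrite gauss_pdfE ler_pM2l ?normal_peak_gt0 ?oner_neq0//.
by rewrite ler_expR lerN2 ler_pM2r// -[leLHS]real_normK ?num_real//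
  -[leRHS]real_normK ?num_real// lerXn2r// nnegrE.
Qed.

Lemma gauss_pdfN x : phi (- x) = phi x.
Proof. by rewrite gauss_pdfE sqrrN. Qed.

Lemma gauss_pdf_cvg0 : phi x @[x --> +oo%R] --> (0 : R).
Proof.
apply: (squeeze_cvgr (f := cst 0) (h := fun x => normal_peak 1 * expR (- x))).
- near=> x; rewrite ltW ?gauss_pdf_gt0//= gauss_pdfE ler_pM2l; last first.
    by rewrite normal_peak_gt0// oner_neq0.
  have x2 : 2 <= x by near: x; apply: nbhs_pinfty_ge; exact: num_real.
  by rewrite ler_expR lerN2 ler_pdivlMr// expr2 ler_wpM2l//; lra.
- exact: cvg_cst.
- by rewrite -(mulr0 (normal_peak 1)); apply: cvgMr; exact: cvgr_expR.
Unshelve. all: by end_near. Qed.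

(* Each difference has a derivative of constant sign and vanishes at infinity. *)
Lemma gauss_tail_bounds (H : R -> R) (k rho : R) : 1 <= rho -> 0 <= k ->
  (forall x, rho < x -> is_derive x 1 H (- (k * phi x))) ->
  H x @[x --> +oo%R] --> (0 : R) ->
  forall x, rho < x ->
    k * (x^-1 - x^-1 ^+ 3) * phi x <= H x <= k * x^-1 * phi x.
Proof.
move=> r1 k0 dH H0.
have dV x : rho < x -> is_derive x 1 (fun y : R => y^-1) (- x^-1 ^+ 2).
  move=> rx; have x0 : x != 0 by apply: lt0r_neq0; lra.
  have := is_derive_inv (f := id) x0 (is_derive_id x (1 : R)).
  by apply: is_derive_fun => //; rewrite mulr1 exprVn.
have dV3 x : rho < x -> is_derive x 1 (fun y : R => y^-1 ^+ 3) (- (3 * x^-1 ^+ 4)).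
  move=> rx; have := is_derive_mul (dV x rx) (is_derive_mul (dV x rx) (dV x rx)).
  by apply: is_derive_fun => [y|]; ring.
have small (g : R -> R) : (forall x, 1 <= x -> 0 <= g x <= 1) ->
    k * g x * phi x @[x --> +oo%R] --> (0 : R).
  move=> g01; apply: (squeeze_cvgr (f := cst 0) (h := fun x => k * phi x)).
  - near=> x; have /g01/andP[g0 g1] : 1 <= x.
      by near: x; apply: nbhs_pinfty_ge; exact: num_real.
    have p0 := ltW (gauss_pdf_gt0 x).
    by rewrite !mulr_ge0//= ler_wpM2r// ler_piMr.
  - exact: cvg_cst.
  - by rewrite -[X in _ --> X](mulr0 k); apply: cvgMr; exact: gauss_pdf_cvg0.
move=> x rx; apply/andP; split; rewrite -subr_ge0.
(* In the derivative the terms of order x^{-2} cancel, which leaves -3 k x^{-4} phi. *)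
- apply: (@nonincreasing_tail_ge0 _ (fun x => H x - k * (x^-1 - x^-1 ^+ 3) * phi x)
    (fun x => - (3 * k * x^-1 ^+ 4 * phi x)) rho) => // [z rz|z rz|].
  + have z0 : z != 0 by apply: lt0r_neq0; lra.
    have := is_derive_mul (is_derive_mul (is_derive_cst k z (1 : R))
      (is_derive_sub (dV z rz) (dV3 z rz))) (is_derive_gauss_pdf z).
    move=> /(is_derive_sub (dH z rz)); apply: is_derive_fun => //.
    by rewrite /=; field.
  + by rewrite oppr_le0 !mulr_ge0 ?exprn_ge0// ?invr_ge0 ?ltW ?gauss_pdf_gt0//; lra.
  + rewrite -[X in _ --> X](subr0 0); apply: cvgB => //; apply: small => z z1.
    have z0 : 0 < z by lra.
    have v0 : 0 < z^-1 by rewrite invr_gt0.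
    have v1 : z^-1 <= 1 by rewrite invf_le1.
    have v3 : z^-1 ^+ 3 <= z^-1 by rewrite -[leRHS]expr1 ler_wiXn2l// ltW.
    by rewrite subr_ge0 v3/= (le_trans _ v1)// gerBl exprn_ge0// ltW.
- apply: (@nonincreasing_tail_ge0 _ (fun x => k * x^-1 * phi x - H x)
    (fun x => - (k * x^-1 ^+ 2 * phi x)) rho) => // [z rz|z rz|].
  + have z0 : z != 0 by apply: lt0r_neq0; lra.
    have := is_derive_sub (is_derive_mul (is_derive_mul (is_derive_cst k z (1 : R))
      (dV z rz)) (is_derive_gauss_pdf z)) (dH z rz).
    apply: is_derive_fun => //.
    by rewrite /=; field.
  + by rewrite oppr_le0 !mulr_ge0 ?exprn_ge0// ?invr_ge0 ?ltW ?gauss_pdf_gt0//; lra.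
  + rewrite -[X in _ --> X](subr0 0); apply: cvgB => //; apply: small => z z1.
    have z0 : 0 < z by lra.
    by rewrite invr_ge0 ltW//= invf_le1.
Unshelve. all: by end_near. Qed.

Lemma is_derive_lower_integral (g : R -> R) x : continuous g ->
  (@lebesgue_measure R).-integrable setT (EFin \o g) ->
  is_derive x 1 (fun y => \int[@lebesgue_measure R]_(z in [set` `]-oo, y]]) g z) (g x).
Proof.
move=> cg ig.
have [||||d1 d2] := @continuous_FTC1 R g -oo%O x (x + 1).
- by rewrite ltrDl.
- by apply: integrableS ig => //; exact: measurable_itv.
- by rewrite ltNyr.
- exact: cg.
by apply: DeriveDef; [exact: d1|rewrite -derive1E; exact: d2].
Qed.

Local Notation gcdf := (fun x =>
  \int[@lebesgue_measure R]_(z in [set` `]-oo, x]]) phi z).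

Lemma gauss_cdfE x : (gcdf x)%:E = normal_prob 0 1 [set` `]-oo, x]].
Proof.
rewrite /normal_prob /Rintegral fineK//.
by apply: integrable_fin_num => //; apply: integrableS (integrable_normal_pdf 0 1).
Qed.

(** The identity viewed as a random variable under the normal law: its distribution function is
    [gcdf], whose limits at infinity follow. *)
Let idTR : measurableTypeR R -> R := idfun.

#[local] HB.instance Definition _ :=
  @isMeasurableFun.Build _ _ _ _ idTR (@measurable_id _ _ setT).

Lemma gauss_cdf_cvgy : gcdf x @[x --> +oo%R] --> (1 : R).
Proof.
have := @cvg_cdfy1 _ _ _ (normal_prob 0 1 : probability (measurableTypeR R) R)
  (idTR : {RV (normal_prob 0 1 : probability (measurableTypeR R) R) >-> R}).
move/fine_cvg; apply: cvg_trans; apply: near_eq_cvg; near=> x.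
by rewrite /= -[LHS]/(fine (gcdf x)%:E) gauss_cdfE.
Unshelve. all: by end_near. Qed.

Lemma gauss_cdf_cvgNy : gcdf x @[x --> -oo%R] --> (0 : R).
Proof.
have := @cvg_cdfNy0 _ _ _ (normal_prob 0 1 : probability (measurableTypeR R) R)
  (idTR : {RV (normal_prob 0 1 : probability (measurableTypeR R) R) >-> R}).
move/fine_cvg; apply: cvg_trans; apply: near_eq_cvg; near=> x.
by rewrite /= -[LHS]/(fine (gcdf x)%:E) gauss_cdfE.
Unshelve. all: by end_near. Qed.

End gaussian_tail.

(** * Stein's equation *)

Section stein_equation.
Context (R : realType) (h : R -> R) (rho K : R).
Context (rho_ge1 : 1 <= rho) (h01 : forall x, 0 <= h x <= 1).
Context (h_lip : forall x y, `|h x - h y| <= K * `|x - y|).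
Context (h_left : forall x, x <= - rho -> h x = 1).
Context (h_right : forall x, rho <= x -> h x = 0).

Let mu := @lebesgue_measure R.
Let phi : R -> R := normal_pdf 0 1.
Let c := \int[mu]_x (h x * phi x).
Let Phi x := \int[mu]_(z in [set` `]-oo, x]]) phi z.
Let hPhi x := \int[mu]_(z in [set` `]-oo, x]]) (h z * phi z).
Let H x := hPhi x - c * Phi x.

Let phi_gt0 x : 0 < phi x. Proof. exact: gauss_pdf_gt0. Qed.

Let cphi : continuous phi. Proof. by apply: continuous_normal_pdf; exact: oner_neq0. Qed.

Let ch : continuous h.
Proof.
move=> x; apply/cvgrPdist_le => e e0.
have K1 : 0 < `|K| + 1 by rewrite ltr_wpDl.
near=> z; rewrite (le_trans (h_lip _ _))//.
have : `|x - z| <= e / (`|K| + 1).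
  by near: z; apply: cvgr_dist_le; [exact: cvg_id|rewrite divr_gt0].
rewrite ler_pdivlMr// mulrC; apply: le_trans.
by rewrite ler_wpM2r// (le_trans (ler_norm _))// lerDl.
Unshelve. all: by end_near. Qed.

Let chphi : continuous (fun x => h x * phi x).
Proof. by move=> x; apply: cvgM; [exact: ch|exact: cphi]. Qed.

Let iphi : mu.-integrable setT (fun x => (phi x)%:E).
Proof. exact: integrable_normal_pdf. Qed.

Let ihphi : mu.-integrable setT (fun x => (h x * phi x)%:E).
Proof.
apply: (@le_integrable _ _ _ mu setT measurableT _ (fun x => (phi x)%:E)) => //.
- by apply/measurable_EFinP; exact: continuous_measurable_fun.
- move=> x _; have /andP[h0 h1] := h01 x; have p0 := ltW (phi_gt0 x).
  by rewrite /= lee_fin !ger0_norm ?mulr_ge0// ler_piMl.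
Qed.

Let iphiD (D : set R) : measurable D -> mu.-integrable D (fun x => (phi x)%:E).
Proof. by move=> mD; apply: integrableS iphi. Qed.

Let ihphiD (D : set R) : measurable D -> mu.-integrable D (fun x => (h x * phi x)%:E).
Proof. by move=> mD; apply: integrableS ihphi. Qed.

Let int_phi : \int[mu]_x phi x = 1.
Proof. by rewrite /Rintegral integral_normal_pdf. Qed.

Let hphi_le x : h x * phi x <= phi x.
Proof. by have /andP[_ h1] := h01 x; rewrite ler_piMl// ltW. Qed.

Let hphi_ge0 x : 0 <= h x * phi x.
Proof. by have /andP[h0 _] := h01 x; rewrite mulr_ge0// ltW. Qed.

Lemma stein_mean_itv : 0 <= c <= 1.
Proof.
apply/andP; split; first by apply: Rintegral_ge0 => x _.
by rewrite -int_phi; apply: le_Rintegral.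
Qed.

Let Phi_itv x : 0 <= Phi x <= 1.
Proof.
apply/andP; split; first by apply: Rintegral_ge0 => z _; exact: ltW.
rewrite -lee_fin gauss_cdfE.
exact: (@probability_le1 _ _ _ (normal_prob 0 1 : probability (measurableTypeR R) R)).
Qed.

Let hPhi_itv x : 0 <= hPhi x <= 1.
Proof.
apply/andP; split; first by apply: Rintegral_ge0 => z _.
have /andP[_ P1] := Phi_itv x; apply: le_trans P1.
by apply: le_Rintegral => //; [exact: ihphiD|exact: iphiD].
Qed.

Let H_le x : `|H x| <= 1.
Proof.
have /andP[a0 a1] := hPhi_itv x; have /andP[b0 b1] := Phi_itv x.
have /andP[c0 c1] := stein_mean_itv.
have : c * Phi x <= 1 by rewrite mulr_ile1.
have : 0 <= c * Phi x by rewrite mulr_ge0.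
by rewrite ler_norml /H => *; apply/andP; split; lra.
Qed.

(** Right of [rho] the integral of h phi is already complete, and left of [- rho] it coincides with
    that of phi; in both regions [H] is a multiple of a Gaussian tail. *)
Let H_right x : rho <= x -> H x = c * (1 - Phi x).
Proof.
move=> rx; have E : hPhi x = c.
  rewrite /hPhi /c Rintegral_mkcond; apply: eq_Rintegral => z _.
  rewrite patchE; case: ifPn => // /negP; rewrite inE /= in_itv/= => /negP.
  rewrite -ltNge => xz; rewrite h_right ?mul0r//.
  by rewrite (le_trans rx)// ltW.
by rewrite /H E; ring.
Qed.

Let H_left x : x <= - rho -> H x = (1 - c) * Phi x.
Proof.
move=> xr; have E : hPhi x = Phi x.
  apply: eq_Rintegral => z; rewrite inE /= in_itv/= => zx.
  by rewrite h_left ?mul1r// (le_trans zx).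
by rewrite /H E; ring.
Qed.

Let dH (x : R) : is_derive x 1 H ((h x - c) * phi x).
Proof.
have d1 := is_derive_lower_integral x chphi ihphi.
have d2 := is_derive_lower_integral x cphi iphi.
have := is_derive_sub d1 (is_derive_mul (is_derive_cst c x (1 : R)) d2).
by apply: is_derive_fun => //; rewrite /=; ring.
Qed.

(** The classical solution: the integral of (h - c) phi up to [x], divided by phi. Its derivative
    [df] is written in the form that Stein's equation dictates. *)
Let f x := H x / phi x.
Let df x := x * f x + (h x - c).

Let dphi (x : R) : is_derive x 1 phi (- (x * phi x)).
Proof. exact: is_derive_gauss_pdf. Qed.

Let f_derive (x : R) : is_derive x 1 f (df x).
Proof.
have p0 := lt0r_neq0 (phi_gt0 x).
have := is_derive_mul (dH x) (is_derive_inv p0 (dphi x)).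
apply: is_derive_fun => //; rewrite /df /f; field.
by rewrite p0.
Qed.

Let tail_right x : rho < x -> c * (x^-1 - x^-1 ^+ 3) <= f x <= c * x^-1.
Proof.
move=> rx; have /andP[c0 c1] := stein_mean_itv.
have := @gauss_tail_bounds R H c rho rho_ge1 c0 _ _ x rx.
rewrite /f ler_pdivlMr// ler_pdivrMr//; apply.
- move=> z rz; have := dH z; rewrite h_right ?(ltW rz)//.
  by apply: is_derive_fun => //; rewrite -/phi; ring.
- have : c * (1 - Phi z) @[z --> +oo%R] --> c * (1 - 1).
    apply: cvgMr; apply: cvgB; first exact: cvg_cst.
    exact: gauss_cdf_cvgy.
  rewrite subrr mulr0; apply: cvg_trans; apply: near_eq_cvg; near=> z.
  by rewrite H_right//; near: z; apply: nbhs_pinfty_ge; exact: num_real.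
Unshelve. all: by end_near. Qed.

Let tail_left x : rho < x ->
  (1 - c) * (x^-1 - x^-1 ^+ 3) <= f (- x) <= (1 - c) * x^-1.
Proof.
move=> rx; have /andP[c0 c1] := stein_mean_itv.
have c1' : 0 <= 1 - c by rewrite subr_ge0.
have := @gauss_tail_bounds R (fun z => H (- z)) (1 - c) rho rho_ge1 c1' _ _ x rx.
rewrite /f /phi gauss_pdfN -/phi ler_pdivlMr// ler_pdivrMr//; apply.
- move=> z rz; have zr : - z <= - rho by rewrite lerN2 ltW.
  have := @is_derive1_comp R H -%R z _ _ (dH (- z)) (is_deriveNid z (1 : R)).
  by apply: is_derive_fun => //; rewrite h_left// /phi gauss_pdfN; ring.
- have : (1 - c) * Phi (- z) @[z --> +oo%R] --> (1 - c) * 0.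
    apply: cvgMr.
    by have /cvgNy_compNP := @gauss_cdf_cvgNy R.
  rewrite mulr0; apply: cvg_trans; apply: near_eq_cvg; near=> z.
  rewrite H_left// lerN2; near: z; apply: nbhs_pinfty_ge; exact: num_real.
Unshelve. all: by end_near. Qed.

(** Bounds f in the middle region, since |H| <= 1 and [phi] is smallest there at the ends [rho] and
    [- rho]. *)
Let F0 := (phi rho)^-1.

Let F0_ge0 : 0 <= F0. Proof. by rewrite invr_ge0 ltW. Qed.

Let f_mid x : `|x| <= rho -> `|f x| <= F0.
Proof.
move=> xr; have p0 := phi_gt0 x; have pr := phi_gt0 rho.
rewrite normrM normfV (gtr0_norm p0) ler_pdivrMr//.
rewrite (le_trans (H_le x))// /F0 mulrC ler_pdivlMr// mul1r.
by apply: gauss_pdf_anti; rewrite (ger0_norm (le_trans ler01 rho_ge1)).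
Qed.

(** Beyond [rho], f + x f' combines f (1 + x^2) with a multiple of x, each possibly of linear
    growth. The two tail bounds differ by k u^{-3} only, so the growth cancels up to k u^{-1} above
    and k u^{-3} below. *)
Let tail_mul (k u g : R) : 0 <= k <= 1 -> 1 <= u ->
  k * (u^-1 - u^-1 ^+ 3) <= g <= k * u^-1 ->
  [/\ 0 <= g <= u^-1, 0 <= u * g <= 1 & `|g * (1 + u ^+ 2) - k * u| <= 1].
Proof.
move=> /andP[k0 k1] u1 /andP[g1 g2].
have u0 : 0 < u by lra.
have uN : u != 0 by rewrite gt_eqF.
have v0 : 0 < u^-1 by rewrite invr_gt0.
have v1 : u^-1 <= 1 by rewrite invf_le1.
have v3 : u^-1 ^+ 3 <= u^-1 by rewrite -[leRHS]expr1 ler_wiXn2l// ltW.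
have v30 : 0 <= u^-1 ^+ 3 by rewrite exprn_ge0// ltW.
have g0 : 0 <= g by rewrite (le_trans _ g1)// mulr_ge0// subr_ge0.
have gv : g <= u^-1 by rewrite (le_trans g2)// ler_piMl// ltW.
have W0 : 0 < 1 + u ^+ 2 by rewrite ltr_pwDl// sqr_ge0.
have G2 : g * (1 + u ^+ 2) <= k * u^-1 * (1 + u ^+ 2) by rewrite ler_pM2r.
have G1 : k * (u^-1 - u^-1 ^+ 3) * (1 + u ^+ 2) <= g * (1 + u ^+ 2).
  by rewrite ler_pM2r.
have E2 : k * u^-1 * (1 + u ^+ 2) = k * u^-1 + k * u by field.
have E1 : k * (u^-1 - u^-1 ^+ 3) * (1 + u ^+ 2) = k * u - k * u^-1 ^+ 3 by field.
have kv : k * u^-1 <= 1 by rewrite mulr_ile1// ltW.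
have kv3 : k * u^-1 ^+ 3 <= 1 by rewrite mulr_ile1// (le_trans v3).
split.
- by rewrite g0.
- by rewrite mulr_ge0 ?(ltW u0)//= mulrC -ler_pdivlMr// mul1r.
- rewrite E2 in G2; rewrite E1 in G1.
  by rewrite ler_norml; apply/andP; split; lra.
Qed.

Let stein_bounds x : [/\ `|f x| <= F0 + 1, `|df x| <= rho * F0 + 2 &
  `|f x + x * df x| <= F0 * (1 + rho ^+ 2) + rho + 1].
Proof.
have /andP[c0 c1] := stein_mean_itv.
have F00 := F0_ge0; have r1 := rho_ge1; have r0 : 0 <= rho by lra.
have r2 : 0 <= F0 * (1 + rho ^+ 2) by rewrite mulr_ge0// addr_ge0// sqr_ge0.
have rF : 0 <= rho * F0 by rewrite mulr_ge0.
have hc : `|h x - c| <= 1.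
  by have /andP[? ?] := h01 x; rewrite ler_norml; apply/andP; split; lra.
have E : f x + x * df x = f x * (1 + x ^+ 2) + (h x - c) * x.
  by rewrite /df; ring.
have [xr|xr] := leP `|x| rho.
  have fm := f_mid xr.
  have b1 : `|x * f x| <= rho * F0 by rewrite normrM ler_pM.
  split; first lra.
  - by rewrite (le_trans (ler_normD _ _))//; lra.
  rewrite E (le_trans (ler_normD _ _))//.
  have b2 : `|f x * (1 + x ^+ 2)| <= F0 * (1 + rho ^+ 2).
    rewrite normrM ler_pM// ger0_norm ?addr_ge0 ?sqr_ge0// lerD2l.
    by rewrite -real_normK ?num_real// lerXn2r// nnegrE.
  have b3 : `|(h x - c) * x| <= rho.
    by rewrite normrM (le_trans _ xr)// ler_piMl.
  lra.
have key : [/\ `|f x| <= 1, `|x * f x| <= 1 & `|f x + x * df x| <= 1].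
  move: xr; rewrite E lter_normr => /orP[xr|xr].
    have x1 : 1 <= x by lra.
    have [|/andP[a1 a2] /andP[b1 b2] e1] := @tail_mul c x (f x) _ x1 (tail_right xr).
      by rewrite c0.
    have v1 : x^-1 <= 1 by rewrite invf_le1//; lra.
    split; [by rewrite ger0_norm//; lra|by rewrite ger0_norm|].
    by rewrite h_right ?(ltW xr)// sub0r mulNr.
  have x1 : 1 <= - x by lra.
  have := tail_left xr; rewrite opprK => tl.
  have [|/andP[a1 a2] /andP[b1 b2] e1] := @tail_mul (1 - c) (- x) (f x) _ x1 tl.
    by apply/andP; split; lra.
  have v1 : (- x)^-1 <= 1 by rewrite invf_le1//; lra.
  split; [by rewrite ger0_norm//; lra| |].
    by rewrite -normrN -mulNr ger0_norm.
  rewrite h_left; last by lra.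
  by move: e1; rewrite sqrrN mulrN opprK.
have [k1 k2 k3] := key; split; [lra| |lra].
by rewrite (le_trans (ler_normD _ _))//; lra.
Qed.

(** As [h] is merely Lipschitz, the quadratic remainder comes from a Lipschitz bound on f' = x f + h
    - c instead of a second derivative: x f has the bounded derivative f + x f', and the mean value
    theorem concludes. *)
Theorem stein_solution : exists (f df : R -> R) (M : R),
  [/\ forall x, df x - x * f x = h x - c,
      forall x, `|f x| <= M /\ `|df x| <= M,
      forall x y, `|f x - f y| <= M * `|x - y|,
      forall w u, 0 <= u -> `|f (w + u) - f w - u * df w| <= M * u ^+ 2 &
      f x @[x --> +oo%R] --> (0 : R) /\ measurable_fun [set: R] df].
Proof.
have r1 := rho_ge1.
pose B := F0 * (1 + rho ^+ 2) + rho + 1.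
pose M := Num.max (F0 + 1) (Num.max (rho * F0 + 2) (B + K)).
have M1 : F0 + 1 <= M by rewrite le_max lexx.
have M2 : rho * F0 + 2 <= M by rewrite !le_max lexx orbT.
have M3 : B + K <= M by rewrite !le_max lexx !orbT.
have p_lip x y : `|x * f x - y * f y| <= B * `|x - y|.
  apply: (@derive_bounded_lipschitz _ (fun z => z * f z) (fun z => f z + z * df z)).
    move=> z; have := is_derive_mul (is_derive_id z (1 : R)) (f_derive z).
    by apply: is_derive_fun => //=; rewrite mulr1 addrC.
  by move=> z; have [] := stein_bounds z.
have df_lip x y : `|df x - df y| <= (B + K) * `|x - y|.
  have -> : df x - df y = (x * f x - y * f y) + (h x - h y) by rewrite /df; ring.
  by rewrite (le_trans (ler_normD _ _))// mulrDl lerD.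
exists f, df, M; split.
- by move=> x; rewrite /df addrC addKr.
- move=> x; have [b1 b2 _] := stein_bounds x; split.
    exact: le_trans M1.
  exact: le_trans M2.
- move=> x y; apply: (derive_bounded_lipschitz f_derive) => z.
  by have [_ b2 _] := stein_bounds z; exact: le_trans M2.
- move=> w u; rewrite le_eqVlt => /orP[/eqP <-|u0].
    by rewrite addr0 subrr mul0r subr0 normr0 expr0n mulr0.
  have wu : w < w + u by rewrite ltrDl.
  have [z /andP[z1 z2] E] := mean_value wu (fun z _ => f_derive z).
  have -> : f (w + u) - f w - u * df w = u * (df z - df w).
    by rewrite E; ring.
  rewrite normrM (gtr0_norm u0) mulrC (le_trans (ler_wpM2r (ltW u0) (df_lip _ _)))//.
  have zw : `|z - w| <= u by rewrite ger0_norm; lra.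
  rewrite expr2 mulrA ler_pM2r// (@le_trans _ _ (M * `|z - w|))//.
    by rewrite ler_wpM2r.
  by rewrite ler_wpM2l// (le_trans _ M1)// addr_ge0.
split; last first.
  apply: measurable_funD; last first.
    apply: measurable_funB; last exact: measurable_cst.
    exact: continuous_measurable_fun.
  apply: measurable_funM => //; apply: continuous_measurable_fun => x.
  exact: derive_continuous (f_derive x).
apply/cvgrPdist_le => e e0; near=> x.
have rx : rho < x by near: x; apply: nbhs_pinfty_gt; exact: num_real.
have ex : e^-1 <= x by near: x; apply: nbhs_pinfty_ge; exact: num_real.
have x1 : 1 <= x by lra.
have [|/andP[a1 a2] _ _] := @tail_mul c x (f x) _ x1 (tail_right rx).
  exact: stein_mean_itv.
rewrite sub0r normrN ger0_norm// (le_trans a2)//.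
by rewrite -[leRHS]invrK lef_pV2 ?posrE ?invr_gt0//; lra.
Unshelve. all: by end_near. Qed.

End stein_equation.

(** * The integrated tail *)

Section integrated_tail_formula.
Context (R : realType) (Pi : {measure set (measurableTypeR R) -> \bar R}).
Context (hPi : is_subordinator_levy_measure Pi).
Let D : set R := [set` `]0%R, +oo[].

(** Markov's inequality: above [e] the function min(1, x) is at least min(1, e). *)
Lemma levy_tail_fin e : 0 < e -> (Pi [set` `]e, +oo[] < +oo)%E.
Proof.
move=> e0; have [_ fin1] := hPi.
have mE : measurable ([set` `]e, +oo[] : set (measurableTypeR R)).
  exact: measurable_itv.
have mD : measurable (D : set (measurableTypeR R)) by exact: measurable_itv.
pose k := Num.min 1 e; have k0 : 0 < k by rewrite lt_min ltr01.
have mmin : measurable_fun [set: measurableTypeR R] (fun x : R => (Num.min 1 x)%:E).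
  apply/measurable_EFinP; apply: measurable_minr => //; exact: measurable_cst.
have : (k%:E * Pi [set` `]e, +oo[] < +oo)%E.
  apply: le_lt_trans fin1.
  rewrite -integral_cst//.
  apply: (@le_trans _ _ (\int[Pi]_(x in [set` `]e, +oo[]) (Num.min 1 x)%:E)%E).
    apply: ge0_le_integral => //.
    - by move=> x _; rewrite lee_fin ltW.
    - exact: measurable_funTS.
    - move=> x; rewrite /= in_itv/= andbT => ex.
      by rewrite lee_fin le_min !ge_min lexx/= (ltW ex) orbT.
  apply: ge0_subset_integral => //.
  - exact: measurable_funTS.
  - move=> x; rewrite /D /= in_itv/= andbT => x0.
    by rewrite lee_fin le_min ler01 ltW.
  - move=> x; rewrite /D /= !in_itv/= !andbT; exact: lt_trans.
rewrite !ltNge !leye_eq; apply: contra => /eqP ->.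
by rewrite gt0_muley// lte_fin.
Qed.

Lemma levy_sigma_finite : sigma_finite setT Pi.
Proof.
have [Pi0 _] := hPi.
exists (fun n => if n is n'.+1 then [set` `]n'.+1%:R^-1, +oo[] else [set` `]-oo, 0%R]]).
  apply/seteqP; split => // x _; have [x0|x0] := ltP 0 x; last first.
    by exists 0%N => //=; rewrite in_itv/=.
  have := near_infty_natSinv_lt (PosNum x0) => /= -[n _ /(_ n)] /= H.
  by exists n.+1 => //=; rewrite in_itv/= andbT; apply: H => /=.
case=> [|n]; split; try exact: measurable_itv.
  by rewrite Pi0 ltry.
by apply: levy_tail_fin; rewrite invr_gt0.
Qed.

(** A copy of [Pi] that carries the sigma-finite structure required by Tonelli's theorem. *)
Let Pi' : set (measurableTypeR R) -> \bar R := Pi.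

#[local] HB.instance Definition _ := isMeasure.Build _ _ _ Pi'
  (measure0 Pi) (measure_ge0 Pi) (@measure_semi_sigma_additive _ _ _ Pi).

#[local] HB.instance Definition _ :=
  Measure_isSigmaFinite.Build _ _ _ Pi' levy_sigma_finite.

(** Tonelli on the region 0 < y < min(x, delta): its sections have measure Pi(]y, +oo[) in one
    direction and length min(x, delta) in the other. *)
Lemma integrated_tailE delta : 0 < delta ->
  integrated_tail Pi delta = \int[Pi]_(x in [set` `]0%R, +oo[]) Num.min x delta.
Proof.
move=> d0; have [Pi0 _] := hPi.
pose A : set (measurableTypeR R * measurableTypeR R) :=
  [set p | (0 < p.2) && (p.2 < Num.min p.1 delta)].
have mA : measurable A.
  pose f02 (p : measurableTypeR R * measurableTypeR R) : bool := 0 < p.2.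
  pose f21 (p : measurableTypeR R * measurableTypeR R) : bool := p.2 < Num.min p.1 delta.
  rewrite [X in measurable X](_ : _ = f02 @^-1` [set true] `&` f21 @^-1` [set true]).
    apply: measurableI.
    - have : measurable_fun setT f02 by exact: measurable_fun_ltr.
      by move=> /(_ measurableT [set true]); rewrite setTI; exact.
    - have : measurable_fun setT f21.
        apply: measurable_fun_ltr => //; exact: measurable_minr.
      by move=> /(_ measurableT [set true]); rewrite setTI; exact.
  by apply/seteqP; split => p /=; [move=> /andP|move=> /andP].
have := @indic_fubini_tonelli _ _ _ _ R Pi' (@lebesgue_measure R) A mA.
rewrite /fubini_F /fubini_G => E.
rewrite /integrated_tail /Rintegral; congr fine.
transitivity (\int[@lebesgue_measure R]_y (\int[Pi']_x (EFin \o \1_A) (x, y)))%E.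
  rewrite [LHS]integral_mkcond; apply: eq_integral => y _.
  rewrite patchE; case: ifPn => [|/negP].
    rewrite inE /= in_itv/= => /andP[y0 yd].
    transitivity (\int[Pi']_x (\1_[set` `]y, +oo[] x)%:E)%E.
      by rewrite integral_indic ?setIT//; exact: measurable_itv.
    apply: eq_integral => x _; congr EFin; rewrite !indicE; congr (nat_of_bool _)%:R.
    rewrite /A; apply/idP/idP; rewrite !inE /= in_itv/= andbT.
      by move=> yx; rewrite y0 lt_min yx yd.
    by rewrite lt_min => /andP[_ /andP[]].
  rewrite inE /= in_itv/= => yN; apply/esym/integral0_eq => x _ /=.
  rewrite indicE memNset// /A /= => /andP[y0]; rewrite lt_min => /andP[_ yd].
  by apply: yN; rewrite y0.
rewrite -E [RHS]integral_mkcond; apply: eq_integral => x _.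
transitivity (@lebesgue_measure R [set` `]0%R, (Num.min x delta)[]).
  transitivity (\int[@lebesgue_measure R]_y
      (\1_[set` `]0%R, (Num.min x delta)[] y)%:E)%E.
    by apply: eq_integral => y _; congr EFin; rewrite !indicE; congr (nat_of_bool _)%:R.
  by rewrite integral_indic ?setIT//; exact: measurable_itv.
rewrite lebesgue_measure_itv/= lte_fin patchE; case: ifPn => xd; case: ifPn => //.
- by rewrite -EFinB subr0.
- move=> /negP; rewrite inE /= in_itv/= andbT => /negP.
  by move: xd; rewrite lt_min => /andP[->].
- rewrite inE /= in_itv/= andbT => x0.
  by move: xd; rewrite lt_min x0 d0.
Qed.

End integrated_tail_formula.

(** * The Stein bound *)

Section stein_bound.
Context d (T : measurableType d) (R : realType) (P : probability T R).
Context (X : R -> {RV P >-> R}) (b : R).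
Context (Pi : {measure set (measurableTypeR R) -> \bar R}).
Context (hX : is_subordinator X) (hbPi : has_drift_levy_measure X b Pi).
Context (t : R) (t_gt0 : 0 < t) (delta : R) (delta_gt0 : 0 < delta).
Let D : set R := [set` `]0%R, +oo[].
Let mD : measurable (D : set (measurableTypeR R)).
Proof. exact: measurable_itv. Qed.

Let y (x : R) : R := Num.min x delta.
Let hPi : is_subordinator_levy_measure Pi. Proof. by case: hbPi. Qed.

Let D_gt0 x : D x -> 0 < x. Proof. by rewrite /D /= in_itv/= andbT. Qed.

Let y_gt0 x : D x -> 0 < y x.
Proof. by move=> /D_gt0 x0; rewrite /y lt_min x0. Qed.

Let y_le x : y x <= delta. Proof. by rewrite ge_min lexx orbT. Qed.

Let my : measurable_fun [set: R] y.
Proof. by apply: measurable_minr => //; exact: measurable_cst. Qed.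

Let min1_bound x : 0 < x -> y x <= (1 + delta) * Num.min 1 x.
Proof.
move=> x0; have [x1|x1] := ltP 1 x.
  by rewrite mulr1 (le_trans (y_le x))// lerDr.
by rewrite ge_min ler_peMl ?(ltW x0)// lerDl ltW.
Qed.

Let iy : Pi.-integrable D (fun x => (y x)%:E).
Proof.
apply: (levy_integrable hPi (C := 1 + delta)) => // x x0.
by rewrite ger0_norm ?min1_bound// le_min !ltW.
Qed.

Definition truncated_variance : R :=
  \int[Pi]_(x in [set` `]0%R, +oo[]) (Num.min x delta) ^+ 2.
Local Notation s2 := truncated_variance.

Let iy2 : Pi.-integrable D (fun x => (y x ^+ 2)%:E).
Proof.
apply: (levy_integrable hPi (C := delta * (1 + delta))).
  exact: measurable_funX.
move=> x x0; have y0 : 0 <= y x by rewrite le_min !ltW.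
rewrite ger0_norm ?exprn_ge0// expr2 -mulrA ler_pM// min1_bound//.
Qed.

Lemma truncated_variance_ge0 : 0 <= s2.
Proof. by apply: Rintegral_ge0 => x _; exact: sqr_ge0. Qed.

Let U := shortened b X delta t.
Let m := b + \int[Pi]_(x in D) y x.
Let s := Num.sqrt (t * s2).

Context (s_gt0 : 0 < s).

Let s_sq : s ^+ 2 = t * s2.
Proof. by rewrite sqr_sqrtr// mulr_ge0 ?truncated_variance_ge0// ltW. Qed.

Let W w := (U w - t * m) / s.

(** Insert F(z) = f((z - tm)/s) into the size-bias identity. The drift cancels against its share of
    the centring, and s = t s2 / s turns s E f'(W) into an integral against y^2 Pi; what remains
    under [Pi] is y times a Taylor remainder of size M (y / s)^2. *)
Lemma stein_bound (f df : R -> R) (M : R) :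
  (forall x, `|f x| <= M /\ `|df x| <= M) ->
  (forall x z, `|f x - f z| <= M * `|x - z|) ->
  (forall w u, 0 <= u -> `|f (w + u) - f w - u * df w| <= M * u ^+ 2) ->
  f x @[x --> +oo%R] --> (0 : R) -> measurable_fun [set: R] df ->
  `|\int[P]_w (df (W w) - W w * f (W w))| <= M * (delta / s).
Proof.
move=> fM flip ftaylor f0 mdf.
have M0 : 0 <= M by have [h _] := fM 0; exact: le_trans h.
have sN : s != 0 by rewrite gt_eqF.
pose F z := f ((z - t * m) / s).
have FM x : `|F x| <= M by have [] := fM ((x - t * m) / s).
have Flip x z : `|F x - F z| <= M / s * `|x - z|.
  rewrite (le_trans (flip _ _))// -mulrA ler_wpM2l//.
  by rewrite -mulrBl opprB addrA subrK normrM normfV (gtr0_norm s_gt0) mulrC.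
have F0 : F x @[x --> +oo%R] --> (0 : R).
  apply: (@cvg_comp _ _ _ (fun x => (x - t * m) / s) f _ +oo%R) => //.
  apply/cvgryPge => A; near=> x; rewrite ler_pdivlMr// lerBrDr.
  by near: x; apply: nbhs_pinfty_ge; exact: num_real.
have mf : measurable_fun [set: R] f.
  apply: continuous_measurable_fun => x; apply/cvgrPdist_le => e e0.
  have M1 : 0 < M + 1 by rewrite ltr_wpDl.
  near=> z; rewrite (le_trans (flip _ _))//.
  have : `|x - z| <= e / (M + 1).
    by near: z; apply: cvgr_dist_le; [exact: cvg_id|rewrite divr_gt0].
  by rewrite ler_pdivlMr// mulrC; apply: le_trans; rewrite ler_wpM2r// lerDl.
have maff : measurable_fun [set: R] (fun z => (z - t * m) / s).
  by apply: measurable_funM => //; apply: measurable_funB.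
have mF : measurable_fun [set: R] F by exact: (measurableT_comp mf).
have mU : measurable_fun [set: T] U by exact: measurable_shortened.
have [mPsi ident] := shortened_identity hX hbPi t_gt0 delta_gt0 FM Flip F0.
pose Psi z := jump_transform Pi delta F z.
pose G w := df (W w).
have mW : measurable_fun [set: T] W by exact: (measurableT_comp maff).
have iG : P.-integrable setT (fun w => (G w)%:E).
  apply: (@bounded_integrable _ _ _ P _ M); first exact: (measurableT_comp mdf).
  by move=> w; have [_] := fM (W w).
have iFU : P.-integrable setT (fun w => (F (U w))%:E).
  by apply: (@bounded_integrable _ _ _ P _ M) => //; exact: (measurableT_comp mF).
have iUF : P.-integrable setT (fun w => (U w * F (U w))%:E).
  have iU := shortened_integrable hX hbPi t_gt0 delta_gt0.
  apply: (@le_integrable _ _ _ P setT measurableT _ (fun w => (M * U w)%:E)).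
  - apply/measurable_EFinP; apply: measurable_funM => //.
    exact: (measurableT_comp mF).
  - move=> w _; have U0 : 0 <= U w by exact: (shortened_ge0 hX hbPi).
    rewrite /= lee_fin normrM (ger0_norm U0) mulrC.
    by rewrite (le_trans _ (ler_norm _))// ler_wpM2r.
  - exact: integrable_scaler.
have iPsi0 z : Pi.-integrable D (fun x => (y x * F (z + y x))%:E).
  apply: (levy_integrable hPi (C := (1 + delta) * M)).
    apply: measurable_funM => //; apply: (measurableT_comp mF).
    exact: measurable_funD.
  move=> x x0; have y0 : 0 <= y x by rewrite le_min !ltW.
  rewrite normrM (ger0_norm y0) mulrAC.
  by apply: ler_pM => //; exact: min1_bound.
(* One factor of y^3 is bounded by [delta]; the other two integrate to the truncated variance. *)
have pw z : `|Psi z - (\int[Pi]_(x in D) y x) * F z - s2 / s * df ((z - t * m) / s)|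
    <= M * delta / s ^+ 2 * s2.
  set w0 := (z - t * m) / s.
  have -> : Psi z - (\int[Pi]_(x in D) y x) * F z - s2 / s * df w0 =
      \int[Pi]_(x in D) (y x * F (z + y x) - F z * y x - df w0 / s * y x ^+ 2).
    rewrite RintegralB//; last 2 first.
      by apply: integrable_subr => //; exact: integrable_scaler.
      exact: integrable_scaler.
    rewrite RintegralB//; [|exact: iPsi0|exact: integrable_scaler].
    rewrite !RintegralZl//; congr (_ - _ - _); first by rewrite mulrC.
    by rewrite /truncated_variance /y; ring.
  have i1 : Pi.-integrable D (fun x =>
      (y x * F (z + y x) - F z * y x - df w0 / s * y x ^+ 2)%:E).
    apply: integrable_subr => //; last exact: integrable_scaler.
    by apply: integrable_subr => //; exact: integrable_scaler.
  rewrite (le_trans (le_normr_Rintegral _ _))// -RintegralZl//.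
  apply: le_Rintegral => //; [exact: integrable_norm|exact: integrable_scaler|].
  move=> x Dx; have y0 := y_gt0 Dx.
  have -> : y x * F (z + y x) - F z * y x - df w0 / s * y x ^+ 2 =
      y x * (f (w0 + y x / s) - f w0 - y x / s * df w0).
    have Ez : (z + y x - t * m) / s = w0 + y x / s by rewrite /w0; ring.
    by rewrite /F Ez -/w0; ring.
  rewrite normrM (gtr0_norm y0).
  have := ftaylor w0 (y x / s) (divr_ge0 (ltW y0) (ltW s_gt0)).
  move=> /(ler_wpM2l (ltW y0))/le_trans; apply.
  have -> : y x * (M * (y x / s) ^+ 2) = M / s ^+ 2 * y x ^+ 2 * y x by field.
  have -> : M * delta / s ^+ 2 * y x ^+ 2 = M / s ^+ 2 * y x ^+ 2 * delta by ring.
  by rewrite ler_wpM2l// mulr_ge0 ?divr_ge0 ?sqr_ge0.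
have iPsi : P.-integrable setT (fun w => (Psi (U w))%:E).
  apply: (@bounded_integrable _ _ _ P _ (M * \int[Pi]_(x in D) y x)) => // w.
  rewrite (le_trans (le_normr_Rintegral _ (iPsi0 _)))// -RintegralZl//.
  apply: le_Rintegral => //.
  - by apply: integrable_norm; exact: iPsi0.
  - exact: integrable_scaler.
  move=> x Dx; have y0 := ltW (y_gt0 Dx).
  by rewrite normrM (ger0_norm y0) mulrC ler_wpM2r.
have iWf : P.-integrable setT (fun w => (W w * f (W w))%:E).
  rewrite (_ : (fun w => _) =
      (fun w => (s^-1 * (U w * F (U w)) - t * m / s * F (U w))%:E)).
    by apply: integrable_subr => //; exact: integrable_scaler.
  by apply/funext => w; rewrite /F -/(W w) {1}/W; congr EFin; ring.
pose c := \int[Pi]_(x in D) y x.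
have E : s * \int[P]_w (df (W w) - W w * f (W w)) =
    - (t * \int[P]_w (Psi (U w) - c * F (U w) - s2 / s * G w)).
  rewrite RintegralB//.
  have E1 : s * \int[P]_w (W w * f (W w)) =
      \int[P]_w (U w * F (U w)) - t * m * \int[P]_w F (U w).
    rewrite -!RintegralZl// -RintegralB//; last exact: integrable_scaler.
    apply: eq_Rintegral => w _; rewrite /F -/(W w) {1}/W; field.
    exact: sN.
  have E2 : \int[P]_w (b * F (U w) + Psi (U w)) =
      b * \int[P]_w F (U w) + \int[P]_w Psi (U w).
    rewrite RintegralD ?RintegralZl//; exact: integrable_scaler.
  have E3 : \int[P]_w (U w * F (U w)) =
      t * (b * \int[P]_w F (U w) + \int[P]_w Psi (U w)).
    by rewrite -E2; exact: ident.
  rewrite mulrBr E1 E3.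
  rewrite RintegralB//; last 2 first.
    by apply: integrable_subr => //; exact: integrable_scaler.
    exact: integrable_scaler.
  rewrite RintegralB//; last exact: integrable_scaler.
  rewrite !RintegralZl//.
  have -> : s * \int[P]_w df (W w) = t * (s2 / s * \int[P]_w G w).
    by rewrite mulrA [t * _]mulrA -s_sq expr2 mulfK.
  by rewrite /m -/c; ring.
have : s * `|\int[P]_w (df (W w) - W w * f (W w))| <= M * delta.
  rewrite -{1}(gtr0_norm s_gt0) -normrM E normrN normrM (gtr0_norm t_gt0).
  have -> : M * delta = t * (M * delta / s ^+ 2 * s2).
    by rewrite mulrCA -s_sq divfK// expf_neq0.
  rewrite ler_pM2l// (le_trans (le_normr_Rintegral _ _))//.
    apply: integrable_subr => //; last exact: integrable_scaler.
    by apply: integrable_subr => //; exact: integrable_scaler.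
  rewrite -[leRHS](Rintegral_probability_cst P); apply: le_Rintegral => //.
  - apply: integrable_norm.
    apply: integrable_subr => //; last exact: integrable_scaler.
    by apply: integrable_subr => //; exact: integrable_scaler.
  - by apply: (@bounded_integrable _ _ _ P (cst _) `|M * delta / s ^+ 2 * s2|).
by rewrite mulrC -ler_pdivlMr// mulrA.
Unshelve. all: by end_near. Qed.

End stein_bound.

(** * Convergence to the normal law *)

Section ramp.
Context (R : realType).
Implicit Types a e z : R.

Definition ramp a e z : R := Num.min 1 (Num.max 0 ((a + e - z) / e)).

Lemma ramp_itv a e z : 0 <= ramp a e z <= 1.
Proof. by rewrite /ramp le_min ler01 le_max lexx/= ge_min lexx. Qed.

Lemma ramp_left a e z : 0 < e -> z <= a -> ramp a e z = 1.
Proof.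
move=> e0 za; rewrite /ramp min_l// le_max; apply/orP; right.
by rewrite ler_pdivlMr//; lra.
Qed.

Lemma ramp_right a e z : 0 < e -> a + e <= z -> ramp a e z = 0.
Proof.
move=> e0 az; have h : (a + e - z) / e <= 0 by rewrite ler_pdivrMr// mul0r; lra.
by rewrite /ramp max_l// min_r.
Qed.

Lemma ramp_lipschitz a e z z' : 0 < e ->
  `|ramp a e z - ramp a e z'| <= e^-1 * `|z - z'|.
Proof.
move=> e0; rewrite /ramp; set u := (a + e - z) / e; set v := (a + e - z') / e.
have -> : e^-1 * `|z - z'| = `|u - v|.
  rewrite -mulrBl (_ : a + e - z - _ = z' - z); last by ring.
  by rewrite normrM normfV (gtr0_norm e0) mulrC distrC.
have h1 : u - v <= `|u - v| by exact: ler_norm.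
have h2 : v - u <= `|u - v| by rewrite distrC; exact: ler_norm.
rewrite ler_norml /Num.min /Num.max.
by case: (ltP 0 u) => ?; case: (ltP 0 v) => ?; apply/andP; split;
  repeat case: ltP => ?; lra.
Qed.

Lemma continuous_ramp (a e : R) : 0 < e -> continuous (ramp a e).
Proof.
move=> e0 x; apply/cvgrPdist_le => eta eta0; near=> z.
rewrite (le_trans (ramp_lipschitz _ _ _ e0))// ler_pdivrMl//.
by near: z; apply: cvgr_dist_le; [exact: cvg_id|rewrite mulr_gt0].
Unshelve. all: by end_near. Qed.

End ramp.

Section gauss_ramp.
Context (R : realType).
Local Notation mu := (@lebesgue_measure R).
Local Notation phi := (normal_pdf 0 1 : R -> R).
Local Notation Phi := (fun x => \int[mu]_(z in [set` `]-oo, x]]) phi z).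

Lemma gauss_cdf_lipschitz (x z : R) : `|Phi x - Phi z| <= normal_peak 1 * `|x - z|.
Proof.
apply: (@derive_bounded_lipschitz _ Phi phi) => u.
  apply: is_derive_lower_integral; last exact: integrable_normal_pdf.
  by apply: continuous_normal_pdf; exact: oner_neq0.
by rewrite ger0_norm ?normal_pdf_ge0// normal_pdf_ub ?oner_neq0.
Qed.

Let iphi : mu.-integrable setT (fun x => (phi x)%:E).
Proof. exact: integrable_normal_pdf. Qed.

Lemma gauss_ramp_bounds (a e : R) : 0 < e ->
  Phi a <= \int[mu]_z (ramp a e z * phi z) <= Phi (a + e).
Proof.
move=> e0.
have p0 z : 0 <= phi z by exact: normal_pdf_ge0.
have cramp : continuous (ramp a e) by exact: continuous_ramp.
have ir : mu.-integrable setT (fun z => (ramp a e z * phi z)%:E).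
  apply: (@le_integrable _ _ _ mu setT measurableT _ (fun x => (phi x)%:E)) => //.
    apply/measurable_EFinP; apply: measurable_funM.
      exact: continuous_measurable_fun.
    exact: measurable_normal_pdf.
  move=> z _; have /andP[r0 r1] := ramp_itv a e z.
  by rewrite /= lee_fin !ger0_norm ?mulr_ge0// ler_piMl.
have mI (x : R) : measurable ([set` `]-oo, x]] : set R) by exact: measurable_itv.
have ires (x : R) : mu.-integrable setT (fun z => ((phi \_ [set` `]-oo, x]]) z)%:E).
  apply: (@le_integrable _ _ _ mu setT measurableT _ (fun z => (phi z)%:E)) => //.
    apply/measurable_EFinP/(measurable_restrictT _ (mI x)).
    by apply: measurable_funTS; exact: measurable_normal_pdf.
  move=> z _; rewrite /= lee_fin patchE; case: ifPn => // _.
  by rewrite normr0.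
apply/andP; split.
- rewrite Rintegral_mkcond.
  apply: le_Rintegral; [exact: measurableT|exact: ires|exact: ir|move=> z _].
  rewrite patchE; case: ifPn => [|_].
    by rewrite inE /= in_itv/= => za; rewrite ramp_left// mul1r.
  by rewrite mulr_ge0//; have /andP[] := ramp_itv a e z.
- rewrite [leRHS]Rintegral_mkcond.
  apply: le_Rintegral; [exact: measurableT|exact: ir|exact: ires|move=> z _].
  have /andP[r0 r1] := ramp_itv a e z.
  rewrite patchE; case: ifPn => [_|/negP]; first by rewrite ler_piMl.
  rewrite inE /= in_itv/= => /negP; rewrite -ltNge => za.
  by rewrite ramp_right ?mul0r// ltW.
Qed.

End gauss_ramp.

(** * Consequences of an infinite Lévy measure *)

Section small_truncation.
Context (R : realType) (Pi : {measure set (measurableTypeR R) -> \bar R}).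
Context (hPi : is_subordinator_levy_measure Pi).
Context (hinf : Pi [set` `]0, +oo[] = +oo%E).

(** Continuity from below along the sets ]1/(n+1), +oo[, then monotonicity in delta. *)
Lemma levy_tail_large (A : R) : \forall delta \near 0^'+,
  (A%:E <= Pi [set` `]delta, +oo[])%E.
Proof.
pose E n : set (measurableTypeR R) := [set` `](n.+1%:R^-1 : R), +oo[].
have mE n : measurable (E n) by exact: measurable_itv.
have UE : \bigcup_n E n = [set` `]0%R, +oo[].
  apply/seteqP; split=> [x [n _]|x]; rewrite /E /= !in_itv/= !andbT.
    by apply: lt_trans; rewrite invr_gt0.
  move=> x0; have [n _ /(_ n)] := near_infty_natSinv_lt (PosNum x0).
  by move=> H; exists n => //=; rewrite in_itv/= andbT; apply: H => /=.
have ndE : nondecreasing_seq E.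
  move=> i j ij; apply/subsetPset => x; rewrite /E /= !in_itv/= !andbT.
  by apply: le_lt_trans; rewrite lef_pV2 ?posrE// ler_nat.
have PU : Pi (\bigcup_n E n) = +oo%E.
  by rewrite -hinf; congr (Pi _); exact: UE.
have mU : measurable (\bigcup_n E n) by exact: bigcup_measurable.
have cE : Pi \o E @ \oo --> +oo%E by rewrite -PU; exact: nondecreasing_cvg_mu.
have [n _ /(_ n (leqnn n)) /= AE] := (cvgeyPge _).1 cE A.
near=> delta; apply: (le_trans AE); apply: le_measure; rewrite ?inE.
- exact: mE.
- exact: measurable_itv.
move=> x; rewrite /E /= !in_itv/= !andbT; apply: le_lt_trans.
near: delta; apply: nbhs_right_le; rewrite invr_gt0//.
Unshelve. all: by end_near. Qed.

Lemma truncated_variance_ge (delta A : R) : 0 < delta -> 0 <= A ->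
  (A%:E <= Pi [set` `]delta, +oo[])%E -> delta ^+ 2 * A <= truncated_variance Pi delta.
Proof.
move=> d0 A0 HA.
have mE : measurable ([set` `]delta, +oo[] : set (measurableTypeR R)).
  exact: measurable_itv.
have mD : measurable ([set` `]0%R, +oo[] : set (measurableTypeR R)).
  exact: measurable_itv.
have m2 : measurable_fun [set: measurableTypeR R]
    (fun x : R => ((Num.min x delta) ^+ 2)%:E).
  apply/measurable_EFinP; apply: measurable_funX; exact: measurable_minr.
have i2 : Pi.-integrable [set` `]0%R, +oo[]
    (fun x : R => ((Num.min x delta) ^+ 2)%:E).
  apply: (levy_integrable hPi (C := delta * (1 + delta))).
    exact/measurable_EFinP.
  move=> x x0; have y0 : 0 <= Num.min x delta by rewrite le_min !ltW.
  rewrite ger0_norm ?exprn_ge0// expr2 -mulrA ler_pM// ?ge_min ?lexx ?orbT//.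
  have [x1|x1] := ltP 1 x.
    by rewrite mulr1 lerDr ler01 orbT.
  by rewrite ler_peMl ?(ltW x0)// lerDl ltW.
rewrite -lee_fin /truncated_variance /Rintegral fineK; last first.
  exact: integrable_fin_num.
rewrite EFinM; apply: (@le_trans _ _ ((delta ^+ 2)%:E * Pi [set` `]delta, +oo[])%E).
  by rewrite lee_pmul2l// lte_fin exprn_gt0.
rewrite -integral_cst//.
apply: (@le_trans _ _
    (\int[Pi]_(x in [set` `]delta, +oo[]) ((Num.min x delta) ^+ 2)%:E)%E).
  apply: ge0_le_integral => //.
  - by move=> x _; rewrite lee_fin sqr_ge0.
  - exact: measurable_funTS.
  - move=> x; rewrite /= in_itv/= andbT => dx.
    by rewrite lee_fin min_r// ltW.
apply: ge0_subset_integral => //.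
- exact: measurable_funTS.
- by move=> x _; rewrite lee_fin sqr_ge0.
- by move=> x; rewrite /= !in_itv/= !andbT; exact: lt_trans.
Qed.

Lemma truncated_ratio_small (t e : R) : 0 < t -> 0 < e -> \forall delta \near 0^'+,
  0 < Num.sqrt (t * truncated_variance Pi delta) /\
  delta / Num.sqrt (t * truncated_variance Pi delta) <= e.
Proof.
(* With tail mass at least [A], t times the truncated variance is at least t delta^2 A = (delta /
   e)^2. *)
move=> t0 e0; pose A := (t * e ^+ 2)^-1.
have A0 : 0 < A by rewrite invr_gt0 mulr_gt0// exprn_gt0.
near=> delta.
have d0 : 0 < delta by near: delta; exact: nbhs_right_gt.
have HA : (A%:E <= Pi [set` `]delta, +oo[])%E.
  by near: delta; exact: levy_tail_large.
have V := truncated_variance_ge d0 (ltW A0) HA.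
have de : 0 <= delta / e by rewrite divr_ge0// ltW.
have le_s : delta / e <= Num.sqrt (t * truncated_variance Pi delta).
  rewrite -(ger0_norm de) -sqrtr_sqr ler_wsqrtr//.
  rewrite -ler_pdivrMl// (le_trans _ V)// /A.
  rewrite [leLHS](_ : _ = delta ^+ 2 * (t * e ^+ 2)^-1)//.
  by field; rewrite !gt_eqF.
have s0 : 0 < Num.sqrt (t * truncated_variance Pi delta).
  by rewrite (lt_le_trans _ le_s)// divr_gt0.
by split => //; rewrite ler_pdivrMr// mulrC -ler_pdivrMr.
Unshelve. all: by end_near. Qed.

End small_truncation.

Section ramp_expectation.
Context d (T : measurableType d) (R : realType) (P : probability T R).
Context (W : T -> R) (mW : measurable_fun [set: T] W).

Lemma measurable_ramp (a e : R) : 0 < e ->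
  measurable_fun [set: T] (fun w => ramp a e (W w)).
Proof.
move=> e0; have cr : measurable_fun [set: R] (ramp a e).
  by apply: continuous_measurable_fun; exact: continuous_ramp.
exact: (measurableT_comp cr mW).
Qed.

Lemma ramp_expectation_bounds (x e : R) : 0 < e ->
  \int[P]_w ramp (x - e) e (W w) <= fine (P (W @^-1` [set` `]-oo, x]])) <=
  \int[P]_w ramp x e (W w).
Proof.
move=> e0; pose A := W @^-1` [set` `]-oo, x]].
have mA : measurable A.
  by rewrite -[A]setTI; apply: mW => //; exact: measurable_itv.
have -> : fine (P A) = \int[P]_w (\1_A w : R).
  by rewrite /Rintegral integral_indic// setIT.
have iR a : P.-integrable setT (fun w => (ramp a e (W w))%:E).
  apply: (@bounded_integrable _ _ _ P _ 1); first exact: measurable_ramp.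
  by move=> w; have /andP[r0 r1] := ramp_itv a e (W w); rewrite ger0_norm.
have iA : P.-integrable setT (fun w => (\1_A w : R)%:E).
  apply: (@bounded_integrable _ _ _ P (\1_A : T -> R) 1).
    exact: measurable_indic.
  by move=> w; rewrite indicE; case: (w \in A); rewrite ?normr1 ?normr0.
apply/andP; split.
- apply: le_Rintegral; [exact: measurableT|exact: iR|exact: iA|move=> w _].
  have /andP[r0 r1] := ramp_itv (x - e) e (W w).
  rewrite indicE; case: (boolP (w \in A)) => // /negP wA.
  rewrite ramp_right// subrK leNgt; apply/negP => Wx; apply: wA.
  by rewrite inE /A /= in_itv/= ltW.
- apply: le_Rintegral; [exact: measurableT|exact: iA|exact: iR|move=> w _].
  have /andP[r0 r1] := ramp_itv x e (W w).
  rewrite indicE; case: (boolP (w \in A)) => // wA.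
  by rewrite ramp_left//; move: wA; rewrite inE /A /= in_itv.
Qed.

End ramp_expectation.

(** * Convergence of the standardized shortened process *)

Section normal_limit.
Context d (T : measurableType d) (R : realType) (P : probability T R).
Context (X : R -> {RV P >-> R}) (b : R).
Context (Pi : {measure set (measurableTypeR R) -> \bar R}).
Context (hX : is_subordinator X) (hbPi : has_drift_levy_measure X b Pi).
Context (hinf : Pi [set` `]0, +oo[] = +oo%E) (t : R) (t_gt0 : 0 < t).

Let hPi : is_subordinator_levy_measure Pi. Proof. by case: hbPi. Qed.

Definition standardized (delta : R) (w : T) : R :=
  (shortened b X delta t w -
     t * (b + \int[Pi]_(x in [set` `]0%R, +oo[]) Num.min x delta)) /
  Num.sqrt (t * truncated_variance Pi delta).

Lemma measurable_standardized (delta : R) : 0 < delta ->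
  measurable_fun [set: T] (standardized delta).
Proof.
move=> d0; have mS := measurable_shortened b hX t_gt0 d0.
by apply: measurable_funM => //; exact: measurable_funB.
Qed.

(** Numerator and denominator both carry 1 / delta, which cancels; [integrated_tailE] matches the
    two forms of the mean. *)
Lemma standardizedE (delta : R) (w : T) : 0 < delta ->
  (L b X t delta w - t * mu b Pi delta) / (Num.sqrt t * v Pi delta) =
  standardized delta w.
Proof.
move=> d0; have dN : delta != 0 by rewrite gt_eqF.
rewrite /L /mu /v (integrated_tailE hPi d0) /standardized sqrtrM ?(ltW t_gt0)//.
rewrite -/(truncated_variance Pi delta).
move: (shortened _ _ _ _ _) (b + _) => S m.
by rewrite !mulrA -mulrBl [in LHS]invfM invrK [LHS]mulrA mulrAC divfK.
Qed.

Lemma ramp_expectation_cvg (a e : R) : 0 < e ->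
  \int[P]_w ramp a e (standardized delta w) @[delta --> 0^'+] -->
  \int[lebesgue_measure]_z (ramp a e z * normal_pdf 0 1 z).
Proof.
(* Large enough for the ramp to be constant beyond [- rho] and [rho], and at least 1 as the tail
   bounds require. *)
move=> e0; pose rho := 1 + `|a| + e.
have na := ler_norm a; have nNa := ler_norm (- a); rewrite normrN in nNa.
have a0 := normr_ge0 a.
have rho1 : 1 <= rho by rewrite /rho; lra.
have [|x xr|x xr|f [df [M [eq_st bds lip tay [f_lim mdf]]]]] :=
    @stein_solution R (ramp a e) rho e^-1 rho1 (ramp_itv a e).
- by move=> x y; exact: ramp_lipschitz.
- by rewrite ramp_left//; move: xr; rewrite /rho; lra.
- by rewrite ramp_right//; move: xr; rewrite /rho; lra.
set c := (X in _ --> X); apply/cvgrPdist_le => eta eta0.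
have M0 : 0 <= M by have [+ _] := bds 0; apply: le_trans.
near=> delta.
have d0 : 0 < delta by near: delta; exact: nbhs_right_gt.
(* Dividing by [M + 1] covers the case [M = 0]. *)
have [s0 small] : 0 < Num.sqrt (t * truncated_variance Pi delta) /\
    delta / Num.sqrt (t * truncated_variance Pi delta) <= eta / (M + 1).
  near: delta; apply: truncated_ratio_small => //.
  by rewrite divr_gt0// ltr_wpDl.
have := stein_bound hX hbPi t_gt0 d0 s0 bds lip tay f_lim mdf.
rewrite -/(standardized delta).
under eq_Rintegral do rewrite eq_st -/c.
rewrite RintegralB; [|exact: measurableT| |]; last 2 first.
  apply: (@bounded_integrable _ _ _ P _ 1).
    exact: (measurable_ramp (measurable_standardized d0)).
  move=> w; have /andP[? ?] := ramp_itv a e (standardized delta w).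
  by rewrite ger0_norm.
  by apply: (@bounded_integrable _ _ _ P (cst c) `|c|).
rewrite (Rintegral_probability_cst P) distrC => /le_trans; apply.
apply: (@le_trans _ _ (M * (eta / (M + 1)))); first exact: ler_wpM2l.
by rewrite mulrA ler_pdivrMr ?ltr_wpDl// mulrC ler_pM2l// lerDl.
Unshelve. all: by end_near. Qed.

Lemma standardized_cvg (x : R) :
  P (standardized delta @^-1` [set` `]-oo, x]]) @[delta --> 0^'+] -->
  (\int[lebesgue_measure]_(z in [set` `]-oo, x]]) normal_pdf 0 1 z)%:E.
Proof.
apply/fine_cvgP; split.
  near=> delta; have d0 : 0 < delta by near: delta; exact: nbhs_right_gt.
  apply: fin_num_measure; rewrite -[X in measurable X]setTI.
  by apply: (measurable_standardized d0 measurableT); exact: measurable_itv.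
apply/cvgrPdist_le => eta eta0 /=.
pose k : R := normal_peak 1.
have k0 : 0 <= k by exact: normal_peak_ge0.
(* A shift by [e] moves the normal distribution function by at most k e <= eta / 2, [k] being the
   largest density; the other half of [eta] is left for the ramp expectations. *)
pose e := eta / (2 * (k + 1)).
have eta2 : 0 < eta / 2 by rewrite divr_gt0.
have k1 : 0 < k + 1 by rewrite ltr_wpDl.
have e0 : 0 < e by rewrite divr_gt0// mulr_gt0.
have ke : k * e <= eta / 2.
  have -> : k * e = k / (k + 1) * (eta / 2) by rewrite /e; field; rewrite gt_eqF.
  apply: ler_piMl; first by lra.
  by rewrite ler_pdivrMr// mul1r lerDl.
near=> delta.
have d0 : 0 < delta by near: delta; exact: nbhs_right_gt.
have /andP[Pl Pu] := ramp_expectation_bounds P (measurable_standardized d0) x e0.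
have up : `|\int[lebesgue_measure]_z (ramp x e z * normal_pdf 0 1 z) -
    \int[P]_w ramp x e (standardized delta w)| <= eta / 2.
  by near: delta; have /cvgrPdist_le := ramp_expectation_cvg (a := x) e0; exact.
have lo : `|\int[lebesgue_measure]_z (ramp (x - e) e z * normal_pdf 0 1 z) -
    \int[P]_w ramp (x - e) e (standardized delta w)| <= eta / 2.
  by near: delta; have /cvgrPdist_le := ramp_expectation_cvg (a := x - e) e0; exact.
have /andP[_ gu] := gauss_ramp_bounds x e0.
have /andP[gl _] := gauss_ramp_bounds (x - e) e0.
have xe : x + e - x = e by ring.
have ex : x - (x - e) = e by ring.
have := gauss_cdf_lipschitz (x + e) x; rewrite xe (gtr0_norm e0) => ku.
have := gauss_cdf_lipschitz x (x - e); rewrite ex (gtr0_norm e0) => kl.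
move: up lo; rewrite !ler_norml => /andP[? ?] /andP[? ?].
move: (ler_normlW ku) (ler_normlW kl); rewrite -/k => ? ?.
by apply/andP; split; lra.
Unshelve. all: by end_near. Qed.

End normal_limit.

Theorem theorem2p10 (disp : measure_display) (T : measurableType disp)
    (R : realType) (P : probability T R) (X : R -> {RV P >-> R}) (b : R)
    (Pi : {measure set (measurableTypeR R) -> \bar R})
    (hX : is_subordinator X) (hbPi : has_drift_levy_measure X b Pi)
    (hinf : Pi [set` `]0, +oo[] = +oo%E) (t : R) (ht : 0 < t) :
  cvg_in_distribution P (0 : R)^'+
    (fun (delta : R) (w : T) =>
       (L b X t delta w - t * mu b Pi delta) / (Num.sqrt t * v Pi delta))
    (normal_prob 0 1).
Proof.
(* The cancellation of 1 / delta uses [delta > 0], hence an equality near 0 from the right. *)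
have eqZ : \forall delta \near (0 : R)^'+,
    (fun w => (L b X t delta w - t * mu b Pi delta) / (Num.sqrt t * v Pi delta)) =
    standardized X b Pi t delta.
  near=> delta; apply/funext => w; apply: standardizedE => //.
split.
- apply: filterS2 eqZ (nbhs_right_gt 0) => delta -> d0.
  exact: (measurable_standardized b Pi hX ht d0).
- move=> x _; rewrite -[X in _ --> X](gauss_cdfE x).
  apply: cvg_trans (standardized_cvg hX hbPi hinf ht (x := x)).
  by apply: near_eq_cvg; near=> delta; rewrite (near eqZ delta).
Unshelve. all: by end_near. Qed.
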